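(* Let $n\ge 1$ and $k\ge 2$ be integers. For every $\pi\in\mathrm{Irr}(\mathrm{GL}_{kn})$ and every $\sigma\in\mathrm{Irr}(\mathrm{GL}_n)$, there is an isomorphism of complex vector spaces $$\mathrm{Hom}_{\mathrm{GL}_n^{\Delta}\cdot N}\left(\Theta(\pi),\sigma\otimes\psi\right)\;\cong\;\mathrm{Hom}_{\mathrm{GL}_n^{\Delta'}\cdot H}\left(\pi^\vee,\left(|\det|^{(k-2)n/2}\otimes\sigma\right)\otimes\left(|\det|^{(2-k)n/2}\otimes\psi\right)\right).$$
   Context: $F$ is a non-archimedean local field of characteristic $0$ with normalized absolute value $|\cdot|$, and $\psi$ is a fixed nontrivial additive character of $F$. $\mathrm{GL}_m$ also denotes $\mathrm{GL}_m(F)$. All representations are smooth complex representations; $\mathrm{Irr}(G)$ is the set of isomorphism classes of irreducible smooth representations of $G$; $\pi^\vee$ is the contragredient of $\pi$. For a representation $\tau$ of a group $G$, $\tau_G$ denotes the space of $G$-coinvariants. Big theta lift. The Weil representation $\omega$ of the dual pair $(\mathrm{GL}_{kn},\mathrm{GL}_{kn})$ is realized on $\mathcal S(M_{kn}(F))$ (locally constant compactly supported functions on $kn\times kn$ matrices) by $$(\omega(h,g)\varphi)(X)=|\det g|^{-kn/2}\,|\det h|^{kn/2}\,\varphi(g^{-1}Xh),\qquad (h,g)\in \mathrm{GL}_{kn}\times\mathrm{GL}_{kn}.$$ For $\pi\in\mathrm{Irr}(\mathrm{GL}_{kn})$ (a representation of the first factor), $\Theta(\pi):=(\omega\otimes\pi^\vee)_{\mathrm{GL}_{kn}}$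 (coinvariants for the first factor), a smooth representation of the second factor $\mathrm{GL}_{kn}$. Subgroups of $\mathrm{GL}_{kn}$ (matrices are written as $k\times k$ arrays of $n\times n$ blocks): - $N$ is the group of block upper triangular matrices with all diagonal blocks equal to $1_n$. For $x\in N$ with $(i,i+1)$ block $X_i$ ($1\le i\le k-1$), set $\psi(x)=\prod_{i=1}^{k-1}\psi(\mathrm{Tr}(X_i))$; this is a character of $N$. - $\mathrm{GL}_n^{\Delta}=\{\mathrm{diag}(g,\dots,g)\mid g\in\mathrm{GL}_n\}$ ($k$ copies of $g$), which normalizes $N$ and fixes $\psi$. The representation $\sigma\otimes\psi$ of $\mathrm{GL}_n^{\Delta}\cdot N$ is $\mathrm{diag}(g,\dots,g)\,x\mapsto \psi(x)\sigma(g)$. - $H$ is the group of block upper triangular matrices $x$ whose first $k-1$ diagonal blocks equal $1_n$, whose last diagonal block is an arbitrary $g\in\mathrm{GL}_n$, whose $(k-1,k)$ block is $0$, and whose other blocks above the diagonal are arbitrary. Writing $X_i$ for the $(i,i+1)$ block, $1\le i\le k-2$, the character $|\det|^{(2-k)n/2}\otimes\psi$ of $H$ is $$x\mapsto |\det(g)|^{(2-k)n/2}\prod_{i=1}^{k-2}\psi(\mathrm{Tr}(X_i)).$$ - $\mathrm{GL}_n^{\Delta'}=\{\mathrm{diag}(g,\dots,g,1_n)\mid g\in\mathrm{GL}_n\}$ ($k-1$ copies of $g$), which normalizes $H$ and fixes this character. The representation $(|\det|^{(k-2)n/2}\otimes\sigma)\otimes(|\det|^{(2-k)n/2}\otimes\psi)$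 of $\mathrm{GL}_n^{\Delta'}\cdot H$ sends $\mathrm{diag}(g,\dots,g,1_n)\,x$ to $|\det g|^{(k-2)n/2}\sigma(g)$ times the value at $x\in H$ of the character of $H$ above. *)

(* Defs.v *)
From HB Require Import structures.
From mathcomp Require Import all_boot all_order all_algebra.
From mathcomp Require Import all_classical all_reals all_analysis.
From mathcomp Require Import complex freeg.

Set Implicit Arguments.
Unset Strict Implicit.
Unset Printing Implicit Defensive.

Import Order.TTheory GRing.Theory Num.Theory.
Import numFieldNormedType.Exports.

Local Open Scope classical_set_scope.
Local Open Scope ring_scope.
Local Open Scope complex_scope.

Section Submodules.
Variables (C : fieldType) (V : lmodType C).
Implicit Types (S : submodClosed V) (A : set V).

Definition submod S : Type := {v : V | v \in S}.
HB.instance Definition _ S := [isSub of submod S for sval].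
HB.instance Definition _ S := [Choice of submod S by <:].
HB.instance Definition _ S := [SubChoice_isSubLmodule of submod S by <:].

Definition span A : {pred V} :=
  fun v => `[< forall S, (forall a, A a -> a \in S) -> v \in S >].

Lemma spanP A v :
  reflect (forall S, (forall a, A a -> a \in S) -> v \in S) (v \in span A).
Proof. exact: asboolP. Qed.

Lemma span_closed A : GRing.subsemimod_closed (span A).
Proof.
split; first split.
- by apply/spanP => S _; exact: rpred0.
- move=> u v /spanP Au /spanP Av; apply/spanP => S AS.
  by apply: rpredD; [exact: Au|exact: Av].
- by move=> c v /spanP Av; apply/spanP => S AS; apply: rpredZ; exact: Av.
Qed.
HB.instance Definition _ A := GRing.isSubmodClosed.Build C V (span A)
  (span_closed A).

Lemma mem_span A v : A v -> v \in span A.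
Proof. by move=> Av; apply/spanP => S; exact. Qed.

(* [submodClosed] does not inherit from [zmodClosed], which the additive
   quotient [Quotient.quot] asks for. *)
Definition zmod_pred S : {pred V} := fun v => v \in S.
HB.instance Definition _ S := GRing.isZmodClosed.Build V (zmod_pred S)
  (GRing.subsemimod_closedB (GRing.subsemimodClosedP S)).

Definition quotmod S : Type := Quotient.quot (zmod_pred S).
HB.instance Definition _ S := Choice.on (quotmod S).
HB.instance Definition _ S := GRing.Zmodule.on (quotmod S).

Definition quot_proj S (v : V) : quotmod S := (\pi_(Quotient.quot (zmod_pred S)) v)%qT.
Definition quot_scale S (c : C) (x : quotmod S) : quotmod S :=
  quot_proj S (c *: repr (x : Quotient.quot (zmod_pred S))).

Lemma quot_projK S (x : quotmod S) : exists v, x = quot_proj S v.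
Proof. by exists (repr (x : Quotient.quot (zmod_pred S))); rewrite /quot_proj reprK. Qed.

Lemma eq_quot_proj S u v : (quot_proj S u = quot_proj S v) <-> (u - v \in S).
Proof.
rewrite /quot_proj; split=> [/eqP|uvS].
  by rewrite -(@Quotient.idealrBE V (zmod_pred S)) unfold_in.
by apply/eqP; rewrite -(@Quotient.idealrBE V (zmod_pred S)) unfold_in.
Qed.

Lemma quot_repr S v : repr (quot_proj S v : Quotient.quot (zmod_pred S)) - v \in S.
Proof. by rewrite -eq_quot_proj /quot_proj reprK. Qed.

Lemma quot_projB S : zmod_morphism (quot_proj S).
Proof. exact: raddfB. Qed.
HB.instance Definition _ S :=
  GRing.isZmodMorphism.Build V (quotmod S) (quot_proj S) (@quot_projB S).

Lemma quot_scale_proj S c v : quot_scale c (quot_proj S v) = quot_proj S (c *: v).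
Proof. by apply/eq_quot_proj; rewrite -scalerBr rpredZ// quot_repr. Qed.

Lemma quot_scalerA S a b (x : quotmod S) :
  quot_scale a (quot_scale b x) = quot_scale (a * b) x.
Proof. by have [v ->] := quot_projK x; rewrite !quot_scale_proj scalerA. Qed.

Lemma quot_scale1r S : left_id 1 (@quot_scale S).
Proof. by move=> x; have [v ->] := quot_projK x; rewrite quot_scale_proj scale1r. Qed.

Lemma quot_scalerDr S : right_distributive (@quot_scale S) +%R.
Proof.
move=> c x y; have [u ->] := quot_projK x; have [v ->] := quot_projK y.
by rewrite -raddfD !quot_scale_proj scalerDr raddfD.
Qed.

Lemma quot_scalerDl S (x : quotmod S) : {morph (@quot_scale S)^~ x : a b / a + b}.
Proof.
by move=> a b; have [v ->] := quot_projK x; rewrite !quot_scale_proj scalerDl raddfD.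
Qed.

HB.instance Definition _ S := GRing.Zmodule_isLmodule.Build C (quotmod S)
  (@quot_scalerA S) (@quot_scale1r S) (@quot_scalerDr S) (@quot_scalerDl S).

Lemma quot_projZ S : scalable (quot_proj S).
Proof. by move=> c v; rewrite -quot_scale_proj. Qed.
HB.instance Definition _ S :=
  GRing.isScalable.Build C V (quotmod S) *:%R (quot_proj S) (@quot_projZ S).

Definition quot_lift S (W : lmodType C) (f : V -> W) (x : quotmod S) : W :=
  f (repr (x : Quotient.quot (zmod_pred S))).

Lemma quot_liftE S (W : lmodType C) (f : {linear V -> W}) v :
  (forall u, u \in S -> f u = 0) -> quot_lift f (quot_proj S v) = f v.
Proof.
by move=> /(_ _ (quot_repr S v)); rewrite raddfB => /eqP; rewrite subr_eq0 => /eqP.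
Qed.

Lemma quot_lift_linear S (W : lmodType C) (f : {linear V -> W}) :
  (forall u, u \in S -> f u = 0) -> linear (@quot_lift S W f).
Proof.
move=> fS c x y; have [u ->] := quot_projK x; have [v ->] := quot_projK y.
by rewrite -linearP !quot_liftE// linearP.
Qed.

End Submodules.

Definition lin_iso (C : fieldType) (U V : lmodType C) : Prop :=
  exists f : {linear U -> V}, bijective f.

Section Tensor.
Variable C : fieldType.

Lemma fglift_linear (K : choiceType) (M : lmodType C) (f : K -> M) :
  linear (fglift f).
Proof.
have fB x y : fglift f (x - y) = fglift f x - fglift f y.
  exact: lift_is_additive.
have f0 : fglift f 0 = 0 by rewrite -[X in fglift f X](subrr 0) fB subrr.
have fN x : fglift f (- x) = - fglift f x by rewrite -(sub0r x) fB f0 sub0r.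
have fD : {morph fglift f : x y / x + y}.
  by move=> x y; rewrite -[y in LHS]opprK fB fN opprK.
have fS (D : {freeg K / C}) c : fglift f (c *: D) = c *: fglift f D.
  rewrite -[D in RHS]freeg_sumE {1}/GRing.scale/= /fgscale.
  rewrite !(big_morph _ fD f0) scaler_sumr; apply: eq_bigr => x _.
  by rewrite !liftU scalerA.
by move=> c x y; rewrite fD fS.
Qed.
HB.instance Definition _ (K : choiceType) (M : lmodType C) (f : K -> M) :=
  GRing.isLinear.Build C {freeg K / C} M *:%R (fglift f) (fglift_linear f).

Section TensorProduct.
Variables U W : lmodType C.

Inductive tensor_rel : set {freeg (U * W) / C} :=
| TensorDl u u' w : tensor_rel (<< (u + u', w) >> - << (u, w) >> - << (u', w) >>)
| TensorDr u w w' : tensor_rel (<< (u, w + w') >> - << (u, w) >> - << (u, w') >>)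
| TensorZl c u w : tensor_rel (<< (c *: u, w) >> - c *: << (u, w) >>)
| TensorZr c u w : tensor_rel (<< (u, c *: w) >> - c *: << (u, w) >>).

Definition tensor : lmodType C := quotmod (span tensor_rel).
Definition tens (u : U) (w : W) : tensor := quot_proj (span tensor_rel) << (u, w) >>.

Definition tensor_lift (T : lmodType C) (b : U -> W -> T) : tensor -> T :=
  quot_lift (fglift (fun p : U * W => b p.1 p.2)).

Definition bilin (T : lmodType C) (b : U -> W -> T) :=
  (forall w, linear (b^~ w)) /\ (forall u, linear (b u)).

Lemma tensor_lift_rel (T : lmodType C) (b : U -> W -> T) : bilin b ->
  forall x, x \in span tensor_rel -> fglift (fun p : U * W => b p.1 p.2) x = 0.
Proof.
move=> [bl br] x /spanP xS.
pose F : {linear {freeg (U * W) / C} -> T} := fglift (fun p : U * W => b p.1 p.2).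
have FU u w : F << (u, w) >> = b u w by rewrite /F /= liftU scale1r.
pose P : {pred {freeg (U * W) / C}} := fun x => F x == 0.
have PE y : (y \in P) = (F y == 0) by [].
have PS : GRing.subsemimod_closed P.
  split; first split.
  - by rewrite PE (linear0 F).
  - by move=> u v; rewrite !PE (linearD F) => /eqP-> /eqP->; rewrite addr0.
  - by move=> c v; rewrite !PE (linearZ_LR F) => /eqP->; rewrite scaler0.
pose PM := GRing.isSubmodClosed.Build C _ P PS.
pose SP : submodClosed {freeg (U * W) / C} := HB.pack P PM.
suff /xS : forall a, tensor_rel a -> a \in SP by move/eqP.
have blD w u u' : b (u + u') w = b u w + b u' w.
  by have := bl w 1 u u'; rewrite !scale1r.
have brD u w w' : b u (w + w') = b u w + b u w'.
  by have := br u 1 w w'; rewrite !scale1r.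
have bl0 w : b 0 w = 0 by apply: (addrI (b 0 w)); rewrite -blD !addr0.
have br0 u : b u 0 = 0 by apply: (addrI (b u 0)); rewrite -brD !addr0.
have blZ w c u : b (c *: u) w = c *: b u w.
  by have := bl w c u 0; rewrite !addr0 bl0 addr0.
have brZ u c w : b u (c *: w) = c *: b u w.
  by have := br u c w 0; rewrite !addr0 br0 addr0.
move=> _ [u u' w|u w w'|c u w|c u w]; rewrite [_ \in _]PE.
- by rewrite !(linearB F) !FU blD addrAC addrK subrr.
- by rewrite !(linearB F) !FU brD addrAC addrK subrr.
- by rewrite (linearB F) (linearZ_LR F) /= !FU blZ subrr.
- by rewrite (linearB F) (linearZ_LR F) /= !FU brZ subrr.
Qed.

Lemma tensor_liftE (T : lmodType C) (b : U -> W -> T) : bilin b ->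
  forall u w, tensor_lift b (tens u w) = b u w.
Proof.
move=> bb u w.
by rewrite [LHS](quot_liftE _ (tensor_lift_rel bb)) /= liftU scale1r.
Qed.

Lemma tensor_lift_linear (T : lmodType C) (b : U -> W -> T) :
  bilin b -> linear (tensor_lift b).
Proof. by move=> bb; exact: (quot_lift_linear (tensor_lift_rel bb)). Qed.

Lemma tensDl u u' w : tens (u + u') w = tens u w + tens u' w.
Proof.
rewrite -raddfD; apply/eq_quot_proj; rewrite opprD addrA.
exact/mem_span/TensorDl.
Qed.

Lemma tensDr u w w' : tens u (w + w') = tens u w + tens u w'.
Proof.
rewrite -raddfD; apply/eq_quot_proj; rewrite opprD addrA.
exact/mem_span/TensorDr.
Qed.

Lemma tensZl c u w : tens (c *: u) w = c *: tens u w.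
Proof. by rewrite -linearZ; apply/eq_quot_proj; exact/mem_span/TensorZl. Qed.

Lemma tensZr c u w : tens u (c *: w) = c *: tens u w.
Proof. by rewrite -linearZ; apply/eq_quot_proj; exact/mem_span/TensorZr. Qed.

Lemma tensor_ind (P : tensor -> Prop) :
  (forall c u w x, P x -> P (c *: tens u w + x)) -> P 0 -> forall x, P x.
Proof.
move=> Ptens P0 x; have [D ->] := quot_projK x.
rewrite -[D]freeg_sumE raddf_sum /=; elim: (dom D) => [|[u w] s IHs].
  by rewrite big_nil.
rewrite big_cons.
have -> : << coeff (u, w) D *g (u, w) >> = coeff (u, w) D *: << (u, w) >>.
  by apply/eqP/freeg_eqP => p; rewrite coeffZ !coeffU mul1r.
by rewrite linearZ; exact: Ptens.
Qed.

End TensorProduct.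

Definition tensor_map (U U' W W' : lmodType C) (f : U -> U') (g : W -> W') :
    tensor U W -> tensor U' W' :=
  tensor_lift (fun u w => tens (f u) (g w)).

Lemma tensor_map_bilin (U U' W W' : lmodType C) (f : U -> U') (g : W -> W') :
  linear f -> linear g -> bilin (fun u w => tens (f u) (g w)).
Proof.
move=> lf lg; split => [w c u u'|u c w w'].
  by rewrite lf tensDl tensZl.
by rewrite lg tensDr tensZr.
Qed.

Lemma tensor_mapE (U U' W W' : lmodType C) (f : U -> U') (g : W -> W') :
  linear f -> linear g ->
  forall u w, tensor_map f g (tens u w) = tens (f u) (g w).
Proof. by move=> lf lg u w; rewrite [LHS]tensor_liftE//; exact: tensor_map_bilin. Qed.

Lemma tensor_map_linear (U U' W W' : lmodType C) (f : U -> U') (g : W -> W') :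
  linear f -> linear g -> linear (tensor_map f g).
Proof. by move=> lf lg; apply: tensor_lift_linear; exact: tensor_map_bilin. Qed.

End Tensor.
Record rep (C : fieldType) (G : groupType) := Rep {
  rep_space :> lmodType C;
  act : G -> rep_space -> rep_space;
  act_linear : forall g, linear (act g);
  act1 : forall v, act 1%g v = v;
  actM : forall g h v, act (g * h)%g v = act g (act h v)
}.
Arguments act {C G} r g v : rename.
Arguments act_linear {C G} r g : rename.

Section Representations.
Variable C : fieldType.
Implicit Types G H : groupType.

HB.instance Definition _ G (V : rep C G) g :=
  GRing.isLinear.Build C V V *:%R (act V g) (act_linear V g).

Definition irreducible_rep G (V : rep C G) : Prop :=
  (exists v : V, v != 0) /\
  forall S : submodClosed V,
    (forall g v, v \in S -> act V g v \in S) ->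
    (forall v, v \in S -> v = 0) \/ (forall v, v \in S).

Section Subrep.
Variables (G : groupType) (V : lmodType C) (a : G -> V -> V).
Variable S : submodClosed V.
Hypothesis a_linear : forall g, linear (a g).
Hypothesis a1 : forall v, a 1%g v = v.
Hypothesis aM : forall g h v, a (g * h)%g v = a g (a h v).
Hypothesis aS : forall g v, v \in S -> a g v \in S.

Definition sub_act (g : G) (v : submod S) : submod S :=
  Sub (a g (val v)) (aS g (valP v)).

Lemma sub_act_linear g : linear (sub_act g).
Proof. by move=> c u v; apply: val_inj; rewrite /= a_linear. Qed.

Lemma sub_act1 v : sub_act 1%g v = v.
Proof. by apply: val_inj; rewrite /= a1. Qed.

Lemma sub_actM g h v : sub_act (g * h)%g v = sub_act g (sub_act h v).
Proof. by apply: val_inj; rewrite /= aM. Qed.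

Definition sub_rep : rep C G := Rep sub_act_linear sub_act1 sub_actM.
End Subrep.

(* The representation of G * H on which H acts trivially. *)
Section InflateFst.
Variables (G H : groupType) (V : rep C G).

Definition inflate_act (p : G * H) (v : V) : V := act V p.1 v.

Lemma inflate_act_linear p : linear (inflate_act p).
Proof. exact: act_linear. Qed.

Lemma inflate_act1 v : inflate_act 1%g v = v.
Proof. exact: act1. Qed.

Lemma inflate_actM p q v : inflate_act (p * q)%g v = inflate_act p (inflate_act q v).
Proof. exact: actM. Qed.

Definition inflate : rep C (G * H)%type :=
  Rep inflate_act_linear inflate_act1 inflate_actM.
End InflateFst.

Section TensorRep.
Variables (G : groupType) (U W : rep C G).

Definition tensor_act (g : G) : tensor U W -> tensor U W :=
  tensor_map (act U g) (act W g).

Lemma tensor_act_linear g : linear (tensor_act g).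
Proof. by apply: tensor_map_linear; exact: act_linear. Qed.

Lemma tensor_actE g u w : tensor_act g (tens u w) = tens (act U g u) (act W g w).
Proof. by apply: tensor_mapE; exact: act_linear. Qed.

Lemma tensor_act0 g : tensor_act g 0 = 0.
Proof.
apply: (addrI (tensor_act g 0)); rewrite addr0.
by have := tensor_act_linear g 1 0 0; rewrite !scale1r addr0.
Qed.

Lemma tensor_act1 x : tensor_act 1%g x = x.
Proof.
elim/tensor_ind: x => [c u w x IHx|]; last exact: tensor_act0.
by rewrite tensor_act_linear tensor_actE !act1 IHx.
Qed.

Lemma tensor_actM g h x : tensor_act (g * h)%g x = tensor_act g (tensor_act h x).
Proof.
elim/tensor_ind: x => [c u w x IHx|]; last by rewrite !tensor_act0.
by rewrite !tensor_act_linear !tensor_actE !actM IHx.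
Qed.

Definition tensor_rep : rep C G := Rep tensor_act_linear tensor_act1 tensor_actM.
End TensorRep.

Lemma pairM G H (a b : G) (c d : H) :
  ((a, c) * (b, d) = (a * b, c * d))%g.
Proof. by []. Qed.

(* Coinvariants for the first factor of a product, as a representation of the
   second one. *)
Section Coinvariants.
Variables (G H : groupType) (V : rep C (G * H)%type).

Definition coinv_rel : set V :=
  [set x | exists g v, x = act V (g, 1%g) v - v].

Definition coinv : lmodType C := quotmod (span coinv_rel).

Definition coinv_act (h : H) : coinv -> coinv :=
  quot_lift (quot_proj (span coinv_rel) \o act V (1%g, h)).

Lemma coinv_act_rel h x : x \in span coinv_rel ->
  (quot_proj (span coinv_rel) \o act V (1%g, h)) x = 0.
Proof.
move=> /spanP xS; pose F : {linear V -> coinv} := quot_proj (span coinv_rel) \o act V (1%g, h).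
pose P : {pred V} := fun x => F x == 0.
have PE y : (y \in P) = (F y == 0) by [].
have PS : GRing.subsemimod_closed P.
  split; first split.
  - by rewrite PE (linear0 F).
  - by move=> u v; rewrite !PE (linearD F) => /eqP-> /eqP->; rewrite addr0.
  - by move=> c v; rewrite !PE (linearZ_LR F) => /eqP->; rewrite scaler0.
pose PM := GRing.isSubmodClosed.Build C _ P PS.
pose SP : submodClosed V := HB.pack P PM.
suff /xS : forall a, coinv_rel a -> a \in SP by move/eqP.
move=> _ [g [v ->]]; rewrite [_ \in _]PE (linearB F) /F /= subr_eq0.
apply/eqP/eq_quot_proj/mem_span; exists g, (act V (1%g, h) v).
rewrite -!actM; congr (act V _ _ - _).
by rewrite !pairM !mulg1 !mul1g.
Qed.

Lemma coinv_actE h v : coinv_act h (quot_proj (span coinv_rel) v) =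
  quot_proj (span coinv_rel) (act V (1%g, h) v).
Proof. exact: (quot_liftE _ (@coinv_act_rel h)). Qed.

Lemma coinv_act_linear h : linear (coinv_act h).
Proof. exact: (quot_lift_linear (@coinv_act_rel h)). Qed.

Lemma coinv_act1 x : coinv_act 1%g x = x.
Proof. by have [v ->] := quot_projK x; rewrite coinv_actE act1. Qed.

Lemma coinv_actM g h x : coinv_act (g * h)%g x = coinv_act g (coinv_act h x).
Proof.
have [v ->] := quot_projK x; rewrite !coinv_actE -actM.
by congr (quot_proj _ (act V _ v)); rewrite pairM mulg1.
Qed.

Definition coinv_rep : rep C H := Rep coinv_act_linear coinv_act1 coinv_actM.
End Coinvariants.

Section Intertwiners.
Variables (I : Type) (D : set I) (V W : lmodType C).
Variables (a : I -> V -> V) (b : I -> {linear W -> W}).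

Definition intertwiner : {pred (V -> W)} := fun f =>
  `[< linear f /\ forall i, D i -> forall v, f (a i v) = b i (f v) >].

Lemma intertwiner_closed : GRing.subsemimod_closed intertwiner.
Proof.
split; first split.
- apply/asboolP; split=> [c u v|i _ v]; first by rewrite /= scaler0 addr0.
  by rewrite /= linear0.
- move=> f g /asboolP[lf fab] /asboolP[lg gab]; apply/asboolP.
  split=> [c u v|i Di v]; last by rewrite !fctE fab// gab// linearD.
  by rewrite !fctE lf lg scalerDr addrACA.
- move=> c f /asboolP[lf fab]; apply/asboolP.
  split=> [d u v|i Di v]; last by rewrite !fctE fab// linearZ.
  by rewrite !fctE lf scalerDr !scalerA mulrC.
Qed.
HB.instance Definition _ := GRing.isSubmodClosed.Build C _ intertwiner
  intertwiner_closed.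

Definition hom_space : lmodType C := submod intertwiner.
End Intertwiners.

End Representations.

Section GeneralLinearGroup.
Variables (F : fieldType) (m : nat).

Definition GL : Type := {A : 'M[F]_m | A \in unitmx}.
HB.instance Definition _ := [isSub of GL for sval].
HB.instance Definition _ := [Choice of GL by <:].

Lemma GL_mul_subproof (g h : GL) : val g *m val h \in unitmx.
Proof. by rewrite unitmx_mul (valP g) (valP h). Qed.

Lemma GL_inv_subproof (g : GL) : invmx (val g) \in unitmx.
Proof. by rewrite unitmx_inv (valP g). Qed.

Definition GL_one : GL := Sub 1%:M (unitmx1 F m).
Definition GL_mul (g h : GL) : GL :=
  Sub (val g *m val h) (GL_mul_subproof g h).
Definition GL_inv (g : GL) : GL :=
  Sub (invmx (val g)) (GL_inv_subproof g).

Lemma GL_mulA : associative GL_mul.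
Proof. by move=> f g h; apply: val_inj; rewrite /= mulmxA. Qed.
Lemma GL_mul1 : left_id GL_one GL_mul.
Proof. by move=> g; apply: val_inj; rewrite /= mul1mx. Qed.
Lemma GL_mulr1 : right_id GL_one GL_mul.
Proof. by move=> g; apply: val_inj; rewrite /= mulmx1. Qed.
Lemma GL_mulV : left_inverse GL_one GL_inv GL_mul.
Proof. by move=> g; apply: val_inj; rewrite /= mulVmx// (valP g). Qed.
Lemma GL_mulrV : right_inverse GL_one GL_inv GL_mul.
Proof. by move=> g; apply: val_inj; rewrite /= mulmxV// (valP g). Qed.

HB.instance Definition _ :=
  isGroup.Build GL GL_mulA GL_mul1 GL_mulr1 GL_mulV GL_mulrV.

Lemma GL_valM (g h : GL) : val (g * h)%g = val g *m val h.
Proof. by []. Qed.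
Lemma GL_val1 : val (1%g : GL) = 1%:M.
Proof. by []. Qed.
Lemma GL_valV (g : GL) : val (g^-1)%g = invmx (val g).
Proof. by []. Qed.
End GeneralLinearGroup.

(* The non-archimedean local fields with their normalized absolute value
   (|uniformizer|^-1 = cardinality of the residue field).  They are complete,
   discretely valued and not discrete as a consequence of the axioms. *)
HB.mixin Record isNonArchLocalField (R : realType) F
    of GRing.Field F & Topological F := {
  absF : F -> R;
  absF_ge0 : forall x, 0 <= absF x;
  absF_eq0 : forall x, (absF x == 0) = (x == 0);
  absFM : {morph absF : x y / x * y};
  absF_ultra : forall x y, absF (x + y) <= Num.max (absF x) (absF y);
  nbhs_absF : forall x : F,
    nbhs x = filter_from [set e : R | 0 < e] (fun e => [set y | absF (x - y) < e]);
  absF_locally_compact : locally_compact [set: F];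
  absF_normalized : exists (q : nat) (pi : F),
    [/\ ([set [set y | absF (x - y) < 1] | x in [set x | absF x <= 1]] #= `I_q)%card,
        absF pi = q%:R^-1 &
        forall x, absF x < 1 -> absF x <= absF pi]
}.
#[short(type="nonArchLocalFieldType")]
HB.structure Definition NonArchLocalField (R : realType) :=
  {F of GRing.Field F & Topological F & isNonArchLocalField R F}.

Section LocalFieldTopology.
Variables (R : realType) (F : nonArchLocalFieldType R).

Lemma absF1 : absF (1 : F) = 1.
Proof.
have n0 : absF (1 : F) != 0 by rewrite absF_eq0 oner_neq0.
by apply: (mulfI n0); rewrite -absFM !mulr1.
Qed.

Lemma absFN (x : F) : absF (- x) = absF x.
Proof.
rewrite -mulN1r absFM; suff -> : absF (- 1 : F) = 1 by rewrite mul1r.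
have : absF (- 1 : F) ^+ 2 == 1 by rewrite expr2 -absFM mulrNN mulr1 absF1.
by rewrite sqrf_eq1 => /orP[/eqP//|/eqP h]; have := absF_ge0 (- 1 : F); rewrite h ler0N1.
Qed.

Lemma nbhsF (x : F) (A : set F) :
  nbhs x A <-> exists2 e : R, 0 < e & forall y, absF (x - y) < e -> A y.
Proof. by rewrite nbhs_absF; split=> -[e e0 eA]; exists e. Qed.

Lemma near_absF (x : F) (e : R) : 0 < e -> \forall y \near x, absF (x - y) < e.
Proof. by move=> e0; apply/nbhsF; exists e. Qed.

Lemma continuousF (T : topologicalType) (f : T -> F) :
  (forall x (e : R), 0 < e -> \forall y \near x, absF (f x - f y) < e) ->
  continuous f.
Proof.
move=> H x A /nbhsF[e e0 eA]; apply: filterS (H x e e0) => y; exact: eA.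
Qed.

Lemma continuousF_near (T : topologicalType) (f : T -> F) x (e : R) :
  continuous f -> 0 < e -> \forall y \near x, absF (f x - f y) < e.
Proof. by move=> fc e0; exact: (fc x _ (near_absF (f x) e0)). Qed.

Lemma continuousF_cst (T : topologicalType) (c : F) :
  continuous (fun _ : T => c).
Proof.
by apply: continuousF => x e e0; apply: filterE => y; rewrite subrr (eqP (_ : absF 0 == 0)) ?absF_eq0.
Qed.

Lemma continuousFD (T : topologicalType) (f g : T -> F) :
  continuous f -> continuous g -> continuous (fun x => f x + g x).
Proof.
move=> fc gc; apply: continuousF => x e e0.
near=> y; rewrite opprD addrACA (le_lt_trans (absF_ultra _ _))// gt_max.
by apply/andP; split; near: y; exact: continuousF_near.
Unshelve. all: by end_near. Qed.

Lemma continuousFM (T : topologicalType) (f g : T -> F) :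
  continuous f -> continuous g -> continuous (fun x => f x * g x).
Proof.
move=> fc gc; apply: continuousF => x e e0.
have fx0 : 0 < absF (f x) + 1 by rewrite ltr_wpDl// absF_ge0.
have gx0 : 0 < absF (g x) + 2 by rewrite ltr_wpDl// absF_ge0.
near=> y.
have -> : f x * g x - f y * g y = f x * (g x - g y) + (f x - f y) * g y.
  by rewrite mulrBr mulrBl addrA subrK.
rewrite (le_lt_trans (absF_ultra _ _))// gt_max !absFM; apply/andP; split.
  apply: (@le_lt_trans _ _ ((absF (f x) + 1) * absF (g x - g y))).
    by rewrite ler_wpM2r ?absF_ge0// lerDl.
  rewrite mulrC -ltr_pdivlMr//; near: y.
  by apply: continuousF_near => //; exact: divr_gt0.
apply: (@le_lt_trans _ _ (absF (f x - f y) * (absF (g x) + 2))).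
  rewrite ler_wpM2l ?absF_ge0//.
  have -> : g y = g x + - (g x - g y) by rewrite opprB addrC subrK.
  rewrite (le_trans (absF_ultra _ _))// ge_max lerDl ler0n/= absFN.
  apply: ltW; apply: (@lt_le_trans _ _ 1).
    by near: y; exact: continuousF_near.
  by rewrite ler_wpDl ?absF_ge0 ?ler1n.
rewrite -ltr_pdivlMr//; near: y.
by apply: continuousF_near => //; exact: divr_gt0.
Unshelve. all: by end_near. Qed.

Lemma continuousF_sum (T : topologicalType) (I : Type) (r : seq I)
    (f : I -> T -> F) :
  (forall i, continuous (f i)) -> continuous (fun x => \sum_(i <- r) f i x).
Proof.
move=> fc; elim: r => [|i r IHr].
  have -> : (fun x => \sum_(i <- [::]) f i x) = (fun=> 0) :> (T -> F).
    by apply/funext => x; rewrite big_nil.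
  exact: continuousF_cst.
have -> : (fun x => \sum_(j <- i :: r) f j x) =
    (fun x => f i x + \sum_(j <- r) f j x).
  by apply/funext => x; rewrite big_cons.
exact: continuousFD.
Qed.

Lemma continuous_entry p q (i : 'I_p) (j : 'I_q) :
  continuous (fun X : 'M[F]_(p, q) => X i j).
Proof.
move=> X A nA; exists (fun i' j' => [set x | i' = i -> j' = j -> A x]).
  move=> i' j'; have [->|/eqP ni] := eqVneq i' i; last by apply: filterE => x /ni.
  have [->|/eqP nj] := eqVneq j' j; last by apply: filterE => x _ /nj.
  by apply: (filterS _ nA) => x Ax _ _.
by move=> Y /(_ i j); exact.
Qed.

Lemma continuous_matrix (T : topologicalType) p q (f : T -> 'M[F]_(p, q)) :
  (forall i j, continuous (fun x => f x i j)) -> continuous f.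
Proof.
move=> fc x A [P nP PA].
have : \forall y \near x, forall i j, P i j (f y i j).
  by apply: filter_forall => i; apply: filter_forall => j; exact: fc.
by apply: filterS => y Py; exact: PA.
Qed.

Lemma continuous_mulmx2 p q s t (A : 'M[F]_(p, q)) (B : 'M[F]_(s, t)) :
  continuous (fun X : 'M[F]_(q, s) => A *m X *m B).
Proof.
apply: continuous_matrix => i j.
have -> : (fun X : 'M[F]_(q, s) => (A *m X *m B) i j) =
    (fun X => \sum_l (\sum_k A i k * X k l) * B l j).
  apply/funext => X; rewrite mxE; apply: eq_bigr => l _.
  by rewrite mxE.
apply: continuousF_sum => l; apply: continuousFM; last exact: continuousF_cst.
apply: continuousF_sum => k; apply: continuousFM; first exact: continuousF_cst.
exact: continuous_entry.
Qed.

End LocalFieldTopology.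

Section SmoothRepresentations.
Variables (R : realType) (F : nonArchLocalFieldType R) (m : nat).
Local Notation C := R[i].
Local Notation G := (GL F m).

(* The stabilizer of v is open, i.e. contains a neighbourhood of 1. *)
Definition smooth_vector (V : Type) (a : G -> V -> V) (v : V) : Prop :=
  \forall A \near (1%:M : 'M[F]_m), forall g : G, val g = A -> a g v = v.

Definition smooth_rep (V : rep C G) : Prop := forall v : V, smooth_vector (act V) v.

Lemma smooth_vector_act (V : Type) (a : G -> V -> V) g v :
  (forall w, a 1%g w = w) -> (forall g h w, a (g * h)%g w = a g (a h w)) ->
  smooth_vector a v -> smooth_vector a (a g v).
Proof.
move=> a1 aM sv.
have c := @continuous_mulmx2 _ F m m m m (val g^-1)%g (val g) 1%:M.
have n1 : nbhs (val g^-1%g *m 1%:M *m val g)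
    [set A | forall h : G, val h = A -> a h v = v].
  by rewrite mulmx1 mulVmx ?(valP g).
have n2 : \forall A \near (1%:M : 'M[F]_m),
  forall h : G, val h = val g^-1%g *m A *m val g -> a h v = v := c _ n1.
rewrite /smooth_vector; near=> A => h hA.
have -> : a h (a g v) = a g (a (g^-1 * h * g)%g v).
  by rewrite -!aM !mulgA mulgV mul1g.
rewrite (near n2 A)// !GL_valM hA//.
Unshelve. all: by end_near. Qed.

Section Contragredient.
Variable V : rep C G.

Definition dual_act (g : G) (l : V -> C^o) : V -> C^o := fun v => l (act V g^-1%g v).

Definition smooth_dual : {pred (V -> C^o)} :=
  fun l => `[< linear l /\ smooth_vector dual_act l >].

Lemma dual_act_linear g : linear (dual_act g).
Proof. by []. Qed.

Lemma dual_act1 l : dual_act 1%g l = l.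
Proof. by apply/funext => v; rewrite /dual_act invg1 act1. Qed.

Lemma dual_actM g h l : dual_act (g * h)%g l = dual_act g (dual_act h l).
Proof. by apply/funext => v; rewrite /dual_act invgM actM. Qed.

Lemma smooth_dual_closed : GRing.subsemimod_closed smooth_dual.
Proof.
split; first split.
- apply/asboolP; split=> [c u v|]; first by rewrite /= scaler0 addr0.
  exact: filterE.
- move=> f g /asboolP[lf sf] /asboolP[lg sg]; apply/asboolP; split.
    by move=> c u v; rewrite !fctE lf lg scalerDr addrACA.
  apply: filterS2 sf sg => A fA gA h hA; apply/funext => v.
  by rewrite /dual_act !fctE -/(dual_act h f v) -/(dual_act h g v) fA// gA.
- move=> c f /asboolP[lf sf]; apply/asboolP; split.
    by move=> d u v; rewrite !fctE lf scalerDr !scalerA mulrC.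
  apply: filterS sf => A fA h hA; apply/funext => v.
  by rewrite /dual_act !fctE -/(dual_act h f v) fA.
Qed.
HB.instance Definition _ := GRing.isSubmodClosed.Build C _ smooth_dual
  smooth_dual_closed.

Lemma smooth_dual_act g l : l \in smooth_dual -> dual_act g l \in smooth_dual.
Proof.
move=> /asboolP[ll sl]; apply/asboolP; split.
  by move=> c u v; rewrite /dual_act act_linear ll.
by apply: smooth_vector_act => //; [exact: dual_act1|exact: dual_actM].
Qed.

Definition contragredient : rep C G :=
  sub_rep dual_act_linear dual_act1 dual_actM smooth_dual_act.
End Contragredient.
End SmoothRepresentations.

Definition smooth_irr (R : realType) (F : nonArchLocalFieldType R) m
    (V : rep R[i] (GL F m)) : Prop :=
  smooth_rep V /\ irreducible_rep V.

Section BigTheta.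
Variables (R : realType) (F : nonArchLocalFieldType R) (m : nat).
Local Notation C := R[i].
Local Notation G := (GL F m).
Local Notation M := 'M[F]_m.

Definition abs_det (p : nat) (A : 'M[F]_p) (s : R) : C := (absF (\det A) `^ s)%:C.

Lemma abs_det1 p s : abs_det (1%:M : 'M[F]_p) s = 1.
Proof. by rewrite /abs_det det1 absF1 powR1. Qed.

Lemma abs_detM p (A B : 'M[F]_p) s :
  abs_det (A *m B) s = abs_det A s * abs_det B s.
Proof. by rewrite /abs_det det_mulmx absFM powRM ?absF_ge0// rmorphM. Qed.

Definition schwartz : {pred (M -> C^o)} := fun phi =>
  `[< (forall X, \forall Y \near X, phi Y = phi X) /\
      compact (closure [set X | phi X != 0]) >].

Lemma schwartz_closed : GRing.subsemimod_closed schwartz.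
Proof.
split; first split.
- apply/asboolP; split=> [X|]; first exact: filterE.
  rewrite (_ : [set X | _] = set0) ?closure0; first exact: compact0.
  by apply/seteqP; split=> X //=; rewrite eqxx.
- move=> f g /asboolP[lf cf] /asboolP[lg cg]; apply/asboolP; split=> [X|].
    by apply: filterS2 (lf X) (lg X) => Y; rewrite !fctE => -> ->.
  apply: (subclosed_compact _ (compactU cf cg)); first exact: closed_closure.
  rewrite -closureU; apply: closure_subset => X /=; rewrite fctE => fgX.
  have [fX|] := eqVneq (f X) 0; last by left.
  by right; move: fgX; rewrite fX add0r.
- move=> c f /asboolP[lf cf]; apply/asboolP; split=> [X|].
    by apply: filterS (lf X) => Y; rewrite !fctE => ->.
  apply: (subclosed_compact _ cf); first exact: closed_closure.
  apply: closure_subset => X /=; rewrite fctE; apply: contra_neq => ->.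
  by rewrite scaler0.
Qed.
HB.instance Definition _ := GRing.isSubmodClosed.Build C _ schwartz schwartz_closed.

Definition weil_act (p : G * G) (phi : M -> C^o) : M -> C^o := fun X =>
  let: (h, g) := p in
  abs_det (val g) (- (m%:R / 2)) * abs_det (val h) (m%:R / 2) *:
    phi (invmx (val g) *m X *m val h).

Lemma weil_act_linear p : linear (weil_act p).
Proof.
case: p => h g c f1 f2; apply/funext => X.
by rewrite /weil_act !fctE scalerDr !scalerA [c * _]mulrC.
Qed.

Lemma weil_act1 phi : weil_act 1%g phi = phi.
Proof.
apply/funext => X; rewrite -[1%g]/((1, 1)%g : G * G) /weil_act.
by rewrite !GL_val1 !abs_det1 mulr1 scale1r invmx1 mul1mx mulmx1.
Qed.

Lemma weil_actM p q phi : weil_act (p * q)%g phi = weil_act p (weil_act q phi).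
Proof.
case: p q => h g [h' g']; apply/funext => X; rewrite pairM /weil_act !GL_valM.
rewrite !abs_detM scalerA mulrACA; congr (_ *: phi _).
by rewrite -!GL_valM -GL_valV invgM !GL_valM !GL_valV !mulmxA.
Qed.

Lemma weil_act_schwartz p phi : phi \in schwartz -> weil_act p phi \in schwartz.
Proof.
case: p => h g /asboolP[lphi cphi]; apply/asboolP.
pose T (X : M) := invmx (val g) *m X *m val h.
pose T' (X : M) := val g *m X *m invmx (val h).
have cT : continuous T by exact: continuous_mulmx2.
have cT' : continuous T' by exact: continuous_mulmx2.
have TK : cancel T T'.
  by move=> X; rewrite /T /T' !mulmxA mulmxV ?(valP g)// mul1mx mulmxK ?(valP h).
have TK' : cancel T' T.
  by move=> X; rewrite /T /T' !mulmxA mulVmx ?(valP g)// mul1mx mulmxKV ?(valP h).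
split=> [X|].
  have nT : \forall Y \near X, phi (T Y) = phi (T X) := cT X _ (lphi (T X)).
  by apply: filterS nT => Y YX; rewrite /weil_act -/(T Y) -/(T X) YX.
have TE (A : set M) : T' @` A = T @^-1` A.
  apply/seteqP; split=> [_ [X AX <-]|X AX]; first by rewrite /= TK'.
  by exists (T X).
apply: (subclosed_compact (B := T' @` closure [set X | phi X != 0])).
- exact: closed_closure.
- by apply: continuous_compact => //; exact: continuous_subspaceT.
- rewrite closureE; apply: smallest_sub.
    rewrite TE; apply: closed_comp; last exact: closed_closure.
    by move=> X _; exact: (cT X).
  rewrite TE => X /=; rewrite /weil_act -/(T X) => wX.
  by apply: subset_closure => /=; apply: contra_neq wX => ->; rewrite scaler0.
Qed.

Definition weil : rep C (G * G)%type :=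
  sub_rep weil_act_linear weil_act1 weil_actM weil_act_schwartz.

Definition big_theta (pi : rep C G) : rep C G :=
  coinv_rep (tensor_rep weil (inflate G (contragredient pi))).
End BigTheta.

Section Models.
Variables (R : realType) (F : nonArchLocalFieldType R) (psi : F -> R[i]).
Variables (k n : nat).
Local Notation C := R[i].
Local Notation kn := (\sum_(i < k) n)%N.

Definition nontrivial_additive_char : Prop :=
  [/\ forall x y, psi (x + y) = psi x * psi y,
      forall x, psi x != 0,
      continuous (psi : F -> C^o) &
      exists x, psi x != 1].

(* Elements of GL_{kn} are indexed by [\sum_(i < k) n] (= k * n), the size for
   which the library's block-matrix operations are stated. *)
Definition block (x : GL F kn) (i j : 'I_k) : 'M[F]_n :=
  @submxblock F k k (fun=> n) (fun=> n) (val x) i j.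

Lemma block_diag_subproof (B : 'I_k -> GL F n) :
  @mxdiag F k (fun=> n) (fun i => val (B i)) \in unitmx.
Proof.
suff /mulmx1_unit[] : @mxdiag F k (fun=> n) (fun i => val (B i)) *m
    @mxdiag F k (fun=> n) (fun i => invmx (val (B i))) = 1%:M by [].
rewrite {2}/mxdiag mul_mxdiag_mxblock -(@mxdiagZ F k (fun=> n) 1).
apply/eq_mxblock => i j; case: eqVneq => [->|_]; last by rewrite mulmx0.
by rewrite !conform_mx_id mulmxV// (valP (B j)).
Qed.

Definition block_diag (B : 'I_k -> GL F n) : GL F kn :=
  Sub (@mxdiag F k (fun=> n) (fun i => val (B i))) (block_diag_subproof B).

Definition diagD (g : GL F n) : GL F kn := block_diag (fun=> g).
Definition diagD' (g : GL F n) : GL F kn :=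
  block_diag (fun i => if i.+1 == k then 1%g else g).

Definition N_group : set (GL F kn) := [set x |
  (forall i j : 'I_k, (j < i)%N -> block x i j = 0) /\
  (forall i : 'I_k, block x i i = 1%:M)].

Definition N_char (x : GL F kn) : C :=
  \prod_(i < k) \prod_(j < k | j == i.+1 :> nat) psi (\tr (block x i j)).

Definition H_group : set (GL F kn) := [set x |
  [/\ forall i j : 'I_k, (j < i)%N -> block x i j = 0,
      forall i : 'I_k, (i.+1 < k)%N -> block x i i = 1%:M &
      forall i j : 'I_k, j = i.+1 :> nat -> j.+1 = k -> block x i j = 0]].

(* The first product has the single index of the last block. *)
Definition H_char (x : GL F kn) : C :=
  (\prod_(i < k | i.+1 == k) abs_det (block x i i) ((2 - k%:R) * n%:R / 2)) *
  \prod_(i < k) \prod_(j < k | (j == i.+1 :> nat) && (j.+1 < k)%N)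
    psi (\tr (block x i j)).

(* Every element of GL_n^Delta N (resp. GL_n^Delta' H) is uniquely of the form
   diag(g, ..., g) x (resp. diag(g, ..., g, 1) x) with g in GL_n and x in N
   (resp. H); the Hom spaces quantify over the pairs (g, x). *)
Definition Hom_DeltaN (V : rep C (GL F kn)) (sigma : rep C (GL F n)) : lmodType C :=
  hom_space [set p : GL F n * GL F kn | N_group p.2]
    (fun p => act V (diagD p.1 * p.2)%g)
    (fun p => N_char p.2 \*: act sigma p.1).

Definition Hom_DeltaH (V : rep C (GL F kn)) (sigma : rep C (GL F n)) : lmodType C :=
  hom_space [set p : GL F n * GL F kn | H_group p.2]
    (fun p => act V (diagD' p.1 * p.2)%g)
    (fun p => abs_det (val p.1) ((k%:R - 2) * n%:R / 2) * H_char p.2 \*: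
                act sigma p.1).

End Models.

(* Main.v *)
(** Put m = k n and p = (k - 1) n.  A Fourier transform in the first k - 1 block rows
    turns Schwartz functions on M_m into functions f(Y, Z), with Y of size m x p and Z of
    size n x m.  Up to powers of |det|, an element h of the first GL_m sends f to
    f(h^-1 Y, Z h), and the unipotent element of the second GL_m with upper right block w
    multiplies f by psi(tr(w Z Y)).  Hence an equivariant functional on Theta(pi), i.e. an
    invariant bilinear form B(f, v) with v in the contragredient of pi, is supported on
    the fiber Z Y = E, where E = (0, ..., 0, 1_n).

    GL_m is transitive on the points of the fiber with Y injective, so near such a point B
    is integration over the fiber against |det h|^alpha ell(h^-1 v) at the point h . base,
    and the equivariance that B imposes on ell is that of the Hom space for
    GL_n^Delta' H.

    The points with Y not injective do not matter.  If Y v = 0 and the last nonzero block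
    of v is the j-th one, there is u = 1 + v w in N with Y u = Y and psi(u) <> 1.  The
    operator (u - 1) / (psi(u) - 1) acts as the identity on equivariant forms and kills
    functions near such points; finitely many of these commuting operators reduce, level
    by level, every f to one vanishing on the degenerate Y.  This shows that ell determines
    B, and it extends the form given by the integral to all f. *)

Require Import Defs.
From HB Require Import structures.
From mathcomp Require Import all_boot all_order all_algebra.
From mathcomp Require Import all_classical all_reals all_analysis.
From mathcomp Require Import perm complex ring.

Set Implicit Arguments.
Unset Strict Implicit.
Unset Printing Implicit Defensive.

Import Order.TTheory GRing.Theory Num.Theory.
Import numFieldNormedType.Exports.

Local Open Scope classical_set_scope.
Local Open Scope ring_scope.
Local Open Scope complex_scope.


(** * Valuation and lattices *)

(** All functionals are merely linear: neither [sigma] nor the Hom spaces carry a topology. Instead,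
    a Schwartz function is a finite combination of indicators of small balls, so integrals are
    finite sums with values in any vector space, and a functional is controlled near a point by its
    values on small indicators.

    The measure on the fiber is the density at E of the pushforward of dY dZ under (Y, Z) -> Z Y, so
    its behaviour under matrices h, b, d is a product of Jacobians.

    With m = p + n, the constant alpha = n - m/2 = m/2 - p collects the Weil factor |det h|^(m/2)
    and the Fourier Jacobian |det h|^(-p). The fiber measure contributes |det h|^(p - n) = |det
    h|^(-2 alpha), which leaves |det h|^alpha as the character of the base stabilizer on ell. For m
    = k n this is (2 - k) n / 2, the exponent in the character of H.

    The obstacle is that v -> ell(h^-1 v) need not vary in a locally constant way as Y degenerates,
    so the integral is available only for f vanishing there. The nontriviality of psi on every
    superdiagonal block supplies the elements u that remove these points one level at a time. *)

Section Valuation.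
Variables (R : realType) (F : nonArchLocalFieldType R).

Lemma absF0 : absF (0 : F) = 0.
Proof. by apply/eqP; rewrite absF_eq0. Qed.

Lemma absF_gt0 (x : F) : (0 < absF x) = (x != 0).
Proof. by rewrite lt_def absF_eq0 absF_ge0 andbT. Qed.

Lemma absFV (x : F) : absF x^-1 = (absF x)^-1.
Proof.
have [->|x0] := eqVneq x 0; first by rewrite invr0 absF0 invr0.
by apply: (mulfI (_ : absF x != 0)); rewrite ?absF_eq0// -absFM !divff ?absF1// absF_eq0.
Qed.

Lemma absFX (x : F) n : absF (x ^+ n) = absF x ^+ n.
Proof. by elim: n => [|n IHn]; rewrite ?expr0 ?absF1// !exprS absFM IHn. Qed.

Lemma absF_prod (I : Type) (r : seq I) (P : pred I) (f : I -> F) :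
  absF (\prod_(i <- r | P i) f i) = \prod_(i <- r | P i) absF (f i).
Proof. exact: (big_morph _ (@absFM _ F) (@absF1 _ F)). Qed.

Lemma absF_sum_le (I : Type) (r : seq I) (P : pred I) (f : I -> F) (e : R) :
  0 <= e -> (forall i, P i -> absF (f i) <= e) ->
  absF (\sum_(i <- r | P i) f i) <= e.
Proof.
move=> e0 fe; elim/big_rec: _ => [|i x Pi xe]; first by rewrite absF0.
by rewrite (le_trans (absF_ultra _ _))// ge_max fe.
Qed.

Lemma absFD_le (x y : F) (e : R) : absF x <= e -> absF y <= e -> absF (x + y) <= e.
Proof. by move=> xe ye; rewrite (le_trans (absF_ultra _ _))// ge_max xe. Qed.

Lemma absFB_le (x y : F) (e : R) : absF x <= e -> absF y <= e -> absF (x - y) <= e.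
Proof. by move=> xe ye; apply: absFD_le; rewrite ?absFN. Qed.

Lemma residue_digits : exists (q : nat) (pi : F) (c : 'I_q -> F),
  [/\ absF pi = q%:R^-1, (1 < q)%N, forall x : F, absF x < 1 -> absF x <= absF pi,
      forall i, absF (c i) <= 1 &
      forall x, absF x <= 1 -> exists i, forall j, (absF (x - c j) < 1) = (i == j)].
Proof.
have [q [pi [cq piq pimax]]] := @absF_normalized R F.
move: cq; rewrite card_eq_sym => /card_set_bijP[f [fA finj fsurj]].
have cex (i : 'I_q) : exists x : F, absF x <= 1 /\ f i = [set y | absF (x - y) < 1].
  by have [x x1 <-] := fA i (ltn_ord i); exists x.
pose c i := projT1 (cid (cex i)).
have cP i : absF (c i) <= 1 /\ f i = [set y | absF (c i - y) < 1].
  exact: projT2 (cid (cex i)).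
have cl x : absF x <= 1 -> exists i, forall j, (absF (x - c j) < 1) = (i == j).
  move=> x1; have [k kq fk] := fsurj [set y | absF (x - y) < 1] (ex_intro2 _ _ x x1 erefl).
  exists (Ordinal kq) => j; apply/idP/eqP => [xj|<-].
    apply: val_inj => /=; apply: finj; rewrite ?inE//= fk (cP j).2.
    apply/seteqP; split=> y /= h.
      have -> : c j - y = (x - y) - (x - c j) by rewrite opprB [RHS]addrC subrKA.
      by rewrite (le_lt_trans (absF_ultra _ _))// gt_max absFN h.
    have -> : x - y = (x - c j) + (c j - y) by rewrite subrKA.
    by rewrite (le_lt_trans (absF_ultra _ _))// gt_max xj.
  have : [set y | absF (x - y) < 1] (c (Ordinal kq)).
    by rewrite -fk (cP (Ordinal kq)).2 /= subrr absF0.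
  by [].
exists q, pi, c; split => //; last by move=> i; exact: (cP i).1.
have [i0 i0P] := cl 0 (eq_ind_r (fun z => z <= 1) ler01 absF0).
have [i1 i1P] := cl 1 (eq_ind_r (fun z => z <= 1) (lexx _) (@absF1 _ F)).
have ne : i0 != i1.
  apply/eqP => i01; have h0 : absF (0 - c i0) < 1 by rewrite i0P.
  have h1 : absF (1 - c i0) < 1 by rewrite i1P i01.
  have : absF (1 : F) < 1.
    have -> : (1 : F) = (1 - c i0) - (0 - c i0) by rewrite opprB subr0 subrK.
    by rewrite (le_lt_trans (absF_ultra _ _))// gt_max absFN h1.
  by rewrite absF1 ltxx.
apply: contraNT ne; rewrite -leqNgt => q1; apply/eqP/val_inj => /=.
have := leq_trans (ltn_ord i0) q1; have := leq_trans (ltn_ord i1) q1.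
by rewrite !ltnS !leqn0 => /eqP-> /eqP->.
Qed.

Definition resq : nat := projT1 (cid residue_digits).
Definition unif : F := projT1 (cid (projT2 (cid residue_digits))).
Definition digit : 'I_resq -> F :=
  projT1 (cid (projT2 (cid (projT2 (cid residue_digits))))).

Lemma residue_digitsP :
  [/\ absF unif = resq%:R^-1, (1 < resq)%N,
      forall x : F, absF x < 1 -> absF x <= absF unif,
      forall i, absF (digit i) <= 1 &
      forall x, absF x <= 1 -> exists i, forall j, (absF (x - digit j) < 1) = (i == j)].
Proof. exact: projT2 (cid (projT2 (cid (projT2 (cid residue_digits))))). Qed.

Lemma resq_gt0 : 0 < resq%:R :> R.
Proof. by have [_ q1 _ _ _] := residue_digitsP; rewrite ltr0n ltnW. Qed.

Lemma absF_unif : absF unif = resq%:R^-1.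
Proof. by have [] := residue_digitsP. Qed.

Lemma absF_unif_gt0 : 0 < absF unif.
Proof. by rewrite absF_unif invr_gt0 resq_gt0. Qed.

Lemma absF_unif_lt1 : absF unif < 1.
Proof.
have [_ q1 _ _ _] := residue_digitsP.
by rewrite absF_unif invf_lt1 ?resq_gt0// ltr1n.
Qed.

Lemma unif_neq0 : unif != 0.
Proof. by rewrite -absF_gt0 absF_unif_gt0. Qed.

Lemma unifX_neq0 n : unif ^+ n != 0.
Proof. by rewrite expf_neq0 ?unif_neq0. Qed.

(** Since |unif| is the largest absolute value below 1, an open ball is the closed ball of the next
    smaller radius. *)
Lemma absF_lt_unif (t x : F) : t != 0 ->
  (absF x < absF t) = (absF x <= absF (t * unif)).
Proof.
move=> t0; have [_ _ umax _ _] := residue_digitsP.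
have t0' : 0 < absF t by rewrite absF_gt0.
apply/idP/idP => [xt|].
  have : absF (x / t) < 1 by rewrite absFM absFV ltr_pdivrMr// mul1r.
  by move/umax; rewrite absFM absFV ler_pdivrMr// absFM mulrC.
by move/le_lt_trans; apply; rewrite absFM gtr_pMr// absF_unif_lt1.
Qed.

Lemma unifX_small (e : R) : 0 < e -> exists n, absF unif ^+ n < e.
Proof.
move=> e0; have u1 := absF_unif_lt1.
have : (fun n => absF unif ^+ n) @ \oo --> (0 : R).
  by apply: cvg_expr; rewrite ger0_norm ?absF_ge0.
move=> /cvgrPdist_lt/(_ e e0)[n _ /(_ n (leqnn n))].
by rewrite sub0r normrN ger0_norm ?exprn_ge0 ?absF_ge0//; exists n.
Qed.

Lemma unifX_le m n : (m <= n)%N -> absF (unif ^+ n) <= absF (unif ^+ m).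
Proof.
move=> mn; rewrite !absFX; apply: ler_wiXn2l => //; first exact: absF_ge0.
exact: ltW absF_unif_lt1.
Qed.

Lemma unifV_le m n : (m <= n)%N -> absF (unif ^- m) <= absF (unif ^- n).
Proof.
by move=> mn; rewrite !absFV lef_pV2 ?posrE ?absF_gt0 ?unifX_neq0// unifX_le.
Qed.

Lemma unifX_le1 n : absF (unif ^+ n) <= 1.
Proof. by rewrite -(@absF1 _ F) -[1 in leRHS](expr0 unif) unifX_le. Qed.

Lemma unifV_ge1 n : 1 <= absF (unif ^- n).
Proof.
rewrite -(@absF1 _ F) -[1](invr1) -[1 in leLHS](expr0 unif) unifV_le//.
Qed.

Lemma exists_unifV (x : R) : exists n, x <= absF (unif ^- n).
Proof.
have x0 : 0 < (`|x| + 1)^-1 by rewrite invr_gt0 ltr_wpDl.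
have [n nx] := unifX_small x0; exists n; rewrite absFV absFX.
rewrite -ltf_pV2 ?posrE ?invrK in nx; rewrite ?exprn_gt0 ?absF_unif_gt0 ?invr_gt0//.
by apply: le_trans (ltW nx); rewrite (le_trans (ler_norm _))// lerDl.
Qed.

(** Once x is scaled into the unit ball, [absF_lt_unif] excludes values strictly between consecutive
    powers of |unif|. Two natural exponents stand in for one integer exponent. *)
Lemma absF_discrete (x : F) : x != 0 ->
  exists m n : nat, absF x = absF (unif ^+ m * unif ^- n).
Proof.
move=> x0; have [n nx] := exists_unifV (absF x).
have y1 : absF (x * unif ^+ n) <= 1.
  by rewrite absFM -ler_pdivlMr ?absF_gt0 ?unifX_neq0// mul1r -absFV.
have y0 : 0 < absF (x * unif ^+ n) by rewrite absF_gt0 mulf_neq0 ?unifX_neq0.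
have [N Ny] := unifX_small y0.
suff [m mx] : exists m, absF (x * unif ^+ n) = absF (unif ^+ m).
  by exists m, n; rewrite absFM -mx absFM absFV mulfK// absF_eq0 unifX_neq0.
elim: N Ny => [|N IHN] Ny.
  by rewrite expr0 ltNge y1 in Ny.
have [xN|] := ltP (absF unif ^+ N) (absF (x * unif ^+ n)); first exact: IHN.
rewrite le_eqVlt => /orP[/eqP->|]; first by exists N; rewrite absFX.
rewrite -absFX absF_lt_unif ?unifX_neq0// -exprSr absFX => h.
by have := lt_le_trans Ny h; rewrite ltxx.
Qed.

End Valuation.

Section Lattices.
Variables (R : realType) (F : nonArchLocalFieldType R).
Local Notation unif := (unif F).

(** The radius is given by an element t of F, so that rescaling and matrix products act on the index
    by multiplication; [lat 1] consists of the integral matrices. *)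
Definition lat a b (t : F) : {pred 'M[F]_(a, b)} :=
  fun X => [forall i, [forall j, absF (X i j) <= absF t]].

Lemma latP a b (t : F) (X : 'M[F]_(a, b)) :
  reflect (forall i j, absF (X i j) <= absF t) (X \in lat t).
Proof.
by apply: (iffP forallP) => h i; [move=> j; exact: (forallP (h i))|apply/forallP].
Qed.

Lemma lat_zmod_closed a b (t : F) : zmod_closed (@lat a b t).
Proof.
split=> [|X Y /latP Xt /latP Yt]; apply/latP => i j; rewrite !mxE.
  by rewrite absF0 absF_ge0.
exact: absFB_le.
Qed.
HB.instance Definition _ a b t :=
  GRing.isZmodClosed.Build 'M[F]_(a, b) (lat t) (@lat_zmod_closed a b t).

Lemma lat_le a b (t t' : F) (X : 'M[F]_(a, b)) :
  absF t <= absF t' -> X \in lat t -> X \in lat t'.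
Proof. by move=> tt' /latP Xt; apply/latP => i j; exact: le_trans tt'. Qed.

Lemma latZ a b (c t : F) (X : 'M[F]_(a, b)) :
  c != 0 -> (c *: X \in lat (c * t)) = (X \in lat t).
Proof.
move=> c0; apply/latP/latP => h i j; have := h i j; rewrite !mxE !absFM ler_pM2l//.
all: by rewrite absF_gt0.
Qed.

Lemma latZ1 a b (c t : F) (X : 'M[F]_(a, b)) :
  absF c <= 1 -> X \in lat t -> c *: X \in lat t.
Proof.
move=> c1 /latP Xt; apply/latP => i j; rewrite !mxE absFM.
by rewrite (le_trans _ (Xt i j))// ler_piMl// absF_ge0.
Qed.

Lemma lat_mulmx a b c (t t' : F) (X : 'M[F]_(a, b)) (Y : 'M[F]_(b, c)) :
  X \in lat t -> Y \in lat t' -> X *m Y \in lat (t * t').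
Proof.
move=> /latP Xt /latP Yt; apply/latP => i j; rewrite mxE.
apply: absF_sum_le => [|k _]; first exact: absF_ge0.
by rewrite !absFM ler_pM ?absF_ge0.
Qed.

Lemma lat_trmx a b (t : F) (X : 'M[F]_(a, b)) : (X^T \in lat t) = (X \in lat t).
Proof. by apply/latP/latP => h i j; have := h j i; rewrite mxE. Qed.

Lemma lat_1 a : (1%:M : 'M[F]_a) \in lat 1.
Proof.
by apply/latP => i j; rewrite mxE absF1; case: (_ == _); rewrite ?absF0 ?ler01 ?absF1.
Qed.

Lemma lat_bounded a b (X : 'M[F]_(a, b)) : exists s, X \in lat (unif ^- s).
Proof.
have /choice[g gP] : forall ij : 'I_a * 'I_b, exists s, absF (X ij.1 ij.2) <= absF (unif ^- s).
  by move=> ij; exact: exists_unifV.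
exists (\max_ij g ij)%N; apply/latP => i j.
by rewrite (le_trans (gP (i, j)))// unifV_le// leq_bigmax.
Qed.

Lemma lat_unifX a b (X : 'M[F]_(a, b)) m n :
  (m <= n)%N -> X \in lat (unif ^+ n) -> X \in lat (unif ^+ m).
Proof. by move=> mn; apply: lat_le; exact: unifX_le. Qed.

Lemma lat_unifV a b (X : 'M[F]_(a, b)) m n :
  (m <= n)%N -> X \in lat (unif ^- m) -> X \in lat (unif ^- n).
Proof. by move=> mn; apply: lat_le; exact: unifV_le. Qed.

Lemma lat_unifXV a b (X : 'M[F]_(a, b)) m n :
  X \in lat (unif ^+ n) -> X \in lat (unif ^- m).
Proof.
by apply: lat_le; rewrite (le_trans (unifX_le1 _ _))// unifV_ge1.
Qed.

Lemma lat_unif0 a b (X : 'M[F]_(a, b)) :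
  (forall n, X \in lat (unif ^+ n)) -> X = 0.
Proof.
move=> h; apply/matrixP => i j; rewrite mxE; apply/eqP; apply: contraT.
rewrite -absF_gt0 => /(unifX_small F)[n]; rewrite -absFX ltNge => /negP[].
by move/latP: (h n); apply.
Qed.

Section Digits.
Variables a b : nat.
Local Notation M := 'M[F]_(a, b).
Local Notation D := 'M['I_(resq F)]_(a, b).

Definition mxdigit (d : D) : M := map_mx (@digit R F) d.

Lemma mxdigit_lat (t : F) d : t *: mxdigit d \in lat t.
Proof.
have [_ _ _ d1 _] := residue_digitsP F.
by apply/latP => i j; rewrite !mxE absFM ler_piMr ?d1 ?absF_ge0.
Qed.

Lemma mxdigitP (t : F) (X : M) : t != 0 -> X \in lat t ->
  exists d, forall d', (X - t *: mxdigit d' \in lat (t * unif)) = (d == d').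
Proof.
move=> t0 /latP Xt; have [_ _ _ _ dP] := residue_digitsP F.
have /choice[g gP] : forall ij : 'I_a * 'I_b, exists k, forall k',
    (absF (X ij.1 ij.2 / t - digit k') < 1) = (k == k').
  move=> ij; apply: dP; rewrite absFM absFV ler_pdivrMr ?absF_gt0// mul1r.
  exact: Xt.
exists (\matrix_(i, j) g (i, j)) => d'.
have e i j : (absF (X i j - t * digit (d' i j)) <= absF (t * unif)) =
    (g (i, j) == d' i j).
  have t0' : 0 < absF t by rewrite absF_gt0.
  rewrite -gP -absF_lt_unif// -[in RHS](ltr_pM2r t0') mul1r.
  by rewrite -absFM mulrBl divfK// [_ * t]mulrC.
apply/latP/eqP => [h|gd i j].
  by apply/matrixP => i j; rewrite mxE; apply/eqP; rewrite -e; have := h i j; rewrite !mxE.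
by rewrite !mxE e -gd mxE eqxx.
Qed.

(** Digit expansions of length l, leading digit first: representatives of [lat t] modulo
    [lat (t * unif ^+ l)]. *)
Fixpoint reps (l : nat) (t : F) : seq M :=
  if l is l'.+1 then
    [seq t *: mxdigit d + x | d <- enum D, x <- reps l' (t * unif)]
  else [:: 0].

Variable W : nmodType.
Implicit Type f : M -> W.

Lemma sum_repsS l t f : \sum_(x <- reps l.+1 t) f x =
  \sum_(d : D) \sum_(x <- reps l (t * unif)) f (t *: mxdigit d + x).
Proof. by rewrite /= big_allpairs_dep/= big_enum. Qed.

Lemma sum_reps_scale l (c t : F) f :
  \sum_(x <- reps l t) f (c *: x) = \sum_(x <- reps l (c * t)) f x.
Proof.
elim: l t f => [|l IHl] t f; first by rewrite /= !big_seq1 scaler0.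
rewrite !sum_repsS; apply: eq_bigr => d _; rewrite -mulrA -IHl.
by apply: eq_bigr => x _; rewrite scalerDr scalerA.
Qed.

Lemma reps_lat l t x : x \in reps l t -> x \in lat t.
Proof.
elim: l t x => [|l IHl] t x /=; first by rewrite inE => /eqP->; exact: rpred0.
move=> /allpairsP[[d y] /= [_ /IHl yt ->]]; apply: rpredD; first exact: mxdigit_lat.
by apply: lat_le yt; rewrite absFM ler_piMr ?absF_ge0// ltW// absF_unif_lt1.
Qed.

Definition lat_inv (t : F) f := forall X d, d \in lat t -> f (X + d) = f X.

(** Adding x permutes the leading digits through [g] and leaves a carry [z] in the next smaller
    lattice, which the induction hypothesis absorbs. *)
Lemma sum_reps_trans l t x f : t != 0 -> x \in lat t -> lat_inv (t * unif ^+ l) f ->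
  \sum_(y <- reps l t) f (y + x) = \sum_(y <- reps l t) f y.
Proof.
elim: l t x f => [|l IHl] t x f t0 xt fi.
  by rewrite /= !big_seq1 fi// expr0 mulr1.
have /choice[g gP] : forall d : D, exists d', forall d'',
    (t *: mxdigit d + x - t *: mxdigit d'' \in lat (t * unif)) = (d' == d'').
  by move=> d; apply: mxdigitP => //; rewrite rpredD ?mxdigit_lat.
have ginj : injective g.
  move=> d d' gdd'; have h : t *: mxdigit d + x - t *: mxdigit (g d) \in lat (t * unif).
    by rewrite gP.
  have h' : t *: mxdigit d' + x - t *: mxdigit (g d) \in lat (t * unif).
    by rewrite gP gdd'.
  have := rpredB h h'; rewrite opprB addrA subrK opprD addrACA subrr addr0 => hh.
  have [d0 d0P] := mxdigitP t0 (mxdigit_lat t d).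
  have := d0P d; rewrite subrr rpred0 => /esym/eqP <-; apply/eqP.
  by rewrite -d0P.
rewrite !sum_repsS [RHS](reindex_inj ginj)/=; apply: eq_bigr => d _.
pose z := t *: mxdigit d + x - t *: mxdigit (g d).
rewrite -(IHl (t * unif) z (fun y => f (t *: mxdigit (g d) + y))).
- apply: eq_bigr => y _; congr f.
  by rewrite [RHS]addrCA [t *: mxdigit (g d) + z]addrC /z subrK [RHS]addrCA addrA.
- by rewrite mulf_neq0 ?unif_neq0.
- by rewrite /z gP.
- by move=> X e ed; rewrite addrA fi// exprS mulrA.
Qed.

Lemma sum_reps_refine l t f : lat_inv (t * unif ^+ l) f ->
  \sum_(x <- reps l.+1 t) f x = (\sum_(x <- reps l t) f x) *+ #|{: D}|.
Proof.
elim: l t f => [|l IHl] t f fi.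
  rewrite sum_repsS/= big_seq1 -sumr_const; apply: eq_bigr => d _.
  rewrite big_seq1 addr0 -[_ *: _]add0r fi// expr0 mulr1; exact: mxdigit_lat.
rewrite sum_repsS [in RHS]sum_repsS -sumrMnl; apply: eq_bigr => d _.
by rewrite IHl// => X e ed; rewrite addrA fi// exprS mulrA.
Qed.

(** Only the leading digit of the class of 0 survives the support condition. Its chosen
    representative need not be 0, so the remaining sum is moved back by translation invariance. *)
Lemma sum_reps_support l t f : t != 0 -> lat_inv (t * unif * unif ^+ l) f ->
  (forall X, X \notin lat (t * unif) -> f X = 0) ->
  \sum_(x <- reps l.+1 t) f x = \sum_(x <- reps l (t * unif)) f x.
Proof.
move=> t0 fi fs; have [d dP] := mxdigitP t0 (rpred0 (@lat a b t)).
rewrite sum_repsS (bigD1 d)//= [X in _ + X]big1 ?addr0.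
  rewrite -[RHS](sum_reps_trans (x := t *: mxdigit d))//.
  - by apply: eq_bigr => y _; rewrite addrC.
  - by rewrite mulf_neq0 ?unif_neq0.
  - by have := dP d; rewrite eqxx sub0r rpredN.
move=> d' d'd; rewrite big1_seq// => y /andP[_ /reps_lat yt]; apply: fs.
by rewrite rpredDr// -rpredN -sub0r dP eq_sym.
Qed.

(** Exactly one representative is congruent to X. Stated as a weighted sum, this is directly the
    expansion of f in indicators of cosets. *)
Lemma reps_cover l t X f : t != 0 -> X \in lat t -> lat_inv (t * unif ^+ l) f ->
  \sum_(x <- reps l t) f x *+ (X - x \in lat (t * unif ^+ l)) = f X.
Proof.
elim: l t X f => [|l IHl] t X f t0 Xt fi.
  rewrite /= big_seq1 subr0 expr0 mulr1 Xt mulr1n -[X in RHS]add0r fi//.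
  by rewrite expr0 mulr1.
have [d dP] := mxdigitP t0 Xt.
rewrite (sum_repsS l t (fun x => f x *+ (X - x \in lat (t * unif ^+ l.+1)))).
rewrite (bigD1 d)//= [X in _ + X]big1 ?addr0.
  have dX : X - t *: mxdigit d \in lat (t * unif) by rewrite dP.
  have := IHl _ _ (fun y => f (t *: mxdigit d + y)) _ dX.
  rewrite [_ + (_ - _)]addrC subrK => <- //.
  - by apply: eq_bigr => y _; rewrite exprS mulrA opprD addrA.
  - by rewrite mulf_neq0 ?unif_neq0.
  - by move=> Y e ed; rewrite addrA fi// exprS mulrA.
move=> d' d'd; rewrite big1_seq// => y /andP[_ /reps_lat yt].
case: (boolP (_ \in _)) => // h; case/negP: d'd; rewrite eq_sym -dP.
have -> : X - t *: mxdigit d' = X - (t *: mxdigit d' + y) + y.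
  by rewrite opprD addrA subrK.
apply: rpredD yt; apply: lat_le h.
by rewrite exprS mulrA absFM ler_piMr ?absF_ge0// unifX_le1.
Qed.

End Digits.
End Lattices.

(** * Haar integration of Schwartz functions *)

Section Integral.
Variables (R : realType) (F : nonArchLocalFieldType R).
Local Notation C := R[i].
Local Notation unif := (unif F).

Definition vol (d : nat) (t : F) : C := (absF t ^+ d)%:C.

Lemma vol1 d : vol d 1 = 1.
Proof. by rewrite /vol absF1 expr1n. Qed.

Lemma volM d (t t' : F) : vol d (t * t') = vol d t * vol d t'.
Proof. by rewrite /vol absFM exprMn rmorphM. Qed.

Lemma vol_neq0 d (t : F) : t != 0 -> vol d t != 0.
Proof. by move=> t0; rewrite /vol fmorph_eq0 expf_neq0// absF_eq0. Qed.

Lemma volV d (t : F) : t != 0 -> vol d t^-1 = (vol d t)^-1.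
Proof. by move=> t0; rewrite /vol absFV exprVn fmorphV. Qed.

Section Schwartz.
Variables (a b : nat).
Local Notation M := 'M[F]_(a, b).

Definition schw_at (W : nmodType) (s r : nat) (f : M -> W) :=
  (forall X, X \notin lat (unif ^- s) -> f X = 0) /\ lat_inv (unif ^+ r) f.

Definition schw (W : nmodType) (f : M -> W) := exists s r, schw_at s r f.

Definition grid s r : seq M := reps a b (s + r) (unif ^- s).

Lemma unifVD s r : unif ^- s * unif ^+ (s + r) = unif ^+ r.
Proof. by rewrite exprD mulKf// unifX_neq0. Qed.

Lemma schw_at_le (W : nmodType) s r s' r' (f : M -> W) : (s <= s')%N -> (r <= r')%N ->
  schw_at s r f -> schw_at s' r' f.
Proof.
move=> ss' rr' [fs fr]; split=> [X Xs'|X d dr'].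
  by apply: fs; apply: contra Xs'; exact: lat_unifV.
by apply: fr; exact: lat_unifX dr'.
Qed.

Lemma schw_at_max (W W' : nmodType) (f : M -> W) (g : M -> W') :
  schw f -> schw g -> exists s r, schw_at s r f /\ schw_at s r g.
Proof.
move=> [s [r fsr]] [s' [r' gsr]]; exists (maxn s s'), (maxn r r').
by split; [apply: schw_at_le fsr|apply: schw_at_le gsr]; rewrite ?leq_maxl ?leq_maxr.
Qed.

Definition haar_at (W : lmodType C) s r (f : M -> W) : W :=
  vol (a * b) (unif ^+ r) *: \sum_(x <- grid s r) f x.

(** A Riemann sum at some level (s, r) valid for f, with default value 0 when there is none; [haarE]
    shows that the choice of level is immaterial. The measure gives [lat 1] volume 1. *)
Definition haar (W : lmodType C) (f : M -> W) : W :=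
  if pselect (schw f) is left e
  then haar_at (projT1 (cid e)) (projT1 (cid (projT2 (cid e)))) f else 0.

(** This is where |unif| = 1/q matters: refining the grid by one digit multiplies the number of
    cells by the inverse of the factor by which each cell shrinks. *)
Lemma vol_card : vol (a * b) unif * #|{: 'M['I_(resq F)]_(a, b)}|%:R = 1.
Proof.
rewrite card_mx card_ord /vol absF_unif exprVn natrX fmorphV rmorphXn rmorph_nat.
by rewrite mulVf// expf_neq0// pnatr_eq0 -lt0n; have := resq_gt0 F; rewrite ltr0n.
Qed.

Lemma haar_at_refine (W : lmodType C) s r (f : M -> W) :
  schw_at s r f -> haar_at s r.+1 f = haar_at s r f.
Proof.
move=> [fs fr]; rewrite /haar_at /grid addnS sum_reps_refine ?unifVD//.
rewrite -scaler_nat scalerA exprSr volM -mulrA vol_card.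
by rewrite mulr1.
Qed.

Lemma haar_at_support (W : lmodType C) s r (f : M -> W) :
  schw_at s r f -> haar_at s.+1 r f = haar_at s r f.
Proof.
move=> [fs fr]; rewrite /haar_at /grid addSn; congr (_ *: _).
have e : unif ^- s.+1 * unif = unif ^- s by rewrite exprS invfM mulrAC mulVf ?mul1r ?unif_neq0.
rewrite sum_reps_support ?e ?unifVD//.
by rewrite invr_neq0 ?unifX_neq0.
Qed.

Lemma haar_at_le (W : lmodType C) s r s' r' (f : M -> W) :
  (s <= s')%N -> (r <= r')%N -> schw_at s r f -> haar_at s' r' f = haar_at s r f.
Proof.
move=> ss' rr' fsr; rewrite -(subnKC ss') -(subnKC rr').
elim: (s' - s)%N => [|m IHm].
  rewrite addn0; elim: (r' - r)%N => [|m IHm]; first by rewrite addn0.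
  by rewrite addnS haar_at_refine//; apply: schw_at_le fsr => //; rewrite leq_addr.
by rewrite addnS haar_at_support//; apply: schw_at_le fsr => //; rewrite leq_addr.
Qed.

Lemma haarE (W : lmodType C) s r (f : M -> W) : schw_at s r f ->
  haar f = haar_at s r f.
Proof.
move=> fsr; rewrite /haar; case: pselect => [e|ne]; last by case: ne; exists s, r.
case: cid => s0 e0; case: cid => r0 f0 /=.
rewrite -(@haar_at_le _ s r (maxn s s0) (maxn r r0)) ?leq_maxl//.
by rewrite -(@haar_at_le _ s0 r0 (maxn s s0) (maxn r r0)) ?leq_maxr.
Qed.

Lemma schwD (W : nmodType) (f g : M -> W) :
  schw f -> schw g -> schw (fun X => f X + g X).
Proof.
move=> fS gS; have [s [r [[fs fr] [gs gr]]]] := schw_at_max fS gS.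
exists s, r; split=> [X Xs|X d dr]; first by rewrite fs// gs// addr0.
by rewrite fr// gr.
Qed.

Lemma schw0 (W : nmodType) : schw (fun _ : M => 0 : W).
Proof. by exists 0%N, 0%N; split. Qed.

Lemma schw_sum (I : Type) (l : seq I) (W : nmodType) (f : I -> M -> W) :
  (forall i, schw (f i)) -> schw (fun X => \sum_(i <- l) f i X).
Proof.
move=> fS; elim: l => [|i l IHl].
  by have -> : (fun X => \sum_(i <- [::]) f i X) = (fun=> 0)
    by [apply/funext => X; rewrite big_nil]; exact: schw0.
have -> : (fun X => \sum_(j <- i :: l) f j X) = (fun X => f i X + \sum_(j <- l) f j X).
  by apply/funext => X; rewrite big_cons.
exact: schwD.
Qed.

Lemma schw_comp (W W' : nmodType) (T : W -> W') (f : M -> W) :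
  T 0 = 0 -> schw f -> schw (T \o f).
Proof.
move=> T0 [s [r [fs fr]]]; by exists s, r; split=> [X Xs|X d dr] /=; [rewrite fs|rewrite fr].
Qed.

Lemma schwZ (W : lmodType C) c (f : M -> W) : schw f -> schw (fun X => c *: f X).
Proof. by move=> fS; apply: (schw_comp (T := *:%R c)) => //; rewrite scaler0. Qed.

Lemma haarD (W : lmodType C) (f g : M -> W) : schw f -> schw g ->
  haar (fun X => f X + g X) = haar f + haar g.
Proof.
move=> fS gS; have [s [r [fsr gsr]]] := schw_at_max fS gS.
rewrite (haarE fsr) (haarE gsr) (@haarE _ s r) /haar_at ?big_split ?scalerDr//.
case: fsr gsr => [fs fr] [gs gr].
by split=> [X Xs|X d dr]; [rewrite fs// gs// addr0|rewrite fr// gr].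
Qed.

Lemma haar_linear (W W' : lmodType C) (T : {linear W -> W'}) (f : M -> W) : schw f ->
  haar (T \o f) = T (haar f).
Proof.
move=> [s [r fsr]]; rewrite (haarE fsr) (@haarE _ s r) /haar_at.
  by rewrite linearZ_LR (linear_sum T).
by case: fsr => fs fr; split=> [X Xs|X d dr] /=; [rewrite fs// linear0|rewrite fr].
Qed.

Lemma haarZ (W : lmodType C) c (f : M -> W) : schw f ->
  haar (fun X => c *: f X) = c *: haar f.
Proof. exact: (haar_linear ( *:%R c)). Qed.

Lemma haar0 (W : lmodType C) : haar (fun _ : M => 0 : W) = 0.
Proof.
by rewrite (@haarE _ 0 0)// /haar_at big1 ?scaler0.
Qed.

Lemma haar_sum (I : Type) (l : seq I) (W : lmodType C) (f : I -> M -> W) :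
  (forall i, schw (f i)) ->
  haar (fun X => \sum_(i <- l) f i X) = \sum_(i <- l) haar (f i).
Proof.
move=> fS; elim: l => [|i l IHl].
  have -> : (fun X => \sum_(i <- [::]) f i X) = (fun=> 0)
    by apply/funext => X; rewrite big_nil.
  by rewrite haar0 big_nil.
have -> : (fun X => \sum_(j <- i :: l) f j X) = (fun X => f i X + \sum_(j <- l) f j X).
  by apply/funext => X; rewrite big_cons.
by rewrite haarD// ?IHl ?big_cons//; exact: schw_sum.
Qed.

Lemma schw_trans (W : nmodType) (f : M -> W) (A : M) : schw f -> schw (fun X => f (X + A)).
Proof.
move=> [s [r [fs fr]]]; have [s' As'] := lat_bounded A.
exists (maxn s s'), r; split=> [X Xs|X d dr]; last by rewrite /= addrAC; exact: fr.
apply: fs; apply: contra Xs => XA; rewrite -(addrK A X).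
by apply: rpredB; [apply: lat_unifV XA|apply: lat_unifV As']; rewrite ?leq_maxl ?leq_maxr.
Qed.

Lemma haar_trans (W : lmodType C) (f : M -> W) (A : M) : schw f ->
  haar (fun X => f (X + A)) = haar f.
Proof.
move=> [s [r fsr]]; have [s' As'] := lat_bounded A.
have [fs fr] : schw_at (maxn s s') r f by apply: schw_at_le fsr; rewrite ?leq_maxl.
have gsr : schw_at (maxn s s') r (fun X => f (X + A)).
  split=> [X Xs|X d dr]; last by rewrite /= addrAC; exact: fr.
  apply: fs; apply: contra Xs => XA; rewrite -(addrK A X).
  by apply: rpredB; [exact: XA|apply: lat_unifV As']; rewrite leq_maxr.
rewrite (haarE gsr) (@haarE _ (maxn s s') r)// /haar_at; congr (_ *: _).
apply: sum_reps_trans; rewrite ?unifVD//.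
  by rewrite invr_neq0 ?unifX_neq0.
by apply: lat_unifV As'; rewrite leq_maxr.
Qed.

Definition ind (A : M) (t : F) : M -> C^o := fun X => (X - A \in lat t)%:R.

Lemma ind_schw_at A s r : A \in lat (unif ^- s) -> schw_at s r (ind A (unif ^+ r)).
Proof.
move=> As; split=> [X Xs|X d dr]; rewrite /ind.
  case: (boolP (X - A \in _)) => // XA; case/negP: Xs.
  by rewrite -(subrK A X) rpredD//; exact: lat_unifXV XA.
by rewrite addrAC rpredDr.
Qed.

Lemma ind_schw A r : schw (ind A (unif ^+ r)).
Proof. by have [s As] := lat_bounded A; exists s, r; exact: ind_schw_at. Qed.

Lemma schw_decomp (W : lmodType C) s r (f : M -> W) : schw_at s r f ->
  forall X, f X = \sum_(x <- grid s r) ind x (unif ^+ r) X *: f x.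
Proof.
move=> [fs fr] X.
have [Xs|Xs] := boolP (X \in lat (unif ^- s)).
  rewrite -[LHS](@reps_cover R F a b W (s + r) (unif ^- s) X f)// ?unifVD//; last first.
    by rewrite invr_neq0 ?unifX_neq0.
  by apply: eq_bigr => x _; rewrite /ind scaler_nat.
rewrite fs// big1_seq// => x /andP[_ /reps_lat xs]; rewrite /ind.
case: (boolP (X - x \in _)) => [Xx|_]; last by rewrite scale0r.
by case/negP: Xs; rewrite -(subrK x X) rpredD//; exact: lat_unifXV Xx.
Qed.

Lemma haar_ind A r : haar (ind A (unif ^+ r)) = vol (a * b) (unif ^+ r).
Proof.
have -> : ind A (unif ^+ r) = (fun X => ind 0 (unif ^+ r) (X + - A)).
  by apply/funext => X; rewrite /ind subr0.
rewrite haar_trans; last exact: ind_schw.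
rewrite (haarE (ind_schw_at r (rpred0 _) : schw_at 0 r _)) /haar_at /grid.
rewrite (eq_bigr (fun x => (1 : C^o) *+ (0 - x \in lat (unif ^- 0 * unif ^+ (0 + r))))).
  rewrite (reps_cover (W := C^o) (f := fun=> 1)) ?rpred0//.
    by rewrite /GRing.scale/= mulr1.
  by rewrite invr_neq0 ?unifX_neq0.
by move=> x _; rewrite unifVD /ind subr0 sub0r rpredN.
Qed.

Lemma haar_scalar (W : lmodType C) (f : M -> C^o) (w : W) : schw f ->
  haar (fun X => f X *: w) = haar f *: w.
Proof.
have lw : linear (fun c : C^o => c *: w : W) by move=> c x y; rewrite scalerDl scalerA.
pose T : {linear C^o -> W} := HB.pack (fun c : C^o => c *: w : W)
  (GRing.isLinear.Build C C^o W *:%R (fun c : C^o => c *: w : W) lw).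
exact: (haar_linear T).
Qed.

Lemma schw_scalar (W : lmodType C) (f : M -> C^o) (w : W) : schw f ->
  schw (fun X => f X *: w).
Proof. by move=> fS; apply: (schw_comp (T := fun c : C^o => c *: w)) => //; rewrite scale0r. Qed.

End Schwartz.

Arguments ind {a b} A t X.

Section ChangeOfVariables.
Variables (a b a' b' : nat) (g : 'M[F]_(a, b) -> 'M[F]_(a', b')) (c : C).

(** By [schw_decomp] a substitution rule has to be checked only on indicators of balls of one fixed
    radius. *)
Lemma haar_comp (W : lmodType C) s r (f : 'M[F]_(a', b') -> W) : schw_at s r f ->
  (forall x, schw (ind x (unif ^+ r) \o g)) ->
  (forall x, haar (ind x (unif ^+ r) \o g) = c * vol (a' * b') (unif ^+ r)) ->
  haar (f \o g) = c *: haar f.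
Proof.
move=> fsr gS gc.
have -> : f \o g = (fun X => \sum_(x <- grid a' b' s r) (ind x (unif ^+ r) \o g) X *: f x).
  by apply/funext => X; rewrite /= (schw_decomp fsr).
rewrite haar_sum => [|x]; last exact: schw_scalar.
rewrite (haarE fsr) /haar_at scalerA scaler_sumr; apply: eq_bigr => x _.
by rewrite haar_scalar// gc.
Qed.

End ChangeOfVariables.

Lemma haar_trmx (W : lmodType C) a b (f : 'M[F]_(a, b) -> W) : schw f ->
  haar (fun X : 'M[F]_(b, a) => f X^T) = haar f.
Proof.
move=> [s [r fsr]]; rewrite -[RHS]scale1r.
pose t (X : 'M[F]_(b, a)) : 'M[F]_(a, b) := trmx X.
have e x : ind x (unif ^+ r) \o t = ind (trmx x) (unif ^+ r).
  by apply/funext => X; rewrite /ind /= -lat_trmx linearB/= trmxK.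
apply: (@haar_comp _ _ _ _ t 1 W s r f) => // x; rewrite e; first exact: ind_schw.
by rewrite haar_ind mul1r mulnC.
Qed.

Lemma haar_ge0 a b (f : 'M[F]_(a, b) -> C^o) : (forall X, (0 : C) <= f X) -> (0 : C) <= haar f.
Proof.
move=> f0; rewrite /haar; case: pselect => // e; rewrite /haar_at.
apply: mulr_ge0; last exact: sumr_ge0.
by rewrite /vol lecR exprn_ge0// absF_ge0.
Qed.

End Integral.

(** * Integral matrices, GL(O) and its congruence subgroups *)

Section Integral_matrices.
Variables (R : realType) (F : nonArchLocalFieldType R).
Local Notation unif := (unif F).

Lemma absF_near1 (x : F) : absF (x - 1) < 1 -> absF x = 1.
Proof.
move=> x1; apply/eqP; rewrite eq_le; apply/andP; split.
  by rewrite -(subrK 1 x) absFD_le ?absF1// ltW.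
rewrite leNgt; apply/negP => x1'; have := absF_ultra x (1 - x).
by rewrite addrC subrK absF1 leNgt gt_max x1' -opprB absFN x1.
Qed.

Lemma absF_sign (n : nat) : absF ((-1 : F) ^+ n) = 1.
Proof. by rewrite absFX absFN absF1 expr1n. Qed.

Lemma absF_prod_sub (I : Type) (r : seq I) (f g : I -> F) (e : R) : 0 <= e ->
  (forall i, absF (f i) <= 1) -> (forall i, absF (g i) <= 1) ->
  (forall i, absF (f i - g i) <= e) ->
  absF (\prod_(i <- r) f i - \prod_(i <- r) g i) <= e.
Proof.
move=> e0 f1 g1 fg; elim: r => [|i r IHr]; first by rewrite !big_nil subrr absF0.
rewrite !big_cons.
have -> : f i * \prod_(j <- r) f j - g i * \prod_(j <- r) g j =
   f i * (\prod_(j <- r) f j - \prod_(j <- r) g j) + (f i - g i) * \prod_(j <- r) g j.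
  by rewrite mulrBr mulrBl addrA subrK.
apply: absFD_le; rewrite absFM.
  by rewrite -[e]mul1r ler_pM ?absF_ge0.
rewrite -[e]mulr1 ler_pM ?absF_ge0// absF_prod.
elim: r {IHr} => [|j r IHr]; first by rewrite big_nil.
by rewrite big_cons mulr_ile1 ?absF_ge0// -absF_prod absF_ge0.
Qed.

Lemma det_lat_sub a (t : F) (X Y : 'M[F]_a) : X \in lat 1 -> Y \in lat 1 ->
  X - Y \in lat t -> absF (\det X - \det Y) <= absF t.
Proof.
move=> /latP X1 /latP Y1 /latP XY; rewrite /determinant -sumrB.
apply: absF_sum_le => [|s _]; first exact: absF_ge0.
rewrite -mulrBr absFM absF_sign mul1r.
apply: absF_prod_sub => [|i|i|i]; rewrite ?absF_ge0//.
- by rewrite -(@absF1 _ F).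
- by rewrite -(@absF1 _ F).
- by have := XY i (s i); rewrite !mxE.
Qed.

Lemma det_lat a (X : 'M[F]_a) : X \in lat 1 -> absF (\det X) <= 1.
Proof.
move=> X1; case: a X X1 => [|a] X X1; first by rewrite det_mx00 absF1.
have := det_lat_sub X1 (rpred0 _) (_ : X - 0 \in lat 1).
by rewrite subr0 det0 subr0 absF1; exact.
Qed.

Lemma invmx_lat a (X : 'M[F]_a) : X \in lat 1 -> absF (\det X) = 1 -> invmx X \in lat 1.
Proof.
move=> X1 dX; rewrite /invmx; case: ifP => // _.
apply: latZ1; first by rewrite absFV dX invr1.
apply/latP => i j; rewrite mxE /cofactor absFM absF_sign mul1r absF1.
apply: det_lat; apply/latP => k l; rewrite !mxE.
by move/latP: X1; exact.
Qed.

(** This is GL_a(O) for the ring O of integers: Cramer's rule makes the inverse integral as well. *)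
Definition GLO a : pred 'M[F]_a := [pred X | (X \in lat 1) && (absF (\det X) == 1)].

Lemma GLO_unit a (X : 'M[F]_a) : X \in @GLO a -> X \in unitmx.
Proof.
by case/andP => _ /eqP dX; rewrite unitmxE unitfE -absF_eq0 dX oner_neq0.
Qed.

Lemma GLO_inv a (X : 'M[F]_a) : X \in @GLO a -> invmx X \in @GLO a.
Proof.
move=> XO; have XU := GLO_unit XO; case/andP: XO => X1 /eqP dX.
rewrite inE invmx_lat//=; have := congr1 (fun Z => absF (\det Z)) (mulmxV XU).
by rewrite det_mulmx absFM dX mul1r det1 absF1 => ->.
Qed.

Lemma GLO_lat a b (X : 'M[F]_a) (t : F) (Y : 'M[F]_(a, b)) : X \in @GLO a ->
  (X *m Y \in lat t) = (Y \in lat t).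
Proof.
move=> XO; have lx Z (W : 'M[F]_(a, b)) : Z \in @GLO a -> W \in lat t -> Z *m W \in lat t.
  by move=> /andP[Z1 _] Wt; rewrite -[t]mul1r; exact: lat_mulmx.
apply/idP/idP => [XY|]; last exact: lx.
by rewrite -(mulKmx (GLO_unit XO) Y); apply: lx XY; exact: GLO_inv.
Qed.

Lemma GLO_latr a b (X : 'M[F]_a) (t : F) (Y : 'M[F]_(b, a)) : X \in @GLO a ->
  (Y *m X \in lat t) = (Y \in lat t).
Proof.
move=> XO; rewrite -(lat_trmx t (Y *m X)) trmx_mul GLO_lat ?lat_trmx//.
by case/andP: XO => X1 dX; rewrite inE lat_trmx X1 det_tr.
Qed.

(** The determinant moves by at most |unif|^(r+1) < 1 and so stays a unit. The exponent starts at
    [r.+1] because a matrix congruent to 1 modulo O alone can be singular. *)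
Lemma GLO_near1 a (X : 'M[F]_a) r : X - 1%:M \in lat (unif ^+ r.+1) -> X \in @GLO a.
Proof.
move=> Xr; have X1 : X \in lat 1.
  rewrite -(subrK 1%:M X) rpredD ?lat_1//.
  by apply: lat_le Xr; rewrite absF1 unifX_le1.
rewrite inE X1; apply/eqP/absF_near1; rewrite -(@det1 F a).
apply: (le_lt_trans (det_lat_sub X1 (lat_1 _ _) Xr)).
by rewrite absFX exprn_ilte1// ?absF_ge0 ?absF_unif_lt1.
Qed.

Lemma GLO_near1V a (X : 'M[F]_a) r : X - 1%:M \in lat (unif ^+ r.+1) ->
  invmx X - 1%:M \in lat (unif ^+ r.+1).
Proof.
move=> Xr; have XO := GLO_near1 Xr; have XU := GLO_unit XO.
have -> : invmx X - 1%:M = - (invmx X *m (X - 1%:M)).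
  by rewrite mulmxBr mulVmx// mulmx1 opprB.
by rewrite rpredN GLO_lat// GLO_inv.
Qed.

Lemma perm_mx_GLO a (s : 'S_a) : perm_mx s \in @GLO a.
Proof.
rewrite inE det_perm absF_sign eqxx andbT; apply/latP => i j.
by rewrite !mxE absF1; case: (_ == _); rewrite ?absF1 ?absF0 ?ler01.
Qed.

Lemma scalar_mx_lat a b (t c : F) (X : 'M[F]_(a, b)) : c != 0 ->
  (c%:M *m X \in lat (c * t)) = (X \in lat t).
Proof. by move=> c0; rewrite mul_scalar_mx latZ. Qed.

End Integral_matrices.

(** * Scaling of Haar measure under invertible matrices *)

Section Determinant.
Variables (R : realType) (F : nonArchLocalFieldType R).
Local Notation C := R[i].
Local Notation unif := (unif F).

Lemma schw_mulmx (W : nmodType) a b (h : 'M[F]_a) (f : 'M[F]_(a, b) -> W) :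
  h \in unitmx -> schw f -> schw (fun X => f (h *m X)).
Proof.
move=> hU [s [r [fs fr]]]; have [s1 h1] := lat_bounded h.
have [s2 h2] := lat_bounded (invmx h).
exists (s + s2)%N, (r + s1)%N; split=> [X Xs|X d dr] /=.
  apply: fs; apply: contra Xs => hX; rewrite -(mulKmx hU X) addnC exprD invfM.
  exact: lat_mulmx.
rewrite mulmxDr; apply: fr; have := lat_mulmx h1 dr.
by rewrite addnC exprD mulKf ?unifX_neq0.
Qed.

Lemma schw_scale (W : nmodType) a b r (f : 'M[F]_(a, b) -> W) :
  schw f -> schw (fun X => f (unif ^- r *: X)).
Proof.
move=> fS; have uU : ((unif ^- r)%:M : 'M[F]_a) \in unitmx.
  by rewrite unitmxE det_scalar unitrX// unitfE invr_neq0// unifX_neq0.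
have := schw_mulmx uU fS; by under eq_fun do rewrite mul_scalar_mx.
Qed.

Lemma haar_scale (W : lmodType C) a b r (f : 'M[F]_(a, b) -> W) : schw f ->
  haar (fun X => f (unif ^- r *: X)) = vol (a * b) (unif ^+ r) *: haar f.
Proof.
elim: r f => [|r IHr] f fS.
  by rewrite expr0 invr1 vol1 scale1r; under eq_fun do rewrite scale1r.
have -> : (fun X => f (unif ^- r.+1 *: X)) =
    (fun X => (fun Y => f (unif ^- 1 *: Y)) (unif ^- r *: X)).
  by apply/funext => X; rewrite scalerA -invfM -exprD addnC addn1.
rewrite (IHr (fun Y => f (unif ^- 1 *: Y))); last exact: schw_scale.
rewrite [in RHS]exprSr volM -scalerA; congr (_ *: _).
have [s [t [fs ft]]] := fS.
have gst : schw_at s t.+1 (fun Y => f (unif ^- 1 *: Y)).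
  split=> [X Xs|X d dt].
    apply: fs; apply: contra Xs => Xs; rewrite -[X](scalerKV (unifX_neq0 F 1)).
    by apply: latZ1; rewrite ?unifX_le1.
  rewrite scalerDr; apply: ft.
  by rewrite -(@latZ _ _ _ _ (unif ^+ 1)) ?unifX_neq0// scalerKV ?unifX_neq0// -exprS.
rewrite (haarE gst) (@haarE _ _ _ _ _ s.+1 t)/haar_at; last first.
  by apply: schw_at_le (conj fs ft).
rewrite /grid (sum_reps_scale _ _ _ f) addnS -invfM -exprD add1n.
by rewrite exprSr volM -scalerA scalerA mulrC -scalerA.
Qed.

Variables a b : nat.
Implicit Types h : 'M[F]_a.

(** The volume of the preimage of the unit ball under h; [haar_modulus] shows that the same factor
    governs every integral. *)
Definition modulus h : C := haar (fun X : 'M[F]_(a, b) => ind 0 1 (h *m X)).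

(** For the indicator of an arbitrary ball, a translation moves the center to 0 and a scalar
    substitution makes the radius 1; both are compatible with left multiplication by h. *)
Lemma haar_modulus (W : lmodType C) h (f : 'M[F]_(a, b) -> W) :
  h \in unitmx -> schw f -> haar (fun X => f (h *m X)) = modulus h *: haar f.
Proof.
move=> hU [s [r fsr]].
apply: (@haar_comp _ _ _ _ _ _ (mulmx h) (modulus h) W s r f) => // x.
  by apply: schw_mulmx => //; exact: ind_schw.
have i0 : schw (fun X => ind 0 1 (h *m X : 'M[F]_(a, b))).
  by apply: (schw_mulmx (f := ind 0 (unif ^+ 0))) => //; exact: ind_schw.
have i1 : schw (fun X => ind 0 (unif ^+ r) (h *m X : 'M[F]_(a, b))).
  by apply: (schw_mulmx (f := ind 0 (unif ^+ r))) => //; exact: ind_schw.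
have -> : ind x (unif ^+ r) \o mulmx h =
    (fun X => ind 0 (unif ^+ r) (h *m (X + - (invmx h *m x)))).
  by apply/funext => X; rewrite /ind /= subr0 mulmxDr mulmxN mulKVmx.
rewrite (haar_trans (f := fun X => ind 0 (unif ^+ r) (h *m X)))//.
have -> : (fun X => ind 0 (unif ^+ r) (h *m X)) =
    (fun X : 'M[F]_(a, b) => ind 0 1 (h *m (unif ^- r *: X))).
  apply/funext => X; rewrite /ind !subr0 -scalemxAr.
  by rewrite -[in LHS](@latZ _ _ _ _ (unif ^- r)) ?invr_neq0 ?mulVf// unifX_neq0.
by rewrite (haar_scale r (f := fun X => ind 0 1 (h *m X)))// mulrC.
Qed.

Lemma modulus1 : modulus 1%:M = 1.
Proof.
rewrite /modulus; under eq_fun do rewrite mul1mx.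
by rewrite (haar_ind 0 0) vol1.
Qed.

Lemma modulusM h h' : h \in unitmx -> h' \in unitmx ->
  modulus (h *m h') = modulus h * modulus h'.
Proof.
move=> hU hU'; rewrite mulrC {1}/modulus.
under eq_fun do rewrite -mulmxA.
rewrite (haar_modulus (f := fun X => ind 0 1 (h *m X)))//.
by apply: (schw_mulmx (f := ind 0 (unif ^+ 0))) => //; exact: ind_schw.
Qed.

Lemma modulus_GLO h : h \in @GLO R F a -> modulus h = 1.
Proof.
move=> hO; rewrite -modulus1 /modulus; congr haar; apply/funext => X.
by rewrite /ind mul1mx !subr0 GLO_lat.
Qed.

Lemma modulus_ge0 h : 0 <= modulus h.
Proof. by apply: haar_ge0 => X; rewrite /ind ler0n. Qed.

Lemma modulus_unif : modulus unif%:M * vol (a * b) unif = 1.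
Proof.
have uU : (unif%:M : 'M[F]_a) \in unitmx.
  by rewrite unitmxE det_scalar unitrX// unitfE unif_neq0.
have h := haar_modulus (f := ind 0 (unif ^+ 1) : 'M[F]_(a, b) -> C^o) uU (ind_schw _ _).
rewrite haar_ind in h; apply: etrans (esym h) _.
rewrite -modulus1 /modulus; congr haar.
apply/funext => X; rewrite /ind mul1mx !subr0 expr1 -[X in lat X]mulr1.
by rewrite scalar_mx_lat// unif_neq0.
Qed.

(** The target formula modulus h = |det h|^(-b), written as a product so that it passes to products
    and can be cancelled from either side. It is then proved on generators of GL_a(F). *)
Definition modulus_det h := h \in unitmx /\ modulus h * vol b (\det h) = 1.

Lemma modulus_detM h h' : modulus_det h -> modulus_det h' -> modulus_det (h *m h').
Proof.
move=> [hU hd] [hU' hd']; split; first by rewrite unitmx_mul hU.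
by rewrite modulusM// det_mulmx volM mulrACA hd hd' mulr1.
Qed.

Lemma modulus_det_cancell h h' : modulus_det h -> modulus_det (h *m h') -> modulus_det h'.
Proof.
move=> [hU hd] []; rewrite unitmx_mul hU => /= hU'.
by rewrite modulusM// det_mulmx volM mulrACA hd mul1r; split.
Qed.

Lemma modulus_det_cancelr h h' : modulus_det h' -> modulus_det (h *m h') -> modulus_det h.
Proof.
move=> [hU' hd'] []; rewrite unitmx_mul hU' andbT => /= hU.
by rewrite modulusM// det_mulmx volM mulrACA hd' mulr1; split.
Qed.

Lemma modulus_det_GLO h : h \in @GLO R F a -> modulus_det h.
Proof.
move=> hO; split; first exact: GLO_unit hO.
rewrite modulus_GLO// mul1r /vol; case/andP: hO => _ /eqP->.
by rewrite expr1n.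
Qed.

Definition diag1 (i : 'I_a) (x : F) : 'M[F]_a :=
  diag_mx (\row_j (if j == i then x else 1)).

Lemma diag1M i x y : diag1 i x *m diag1 i y = diag1 i (x * y).
Proof.
rewrite /diag1 mulmx_diag; congr diag_mx; apply/rowP => j; rewrite !mxE.
by case: ifP; rewrite ?mulr1.
Qed.

Lemma det_diag1 i x : \det (diag1 i x) = x.
Proof.
rewrite det_diag (bigD1 i)//= mxE eqxx big1 ?mulr1// => j /negPf ji.
by rewrite mxE ji.
Qed.

Lemma diag1_unit i x : x != 0 -> diag1 i x \in unitmx.
Proof. by rewrite unitmxE det_diag1 unitfE. Qed.

Lemma diag1_tperm i j x :
  tperm_mx i j *m diag1 i x *m tperm_mx i j = diag1 j x :> 'M[F]_a.
Proof.
rewrite -xrowE -xcolE; apply/matrixP => k l; rewrite !mxE (inj_eq perm_inj).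
by rewrite -(inj_eq (@perm_inj _ (tperm i j))) tpermK tpermL.
Qed.

Lemma diag_mx_prod (d : 'I_a -> F) (s : seq 'I_a) : uniq s ->
  (forall i, i \in s -> modulus_det (diag1 i (d i))) ->
  modulus_det (diag_mx (\row_j (if j \in s then d j else 1))).
Proof.
elim: s => [_ _|i s IHs /= /andP[iNs us] ds].
  have -> : diag_mx (\row_j (if j \in [::] then d j else 1)) = 1%:M :> 'M[F]_a.
    by rewrite -diag_const_mx; congr diag_mx; apply/rowP => j; rewrite !mxE.
  apply: modulus_det_GLO; rewrite inE lat_1 det1 absF1 eqxx//.
have -> : diag_mx (\row_j (if j \in i :: s then d j else 1)) =
    diag1 i (d i) *m diag_mx (\row_j (if j \in s then d j else 1)).
  rewrite mulmx_diag; congr diag_mx; apply/rowP => j; rewrite !mxE inE.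
  have [->|ji] := eqVneq j i; last by rewrite mul1r.
  by rewrite (negPf iNs) mulr1.
apply: modulus_detM; first by apply: ds; rewrite mem_head.
by apply: IHs => // j js; apply: ds; rewrite inE js orbT.
Qed.

(** Permutation matrices lie in GL(O), so all the matrices [diag1 i unif] share one modulus c. Their
    product is the scalar matrix [unif%:M], of known modulus, which gives (c |unif|^b)^a = 1; a
    nonnegative number with this property is 1. *)
Lemma modulus_det_unif i : modulus_det (diag1 i unif).
Proof.
have u0 := unif_neq0 F.
split; first exact: diag1_unit.
rewrite det_diag1; set c := modulus _.
have cj j : modulus (diag1 j unif) = c.
  have tO : tperm_mx i j \in @GLO R F a by exact: perm_mx_GLO.
  have tU := GLO_unit tO.
  rewrite -(diag1_tperm i) !modulusM ?unitmx_mul ?tU ?diag1_unit//.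
  by rewrite !(modulus_GLO tO) mul1r mulr1.
have a0 : (0 < a)%N by rewrite (leq_ltn_trans _ (ltn_ord i)).
have mp (s : seq 'I_a) : uniq s ->
    modulus (diag_mx (\row_j (if j \in s then unif else 1))) = c ^+ size s.
  elim: s => [_|k s IHs /= /andP[ks us]].
    rewrite expr0 -modulus1; congr modulus.
    by rewrite -diag_const_mx; congr diag_mx; apply/rowP => j; rewrite !mxE.
  rewrite exprS -IHs// -(cj k) -modulusM ?diag1_unit//; last first.
    rewrite unitmxE det_diag unitfE; apply/prodf_neq0 => j _; rewrite mxE.
    by case: ifP; rewrite ?oner_neq0.
  congr modulus; rewrite mulmx_diag; congr diag_mx; apply/rowP => j; rewrite !mxE inE.
  have [->|ji] := eqVneq j k; last by rewrite mul1r.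
  by rewrite (negPf ks) mulr1.
have := mp (enum 'I_a) (enum_uniq _); rewrite size_enum_ord.
have -> : diag_mx (\row_j (if j \in enum 'I_a then unif else 1)) = unif%:M :> 'M[F]_a.
  by rewrite -diag_const_mx; congr diag_mx; apply/rowP => j; rewrite !mxE mem_enum.
move=> cE; have := modulus_unif; rewrite cE => /eqP.
have -> : vol (a * b) unif = vol b unif ^+ a.
  by rewrite /vol mulnC exprM rmorphXn.
rewrite -exprMn pexpr_eq1// => [/eqP//|].
by rewrite mulr_ge0 ?modulus_ge0// /vol lecR exprn_ge0// absF_ge0.
Qed.

(** By [absF_discrete], x is a quotient of powers of [unif] times an element of absolute value 1,
    and the latter gives a matrix in GL(O). *)
Lemma modulus_det_diag1 i x : x != 0 -> modulus_det (diag1 i x).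
Proof.
move=> x0; have [m [n xmn]] := absF_discrete x0.
have pX k : modulus_det (diag1 i (unif ^+ k)).
  elim: k => [|k IHk]; last first.
    by rewrite exprS -diag1M; apply: modulus_detM => //; exact: modulus_det_unif.
  apply: modulus_det_GLO; rewrite inE det_diag1 absF1 eqxx andbT.
  apply/latP => k l; rewrite !mxE absF1; case: (k == l); rewrite ?mulr0n ?absF0//.
  by rewrite mulr1n; case: (k == i); rewrite ?expr0 absF1.
apply: (modulus_det_cancelr (pX n)); rewrite diag1M.
have -> : x * unif ^+ n = (x * unif ^+ n / unif ^+ m) * unif ^+ m.
  by rewrite divfK// unifX_neq0.
rewrite -diag1M; apply: modulus_detM => //; apply: modulus_det_GLO.
have u1 : absF (x * unif ^+ n / unif ^+ m) = 1.
  rewrite !absFM xmn absFM absFV mulfVK ?absF_eq0 ?unifX_neq0// absFV.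
  by rewrite mulfV// absF_eq0 unifX_neq0.
rewrite inE det_diag1 u1 eqxx andbT.
apply/latP => k l; rewrite !mxE absF1; case: (k == l); rewrite ?mulr0n ?absF0//.
by rewrite mulr1n; case: (k == i); rewrite ?u1 ?absF1.
Qed.

Lemma modulus_det_diag (d : 'I_a -> F) : (forall i, d i != 0) ->
  modulus_det (diag_mx (\row_i d i)).
Proof.
move=> d0; have -> : diag_mx (\row_i d i) =
    diag_mx (\row_j (if j \in enum 'I_a then d j else 1)).
  by congr diag_mx; apply/rowP => j; rewrite !mxE mem_enum.
apply: diag_mx_prod => [|i _]; first exact: enum_uniq.
exact: modulus_det_diag1.
Qed.

(* Conjugating by diag(unif^(N w i)) shrinks the off-diagonal entries. *)
Lemma modulus_det_trig (w : 'I_a -> nat) h : (forall i, h i i != 0) ->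
  (forall i j, i != j -> h i j != 0 -> (w j < w i)%N) -> modulus_det h.
Proof.
move=> h0 hw; pose d := diag_mx (\row_i h i i).
have dU : d \in unitmx.
  by rewrite unitmxE det_diag unitfE; apply/prodf_neq0 => i _; rewrite mxE.
pose T := \matrix_(i, j) (h i j / h j j).
have hT : h = T *m d.
  by apply/matrixP => i j; rewrite mul_mx_diag !mxE divfK.
rewrite hT; apply: modulus_detM; last exact: modulus_det_diag.
have [s Ts] := lat_bounded T.
pose D := diag_mx (\row_i unif ^+ (s.+1 * w i)).
have DP : modulus_det D by apply: modulus_det_diag => i; rewrite unifX_neq0.
apply: (modulus_det_cancell DP).
pose K := \matrix_(i, j) (unif ^+ (s.+1 * (w i - w j)) * T i j).
have -> : D *m T = K *m D.
  apply/matrixP => i j; rewrite mul_diag_mx mul_mx_diag !mxE.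
  have [->|ij] := eqVneq i j; first by rewrite subnn muln0 expr0 mul1r mulrC.
  have [->|hij] := eqVneq (h i j) 0; first by rewrite mul0r !mulr0 mul0r.
  rewrite mulrAC -exprD -mulnDr subnK// ltnW//; exact: hw.
apply: modulus_detM => //; apply: modulus_det_GLO; apply: (@GLO_near1 _ _ _ _ 0).
apply/latP => i j; rewrite !mxE expr1.
have [->|ij] := eqVneq i j.
  by rewrite subnn muln0 expr0 mul1r divff// subrr absF0 absF_ge0.
rewrite subr0; have [->|hij] := eqVneq (h i j) 0.
  by rewrite mul0r mulr0 absF0 absF_ge0.
have wij := hw _ _ ij hij.
have -> : (w i - w j = (w i - w j).-1.+1)%N by rewrite prednK// subn_gt0.
rewrite mulnS exprD absFM absFM; move/latP: Ts => /(_ i j); rewrite mxE => Tij.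
rewrite mulrAC; apply: (@le_trans _ _ (absF (unif ^+ s.+1) * absF (h i j / h j j))).
  by rewrite ler_piMr ?mulr_ge0 ?absF_ge0// unifX_le1.
rewrite (le_trans (ler_wpM2l (absF_ge0 _) Tij))//.
by rewrite -absFM exprS mulfK// unifX_neq0.
Qed.

End Determinant.

(** LUP decomposition: the permutation factor is in GL(O), and the triangular factors are covered by
    [modulus_det_trig], with the index as weight for the lower one and the reversed index for the
    upper one. *)
Lemma modulus_detE (R : realType) (F : nonArchLocalFieldType R) a b (h : 'M[F]_a) :
  h \in unitmx -> modulus_det b h.
Proof.
case: a h => [|a] h hU.
  apply: modulus_det_GLO; rewrite inE det_mx00 absF1 eqxx andbT.
  by apply/latP => -[].
have := cormen_lup_correct h; have := cormen_lup_lower h; have := cormen_lup_upper h.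
have := cormen_lup_perm h; have := cormen_lup_detL h.
case: (cormen_lup h) => [[P L] U] /= dL /is_perm_mxP[s ->] Uu Ll PLU.
have PO := perm_mx_GLO F s.
have PhU : perm_mx s *m h \in unitmx by rewrite unitmx_mul hU (GLO_unit PO).
have dU : \det U = \prod_i U i i.
  rewrite -det_tr det_trig; first by apply: eq_bigr => i _; rewrite mxE.
  by apply/is_trig_mxP => i j ij; rewrite mxE Uu.
have U0 i : U i i != 0.
  apply: contraTneq PhU => Ui; rewrite mulmxE PLU unitmxE -mulmxE det_mulmx dL mul1r dU.
  by rewrite (bigD1 i)//= Ui mul0r unitfE eqxx.
apply: (@modulus_det_cancell _ _ _ _ (perm_mx s)); first exact: modulus_det_GLO.
rewrite mulmxE PLU; apply: modulus_detM.
  apply: (@modulus_det_trig _ _ _ _ val) => [i|i j ij]; first by rewrite Ll// eqxx oner_neq0.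
  by apply: contraNT; rewrite -leqNgt => ij'; rewrite Ll// (negPf ij).
apply: (@modulus_det_trig _ _ _ _ (fun i : 'I_a.+1 => a.+1 - i)%N) => // i j ij Uij.
rewrite ltn_sub2l//; have : (i != j :> nat) by [].
by rewrite neq_ltn => /orP[//|/Uu U0']; rewrite U0' eqxx in Uij.
Qed.

Section LinearSubstitution.
Variables (R : realType) (F : nonArchLocalFieldType R) (W : lmodType R[i]).

Lemma haar_mull a b (h : 'M[F]_a) (f : 'M[F]_(a, b) -> W) : h \in unitmx -> schw f ->
  haar (fun X => f (h *m X)) = (vol b (\det h))^-1 *: haar f.
Proof.
move=> hU fS; have [_ hd] := modulus_detE b hU; rewrite haar_modulus//; congr (_ *: _).
have v0 : vol b (\det h) != 0 by rewrite vol_neq0// -unitfE -unitmxE.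
by apply: (mulIf v0); rewrite hd mulVf.
Qed.

Lemma schw_trmx a b (f : 'M[F]_(a, b) -> W) : schw f ->
  schw (fun X : 'M[F]_(b, a) => f X^T).
Proof.
move=> [s [r [fs fr]]]; exists s, r; split=> [X Xs|X d dr].
  by apply: fs; rewrite lat_trmx.
by rewrite linearD/=; apply: fr; rewrite lat_trmx.
Qed.

Lemma schw_mulr a b (h : 'M[F]_b) (f : 'M[F]_(a, b) -> W) :
  h \in unitmx -> schw f -> schw (fun X => f (X *m h)).
Proof.
move=> hU fS; have hU' : h^T \in unitmx by rewrite unitmx_tr.
have := schw_trmx (schw_mulmx hU' (schw_trmx fS)).
by under eq_fun do rewrite trmx_mul !trmxK.
Qed.

Lemma haar_mulr a b (h : 'M[F]_b) (f : 'M[F]_(a, b) -> W) : h \in unitmx -> schw f ->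
  haar (fun X => f (X *m h)) = (vol a (\det h))^-1 *: haar f.
Proof.
move=> hU fS; have hU' : h^T \in unitmx by rewrite unitmx_tr.
rewrite -haar_trmx; last exact: schw_mulr.
rewrite -(haar_trmx fS) -det_tr -(haar_mull hU' (schw_trmx fS)).
by congr haar; apply/funext => X; rewrite trmx_mul trmxK.
Qed.

End LinearSubstitution.

(** * Compactness of lattices, finite covers and Schwartz functions *)

Section Compactness.
Variables (R : realType) (F : nonArchLocalFieldType R).
Local Notation unif := (unif F).

Lemma nbhs_absF_le (x : F) (A : set F) :
  nbhs x A <-> exists n, forall y, absF (y - x) <= absF (unif ^+ n) -> A y.
Proof.
split=> [/nbhsF[e e0 eA]|[n nA]].
  have [n ne] := unifX_small F e0; exists n => y yx; apply: eA.
  by rewrite -opprB absFN (le_lt_trans yx)// absFX.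
apply/nbhsF; exists (absF (unif ^+ n)); first by rewrite absF_gt0 unifX_neq0.
by move=> y yx; apply: nA; rewrite -opprB absFN ltW.
Qed.

Lemma nbhs_lat a b (X : 'M[F]_(a, b)) (A : set 'M[F]_(a, b)) :
  nbhs X A <-> exists n, forall d, d \in lat (unif ^+ n) -> A (X + d).
Proof.
split=> [[P nP PA]|[n nA]].
  have /choice[g gP] : forall ij : 'I_a * 'I_b, exists n, forall y,
      absF (y - X ij.1 ij.2) <= absF (unif ^+ n) -> P ij.1 ij.2 y.
    by move=> ij; apply/nbhs_absF_le.
  exists (\max_ij g ij)%N => d /latP dn; apply: PA => i j.
  apply: (gP (i, j)); rewrite mxE addrAC subrr add0r (le_trans (dn i j))//.
  by rewrite unifX_le// leq_bigmax.
exists (fun i j => [set y | absF (y - X i j) <= absF (unif ^+ n)]).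
  by move=> i j; apply/nbhs_absF_le; exists n.
move=> Y XY; rewrite -(subrK X Y) addrC; apply: nA; apply/latP => i j.
by rewrite !mxE; exact: XY.
Qed.

Lemma closed_absF_le (e : R) : closed [set x : F | absF x <= e].
Proof.
move=> x clx; have [x0|] := eqVneq x 0; first have /= := clx setT filterT.
  rewrite x0 /= absF0 => -[y [/= ye _]]; exact: le_trans (absF_ge0 _) ye.
rewrite -absF_gt0 => x0; have nx : nbhs x [set y | absF (x - y) < absF x].
  exact: near_absF.
have [y [/= ye yx]] := clx _ nx; have := absF_ultra (x - y) y; rewrite subrK => h.
by move: h; rewrite le_max leNgt yx /= => /le_trans; exact.
Qed.

(** Some compact neighbourhood of 0 contains a small closed ball, which is then compact;
    multiplication by a scalar carries it onto any other ball. *)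
Lemma compact_absF_le (t : F) : compact [set x : F | absF x <= absF t].
Proof.
have [U U0 [cU clU]] := absF_locally_compact (0 : F) I.
have /nbhs_absF_le[n nU] : nbhs (0 : F) U.
  have U1 : nbhs (0 : F) [set y | [set: F] y -> U y] by [].
  by apply: filterS U1 => y; exact.
have cn : compact [set x : F | absF x <= absF (unif ^+ n)].
  apply: (subclosed_compact (@closed_absF_le _) cU) => y yn.
  by apply: nU; rewrite subr0.
have -> : [set x : F | absF x <= absF t] =
    (fun x => t / unif ^+ n * x) @` [set x : F | absF x <= absF (unif ^+ n)].
  have [->|t0] := eqVneq t 0.
    apply/seteqP; split=> [x /=|_ [x _ <-]]; last by rewrite /= !mul0r.
    rewrite absF0 le_eqVlt absF_eq0 ltNge absF_ge0 orbF => /eqP->.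
    by exists 0; rewrite ?mulr0//= absF0 absF_ge0.
  apply/seteqP; split=> [x /= xt|_ [x /= xn <-]].
    exists (unif ^+ n / t * x).
      rewrite /= -mulrA absFM ger_pMr ?absF_gt0 ?unifX_neq0// absFM absFV.
      by rewrite mulrC ler_pdivrMr ?absF_gt0// mul1r.
    by rewrite mulrA mulrA divfK ?unifX_neq0// divff// mul1r.
  rewrite /= -mulrA absFM ger_pMr ?absF_gt0// absFM absFV.
  by rewrite mulrC ler_pdivrMr ?absF_gt0 ?unifX_neq0// mul1r.
apply: continuous_compact => //; apply: continuous_subspaceT.
apply: continuousFM; first exact: continuousF_cst.
by move=> x; exact: cvg_id.
Qed.

Lemma compact_lat a b (t : F) : compact [set X : 'M[F]_(a, b) | X \in lat t].
Proof.
(* [rV_compact] speaks of pointed spaces, hence this copy of F with base point 0. *)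
pose T : ptopologicalType := HB.pack (NonArchLocalField.sort F) (isPointed.Build F 0).
have cT : @compact T [set x : T | absF (x : F) <= absF t] by exact: compact_absF_le.
have cr := @rV_compact T (a * b) (fun=> [set x : T | absF (x : F) <= absF t]) (fun=> cT).
have -> : [set X : 'M[F]_(a, b) | X \in lat t] =
   (fun v : 'rV[T]_(a * b) => (vec_mx v : 'M[F]_(a, b))) @`
   [set v : 'rV[T]_(a * b) | forall i, absF (v ord0 i : F) <= absF t].
  apply/seteqP; split=> [X /= /latP Xt|_ [v /= vt <-]].
    exists (mxvec X); last by rewrite mxvecK.
    by move=> i; case: (mxvec_indexP i) => k l; rewrite mxvecE.
  by apply/latP => i j; rewrite mxE; exact: vt.
apply: continuous_compact; last exact: cr.
apply: continuous_subspaceT; apply: continuous_matrix => i j.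
have -> : (fun v : 'rV[T]_(a * b) => (vec_mx v : 'M[F]_(a, b)) i j) =
  (fun v => (v : 'rV[F]_(a * b)) ord0 (mxvec_index i j)).
  by apply/funext => v; rewrite mxE.
exact: continuous_entry.
Qed.

(** A finite subcover by balls of variable radius. In the near-covering form of compactness, the
    filter on finite lists ordered by inclusion turns a property holding eventually into one holding
    for a single list. *)
Lemma compact_lat_cover a b (K : set 'M[F]_(a, b)) (r : 'M[F]_(a, b) -> nat) :
  compact K ->
  exists xs : seq 'M[F]_(a, b), forall X, K X ->
    exists2 x, x \in xs & X - x \in lat (unif ^+ r x).
Proof.
move=> /compact_near_coveringP cK.
pose G : set_system (seq 'M[F]_(a, b)) :=
  filter_from [set: seq 'M[F]_(a, b)]
    (fun ys => [set xs : seq 'M[F]_(a, b) | {subset ys <= xs}]).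
have GF : Filter G.
  apply: filter_from_filter => [|ys zs _ _]; first by exists [::].
  exists (ys ++ zs) => // xs /= xsP.
  by split=> y yP; apply: xsP; rewrite mem_cat yP ?orbT.
have [X KX|ys _ ysP] := cK _ G (fun xs X => exists2 x, x \in xs & X - x \in lat (unif ^+ r x)) GF.
  exists ([set Y : 'M[F]_(a, b) | Y - X \in lat (unif ^+ r X)],
    [set xs : seq 'M[F]_(a, b) | {subset [:: X] <= xs}]).
    split; last by exists [:: X].
    by apply/nbhs_lat; exists (r X) => d dr /=; rewrite addrC addKr.
  by move=> [Y xs] /= [YX Xxs]; exists X => //; apply: Xxs; rewrite mem_head.
by exists ys => X KX; apply: ysP => //= y.
Qed.

Lemma lat_cover a b s (r : 'M[F]_(a, b) -> nat) :
  exists xs : seq 'M[F]_(a, b), forall X, X \in lat (unif ^- s) ->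
    exists2 x, x \in xs & X - x \in lat (unif ^+ r x).
Proof. exact: (compact_lat_cover r (@compact_lat a b (unif ^- s))). Qed.

(** For each X the second ball is covered separately; then the first ball is covered with the
    largest exponent occurring in the list attached to X. *)
Lemma lat_cover2 a b a' b' s (r : 'M[F]_(a, b) -> 'M[F]_(a', b') -> nat) :
  exists xs : seq ('M[F]_(a, b) * 'M[F]_(a', b')), forall X Y,
    X \in lat (unif ^- s) -> Y \in lat (unif ^- s) ->
    exists2 xy, xy \in xs & (X - xy.1 \in lat (unif ^+ r xy.1 xy.2)) &&
                            (Y - xy.2 \in lat (unif ^+ r xy.1 xy.2)).
Proof.
have /choice[g gP] := fun X => lat_cover s (r X).
have [xs xsP] := lat_cover s (fun X => \max_(y <- g X) r X y)%N.
exists [seq (x, y) | x <- xs, y <- g x] => X Y Xs Ys.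
have [x xxs Xx] := xsP _ Xs; have [y yg Yy] := gP x _ Ys.
exists (x, y); first exact: allpairs_f_dep.
by rewrite /= Yy andbT; apply: lat_unifX Xx; exact: leq_bigmax_seq.
Qed.

Section SchwartzFunctions.
Variable m : nat.
Local Notation M := 'M[F]_m.

(** Local constancy becomes uniform on the compact support by a finite cover on which phi is
    constant. *)
Lemma schwartz_schw (phi : M -> R[i]^o) : phi \in @schwartz R F m -> schw phi.
Proof.
move=> /asboolP[lphi cphi].
have sub X : phi X != 0 -> closure [set X | phi X != 0] X by move=> ?; exact: subset_closure.
have [xs xsP] := compact_lat_cover (fun=> 0%N) cphi.
have /choice[r rP] : forall X, exists n, forall d, d \in lat (unif ^+ n) -> phi (X + d) = phi X.
  by move=> X; have /nbhs_lat := lphi X.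
have [ys ysP] := compact_lat_cover r cphi.
have /choice[s sP] := @lat_bounded R F m m.
have inv X d : phi X != 0 -> d \in lat (unif ^+ (\max_(y <- ys) r y)%N) -> phi (X + d) = phi X.
  move=> /sub/ysP[y yys Xy] dr; have {}dr : d \in lat (unif ^+ r y).
    by apply: lat_unifX dr; exact: leq_bigmax_seq.
  have e : phi X = phi y by rewrite -[in LHS](subrK y X) addrC rP.
  rewrite e -[in LHS](subrK y (X + d)) addrC rP//.
  by rewrite addrAC rpredD.
exists (\max_(x <- xs) s x)%N, (\max_(y <- ys) r y)%N; split=> [X|X d dr].
  apply: contraNeq => /sub/xsP[x xxs Xx]; rewrite -(subrK x X) rpredD//.
    by apply: lat_unifXV Xx.
  by apply: lat_unifV (sP x); exact: leq_bigmax_seq.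
have [X0|X0] := eqVneq (phi X) 0; last exact: inv.
(* At a zero X of phi the cover says nothing; if phi is nonzero at X + d, invariance is applied
   there with -d. *)
have [->|Xd0] := eqVneq (phi (X + d)) 0; first by rewrite X0.
by have := inv (X + d) (- d) Xd0; rewrite rpredN addrK => /(_ dr).
Qed.

Lemma schw_schwartz (phi : M -> R[i]^o) : schw phi -> phi \in @schwartz R F m.
Proof.
move=> [s [r [fs fr]]]; apply/asboolP; split=> [X|].
  by apply/nbhs_lat; exists r => d dr; exact: fr.
apply: (subclosed_compact (@closed_closure _ _) (@compact_lat m m (unif ^- s))).
move=> X clX /=; have nX : nbhs X [set Y | Y - X \in lat (unif ^+ 0)].
  by apply/nbhs_lat; exists 0%N => d d0 /=; rewrite addrC addKr.
have [Y [/= Y0 YX]] := clX _ nX.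
have Ys : Y \in lat (unif ^- s) by apply: contraNT Y0 => /fs->.
rewrite -(subKr Y X); apply: rpredB => //; exact: lat_unifXV YX.
Qed.

End SchwartzFunctions.
End Compactness.

(** * Fourier inversion *)

Section AdditiveCharacters.
Variables (R : realType) (F : nonArchLocalFieldType R).
Local Notation C := R[i].
Local Notation unif := (unif F).

(** The multiplicative group of C has no small subgroups: 1 - w^2 = (1 + w)(1 - w) with |1 + w| >=
    3/2 near 1, so repeated squaring would push z away from 1 geometrically. *)
Lemma unipotent_near1 (z : C) : (forall j, `|1 - z ^+ (2 ^ j)| < 2^-1) -> z = 1.
Proof.
move=> zj; apply/eqP; rewrite -subr_eq0 -oppr_eq0 opprB; apply: contraT => z1.
have grow j : (3 / 2) ^+ j * `|1 - z| <= `|1 - z ^+ (2 ^ j)|.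
  elim: j => [|j IHj]; first by rewrite mul1r.
  rewrite exprS -mulrA expnS mulnC exprM; set w := z ^+ (2 ^ j) in IHj *.
  have -> : 1 - w ^+ 2 = (1 + w) * (1 - w).
    by rewrite mulrC -subr_sqr expr1n.
  rewrite normrM ler_pM ?mulr_ge0 ?exprn_ge0 ?divr_ge0//.
  have -> : 1 + w = 2 - (1 - w) by rewrite opprB addrCA -natr1 addrK addrC.
  rewrite (le_trans _ (lerB_dist _ _))// ger0_norm// lerBrDr.
  apply: (@le_trans _ _ (3 / 2 + 2^-1)); first by rewrite lerD2l ltW// /w.
  by rewrite -[X in _ + X]mul1r -mulrDl natr1 (natrM _ 2 2) mulfK// pnatr_eq0.
have d0 : 0 < `|1 - z| by rewrite normr_gt0.
have dR : (complex.Re `|1 - z|)%:C = `|1 - z| by rewrite RRe_real// ger0_real.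
set d := complex.Re `|1 - z| in dR.
have dp : 0 < d by rewrite -ltcR dR.
have hb j : (3 / 2) ^+ j * d < 2^-1.
  have e : ((3 / 2) ^+ j * d)%:C = (3 / 2) ^+ j * d%:C.
    by rewrite rmorphM rmorphXn fmorph_div !rmorph_nat.
  rewrite -ltcR e dR fmorphV rmorph_nat.
  exact: le_lt_trans (grow j) (zj j).
have c : (fun n => (2 / 3) ^+ n) @ \oo --> (0 : R).
  apply: cvg_expr; rewrite ger0_norm ?divr_ge0// ltr_pdivrMr ?ltr0n// mul1r ltr_nat//.
have d2 : 0 < 2 * d by rewrite mulr_gt0.
move/cvgrPdist_lt : c => /(_ _ d2)[n _ /(_ n (leqnn n))].
rewrite sub0r normrN ger0_norm ?exprn_ge0 ?divr_ge0//.
have -> : (2 / 3) ^+ n = ((3 / 2) ^+ n)^-1 :> R by rewrite -exprVn invf_div.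
rewrite invf_plt ?posrE ?exprn_gt0 ?divr_gt0// => h.
have := hb n; rewrite ltNge => /negP[].
by rewrite -ler_pdivrMr// -invfM ltW.
Qed.

(** The conductor is recorded as an element [delta], not an exponent: for the trace pairing, the
    dual of [lat t] is then [lat (delta / t)], as [char_trace] shows. *)
Definition char_conductor (psi : F -> C) (delta : F) :=
  [/\ forall x y, psi (x + y) = psi x * psi y, forall x, psi x != 0, delta != 0 &
      forall y, (forall x, absF x <= 1 -> psi (x * y) = 1) <-> absF y <= absF delta].

Lemma exists_conductor (psi : F -> C) : nontrivial_additive_char psi ->
  exists delta, char_conductor psi delta.
Proof.
move=> [psiD psi0 psic [x0 x01]].
have psi_0 : psi 0 = 1 by apply: (mulfI (psi0 0)); rewrite -psiD addr0 mulr1.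
have psiMn x n : psi (x *+ n) = psi x ^+ n.
  by elim: n => [|n IHn]; rewrite ?mulr0n ?psi_0// mulrS psiD IHn exprS.
have [n nP] : exists n, forall x, absF x <= absF (unif ^+ n) -> psi x = 1.
  have c0 : (psi : F -> C^o) @ (0 : F) --> (psi 0 : C^o) by exact: psic.
  have h2 : (0 : C) < 2^-1 by rewrite invr_gt0.
  move/cvgrPdist_lt : c0 => /(_ _ h2) /nbhs_absF_le[n nP]; exists n => x xn.
  apply: unipotent_near1 => j; rewrite -psiMn -[X in X - _]psi_0; apply: nP; rewrite subr0.
  elim: (2 ^ j)%N => [|k IHk]; first by rewrite mulr0n absF0 absF_ge0.
  by rewrite mulrS absFD_le.
(* P j states that psi is trivial on the ball of radius |unif^n / unif^j|. It holds for j = 0 and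
   eventually fails because psi is nontrivial; the index just before the first failure yields
   [delta]. *)
pose P j := forall x, absF x <= 1 -> psi (x * (unif ^+ n / unif ^+ j)) = 1.
have P0 : P 0%N.
  move=> x x1; apply: nP; rewrite divr1 absFM -[leRHS]mul1r.
  by rewrite ler_pM ?absF_ge0.
have ex : exists j, ~~ `[< P j >].
  have [j xj] := exists_unifV F (absF (x0 / unif ^+ n)); exists j.
  apply/asboolPn => Pj; move: x01; rewrite -(Pj (x0 / (unif ^+ n / unif ^+ j))).
    by rewrite divfK ?eqxx// mulf_neq0 ?invr_neq0 ?unifX_neq0.
  move: xj; rewrite !absFM !absFV !absFM !absFV invfM invrK.
  rewrite -[X in _ <= X]mul1r -ler_pdivrMr ?invrK ?mulrA//.
  by rewrite invr_gt0 absF_gt0 unifX_neq0.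
have [j jP jmin] := ex_minnP ex.
case: j jP jmin => [|j] jP jmin; first by case/asboolPn: jP.
have Pj : P j by apply/asboolP; apply: contraT => /jmin; rewrite ltnn.
have d0 : unif ^+ n / unif ^+ j != 0 by rewrite mulf_neq0 ?invr_neq0 ?unifX_neq0.
exists (unif ^+ n / unif ^+ j); split=> // y; split=> [yP|yd x x1]; last first.
  have -> : x * y = (x * (y / (unif ^+ n / unif ^+ j))) * (unif ^+ n / unif ^+ j).
    by rewrite -mulrA divfK.
  apply: Pj; rewrite absFM -[leRHS]mul1r ler_pM ?absF_ge0// absFM absFV.
  by rewrite ler_pdivrMr ?absF_gt0// mul1r.
rewrite leNgt; apply/negP => dy; case/asboolPn: jP => x x1.
have y0 : y != 0 by rewrite -absF_gt0 (le_lt_trans (absF_ge0 _) dy).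
have -> : x * (unif ^+ n / unif ^+ j.+1) = (x * (unif ^+ n / unif ^+ j.+1 / y)) * y.
  by rewrite -mulrA divfK.
apply: yP; rewrite absFM -[leRHS]mul1r ler_pM ?absF_ge0// absFM absFV.
rewrite ler_pdivrMr ?absF_gt0// mul1r.
move: dy; rewrite absF_lt_unif// => dy.
rewrite -(ler_pM2r (absF_unif_gt0 F)) -!absFM (le_trans _ dy)//.
by rewrite exprSr invfM mulrA divfK ?unif_neq0.
Qed.

Lemma char_conductorN psi delta : char_conductor psi delta ->
  char_conductor (fun x => psi (- x)) delta.
Proof.
move=> [psiD psi0 d0 dP]; split=> // [x y|y]; first by rewrite opprD psiD.
rewrite -dP; split=> h x x1.
  by have := h (- x); rewrite absFN mulNr opprK; exact.
by rewrite -mulNr h// absFN.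
Qed.

Section Fourier.
Variables (psi : F -> C) (delta : F).
Hypothesis psiP : char_conductor psi delta.

Lemma charD x y : psi (x + y) = psi x * psi y. Proof. by case: psiP. Qed.
Lemma char_neq0 x : psi x != 0. Proof. by case: psiP. Qed.
Lemma conductor_neq0 : delta != 0. Proof. by case: psiP. Qed.
Lemma char0 : psi 0 = 1.
Proof. by apply: (mulfI (char_neq0 0)); rewrite -charD addr0 mulr1. Qed.

Lemma charN x : psi (- x) = (psi x)^-1.
Proof. by apply: (mulfI (char_neq0 x)); rewrite -charD subrr char0 divff// char_neq0. Qed.

Lemma char_sum (I : Type) (r : seq I) (P : pred I) (f : I -> F) :
  psi (\sum_(i <- r | P i) f i) = \prod_(i <- r | P i) psi (f i).
Proof. exact: (big_morph _ charD char0). Qed.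

(** Testing against multiples of elementary matrices reduces the claim, entry by entry, to the
    definition of the conductor. *)
Lemma char_trace a b (t : F) (Y : 'M[F]_(b, a)) : t != 0 ->
  (forall X : 'M[F]_(a, b), X \in lat t -> psi (\tr (X *m Y)) = 1) <->
  Y \in lat (delta / t).
Proof.
case: psiP => _ _ _ dP t0; split=> [h|Yt X Xt].
  apply/latP => i j; rewrite absFM absFV ler_pdivlMr ?absF_gt0// -absFM.
  apply/dP => x x1; have := h ((x * t) *: delta_mx j i).
  rewrite -scalemxAl mxtraceZ.
  have -> : \tr (delta_mx j i *m Y) = Y i j.
    rewrite /mxtrace (bigD1 j)//= big1 ?addr0 => [|k kj].
      rewrite mxE (bigD1 i)//= mxE !eqxx mul1r big1 ?addr0// => l li.
      by rewrite mxE (negPf li) andbF mul0r.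
    by rewrite mxE big1// => l _; rewrite mxE (negPf kj) mul0r.
  rewrite -mulrA [t * _]mulrC; apply; apply/latP => k l.
  rewrite !mxE absFM absFM -[leRHS]mulr1; case: (_ && _); rewrite ?absF1 ?absF0 ?mulr0 ?absF_ge0//.
    by rewrite mulr1 mulr1 ler_piMl ?absF_ge0.
  by rewrite mulr1 absF_ge0.
have := (dP (\tr (X *m Y))).2 _ 1; rewrite mul1r absF1; apply=> //.
apply: absF_sum_le => [|i _]; first exact: absF_ge0.
have /latP := lat_mulmx Xt Yt; rewrite mulrC divfK//; exact.
Qed.

Lemma char1 a b (t : F) (X : 'M[F]_(a, b)) (Y : 'M[F]_(b, a)) : t != 0 ->
  Y \in lat (delta / t) -> X \in lat t -> psi (\tr (X *m Y)) = 1.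
Proof. by move=> t0 Yt; exact: (char_trace Y t0).2. Qed.

Definition fourier (W : lmodType C) a b (f : 'M[F]_(a, b) -> W) (Y : 'M[F]_(b, a)) : W :=
  haar (fun X => psi (\tr (X *m Y)) *: f X).

Lemma schw_char (W : lmodType C) a b (f : 'M[F]_(a, b) -> W) (Y : 'M[F]_(b, a)) :
  schw f -> schw (fun X => psi (\tr (X *m Y)) *: f X).
Proof.
move=> [s [r [fs fr]]]; have [s' Ys'] := lat_bounded Y.
have d0 : 0 < absF delta by rewrite absF_gt0 conductor_neq0.
have [r' r'd] := unifX_small F d0.
exists s, (maxn r (r' + s')); split=> [X Xs|X d dr]; first by rewrite fs// scaler0.
rewrite fr; last by apply: lat_unifX dr; rewrite leq_maxl.
have dr' : d \in lat (unif ^+ (r' + s')) by apply: lat_unifX dr; rewrite leq_maxr.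
rewrite mulmxDl linearD/= charD (char1 _ _ dr') ?mulr1 ?unifX_neq0//.
apply: lat_le Ys'; rewrite absFM exprD invfM absFM mulrA.
  rewrite ler_peMl ?absF_ge0// absFV ler_pdivlMr ?mul1r ?absF_gt0 ?unifX_neq0//.
by rewrite absFX ltW.
Qed.

Lemma fourierD (W : lmodType C) a b (f g : 'M[F]_(a, b) -> W) Y : schw f -> schw g ->
  fourier (fun X => f X + g X) Y = fourier f Y + fourier g Y.
Proof.
move=> fS gS; rewrite /fourier -haarD; try exact: schw_char.
by congr haar; apply/funext => X; rewrite scalerDr.
Qed.

Lemma fourierZ (W : lmodType C) a b c (f : 'M[F]_(a, b) -> W) Y : schw f ->
  fourier (fun X => c *: f X) Y = c *: fourier f Y.
Proof.
move=> fS; rewrite /fourier -haarZ; last exact: schw_char.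
by congr haar; apply/funext => X; rewrite !scalerA mulrC.
Qed.

Lemma fourier_trans (W : lmodType C) a b (f : 'M[F]_(a, b) -> W) A Y : schw f ->
  fourier (fun X => f (X + A)) Y = psi (- \tr (A *m Y)) *: fourier f Y.
Proof.
move=> fS; rewrite /fourier.
rewrite -(haar_trans A (schw_char Y fS)) -haarZ; last first.
  exact: (schw_trans A (schw_char Y fS)).
congr haar; apply/funext => X; rewrite scalerA mulmxDl linearD/= charD charN.
by rewrite mulrCA mulVf ?char_neq0// mulr1.
Qed.

(** Outside the dual lattice some period d of f has psi(tr(d Y)) <> 1. Translating by d multiplies
    the transform at Y by a number other than 1 while leaving f unchanged, so the value is 0. *)
Lemma fourier_support (W : lmodType C) a b s r (f : 'M[F]_(a, b) -> W) Y :
  schw_at s r f -> Y \notin lat (delta / unif ^+ r) -> fourier f Y = 0.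
Proof.
move=> [fs fr] YN.
have /existsNP[d /not_implyP[dr /eqP d1]] :
    ~ forall d : 'M[F]_(a, b), d \in lat (unif ^+ r) -> psi (\tr (d *m Y)) = 1.
  by move=> /(char_trace Y (unifX_neq0 F r)) h; rewrite h in YN.
have := @fourier_trans W a b f d Y (ex_intro _ s (ex_intro _ r (conj fs fr))).
have -> : (fun X => f (X + d)) = f by apply/funext => X; rewrite fr.
rewrite charN => /eqP; rewrite -subr_eq0 -{1}[fourier f Y]scale1r -scalerBl scaler_eq0.
by rewrite subr_eq0 eq_sym invr_eq1 (negPf d1) => /eqP.
Qed.

Lemma fourier_inv (W : lmodType C) a b s r (f : 'M[F]_(a, b) -> W) :
  schw_at s r f -> lat_inv (delta * unif ^+ s) (fourier f).
Proof.
move=> [fs fr] Y d ds; rewrite /fourier; congr haar; apply/funext => X.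
have [Xs|Xs] := boolP (X \in lat (unif ^- s)); last by rewrite fs// !scaler0.
have v0 : unif ^- s != 0 by rewrite invr_neq0 ?unifX_neq0.
have ds' : d \in lat (delta / unif ^- s) by rewrite invrK.
by rewrite mulmxDr linearD/= charD (char1 v0 ds' Xs) mulr1.
Qed.

(** The new bounds depend on (s, r) alone. This uniformity is needed for partial transforms, where f
    varies with a parameter. *)
Lemma schw_fourier (W : lmodType C) a b s r : exists s' r', 
  forall f : 'M[F]_(a, b) -> W, schw_at s r f -> schw_at s' r' (fourier f).
Proof.
have [s' s'P] := exists_unifV F (absF (delta / unif ^+ r)).
have d0 : 0 < absF (delta * unif ^+ s) by rewrite absF_gt0 mulf_neq0 ?conductor_neq0 ?unifX_neq0.
have [r' r'P] := unifX_small F d0; rewrite -absFX in r'P.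
exists s', r' => f fsr; split=> [Y Ys|Y d dr].
  by apply: (fourier_support fsr); apply: contra Ys; exact: lat_le.
by apply: (fourier_inv fsr); apply: lat_le dr; exact: ltW.
Qed.

(** Dual lattices have radius involving [delta], which need not be a power of [unif], so the volume
    of balls is needed for every nonzero t. *)
Lemma haar_ind_gen a b (t : F) : t != 0 -> schw (ind (0 : 'M[F]_(a, b)) t) /\
  haar (ind (0 : 'M[F]_(a, b)) t) = vol (a * b) t.
Proof.
move=> t0; have [m [n tmn]] := absF_discrete t0.
have tS : schw (ind (0 : 'M[F]_(a, b)) t).
  have [s sP] := exists_unifV F (absF t).
  have t0' : 0 < absF t by rewrite absF_gt0.
  have [r rP] := unifX_small F t0'; rewrite -absFX in rP.
  exists s, r; split=> [X Xs|X d dr]; rewrite /ind subr0.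
    case: (boolP (_ \in _)) => // Xt; case/negP: Xs; exact: lat_le Xt.
  by rewrite subr0 rpredDr//; apply: lat_le dr; exact: ltW.
split=> //; have := haar_scale n tS.
have -> : (fun X => ind (0 : 'M[F]_(a, b)) t (unif ^- n *: X)) = ind 0 (unif ^+ m).
  apply/funext => X; rewrite /ind !subr0.
  rewrite -[in RHS](@latZ _ _ _ _ (unif ^- n)) ?invr_neq0 ?unifX_neq0//.
  congr (nat_of_bool _)%:R; apply/idP/idP; apply: lat_le; rewrite tmn mulrC//.
rewrite haar_ind => h; apply: (scalerI (vol_neq0 (a * b) (unifX_neq0 F n))).
rewrite -h; have e : vol (a * b) (unif ^+ m) = vol (a * b) (unif ^+ n) * vol (a * b) t.
  by rewrite -volM /vol absFM tmn -absFM mulrCA mulfV ?mulr1// unifX_neq0.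
exact: e.
Qed.

Lemma fourier_ind0 a b (t : F) (Y : 'M[F]_(b, a)) : t != 0 ->
  fourier (ind (0 : 'M[F]_(a, b)) t) Y = vol (a * b) t * (Y \in lat (delta / t))%:R.
Proof.
move=> t0; have [tS th] := haar_ind_gen a b t0.
have [Yt|YN] := boolP (Y \in lat (delta / t)).
  rewrite mulr1 -th /fourier; congr haar; apply/funext => X; rewrite /ind subr0.
  have [Xt|_] := boolP (X \in lat t); last by rewrite scaler0.
  by rewrite ((char_trace Y t0).2 Yt X Xt) scale1r.
rewrite mulr0.
have /existsNP[d /not_implyP[dt /eqP d1]] :
    ~ forall d : 'M[F]_(a, b), d \in lat t -> psi (\tr (d *m Y)) = 1.
  by move=> /(char_trace Y t0) h; rewrite h in YN.
have := fourier_trans d Y tS.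
have -> : (fun X => ind 0 t (X + d)) = ind 0 t.
  by apply/funext => X; rewrite /ind !subr0 rpredDr.
rewrite charN => /eqP; rewrite -subr_eq0 -{1}[fourier _ Y]scale1r -scalerBl scaler_eq0.
by rewrite subr_eq0 eq_sym invr_eq1 (negPf d1) => /eqP.
Qed.

Lemma fourier_sum (I : Type) (l : seq I) (W : lmodType C) a b (f : I -> 'M[F]_(a, b) -> W) Y :
  (forall i, schw (f i)) ->
  fourier (fun X => \sum_(i <- l) f i X) Y = \sum_(i <- l) fourier (f i) Y.
Proof.
move=> fS; rewrite /fourier -haar_sum => [|i]; last exact: schw_char.
by congr haar; apply/funext => X; rewrite scaler_sumr.
Qed.

Lemma fourier_scalar (W : lmodType C) a b (f : 'M[F]_(a, b) -> C^o) (w : W) Y : schw f ->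
  fourier (fun X => f X *: w) Y = fourier f Y *: w.
Proof.
move=> fS; rewrite /fourier -haar_scalar; last exact: schw_char.
by congr haar; apply/funext => X; rewrite scalerA.
Qed.

End Fourier.

(** By linearity it suffices to treat the indicator of a ball: its transform is a character times
    the indicator of the dual ball, and transforming back gives the original ball. The volumes of a
    ball and its dual multiply to the volume of [lat delta], whence the constant. *)
Lemma fourier_inversion psi delta (W : lmodType C) a b (f : 'M[F]_(a, b) -> W) X :
  char_conductor psi delta -> schw f ->
  fourier (fun x => psi (- x)) (fourier psi f) X = vol (a * b) delta *: f X.
Proof.
move=> psiP [s [r fsr]]; have psiNP := char_conductorN psiP.
have u0 := unifX_neq0 F r; have d0 := conductor_neq0 psiP.
have t0 : delta / unif ^+ r != 0 by rewrite mulf_neq0 ?invr_neq0.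
have fS : schw f by exists s, r.
have [iS ih] := haar_ind_gen b a t0.
have fi (x : 'M[F]_(a, b)) (Y : 'M[F]_(b, a)) : fourier psi (ind x (unif ^+ r)) Y =
    psi (\tr (x *m Y)) * (vol (a * b) (unif ^+ r) * ind 0 (delta / unif ^+ r) Y).
  have -> : ind x (unif ^+ r) = (fun X => ind 0 (unif ^+ r) (X + - x)).
    by apply/funext => Z; rewrite /ind subr0.
  rewrite (fourier_trans psiP); last exact: ind_schw.
  by rewrite mulNmx linearN/= opprK (fourier_ind0 psiP)// /ind subr0.
rewrite [in RHS](schw_decomp fsr) scaler_sumr.
have -> : fourier psi f = (fun Y => \sum_(x <- grid F a b s r)
    (psi (\tr (x *m Y)) * (vol (a * b) (unif ^+ r) * ind 0 (delta / unif ^+ r) Y)) *: f x).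
  apply/funext => Y.
  transitivity (fourier psi (fun X => \sum_(x <- grid F a b s r) ind x (unif ^+ r) X *: f x) Y).
    by congr (fourier psi _ Y); apply/funext => Z; exact: schw_decomp.
  rewrite (fourier_sum psiP) => [|x]; last by apply: schw_scalar; exact: ind_schw.
  apply: eq_bigr => x _; rewrite (fourier_scalar psiP); last exact: ind_schw.
  by rewrite fi.
have cS (x : 'M[F]_(a, b)) : schw (fun Y : 'M[F]_(b, a) =>
    psi (\tr (x *m Y)) * (vol (a * b) (unif ^+ r) * ind 0 (delta / unif ^+ r) Y) : C^o).
  under eq_fun do rewrite mxtrace_mulC.
  apply: (schw_char psiP (f := fun Y => vol (a * b) (unif ^+ r) * ind 0 (delta / unif ^+ r) Y)).
  exact: (schwZ (vol (a * b) (unif ^+ r)) iS).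
rewrite (fourier_sum psiNP) => [|x]; last exact: schw_scalar.
apply: eq_bigr => x _; rewrite (fourier_scalar psiNP)// scalerA; congr (_ *: _).
transitivity (fourier psi (fun Y => vol (a * b) (unif ^+ r) *: ind 0 (delta / unif ^+ r) Y) (x - X)).
  rewrite /fourier; congr haar; apply/funext => Y.
  rewrite mulmxBr linearB/= (charD psiP) [\tr (x *m Y)]mxtrace_mulC.
  by rewrite [psi (\tr (Y *m x)) * psi _]mulrC -scalerA.
rewrite (fourierZ psiP)// (fourier_ind0 psiP)//.
have e : vol (a * b) (unif ^+ r) * (vol (b * a) (delta / unif ^+ r) *
    (x - X \in lat (delta / (delta / unif ^+ r)))%:R) =
    vol (a * b) delta * (X - x \in lat (unif ^+ r))%:R.
  rewrite mulrA [(b * a)%N]mulnC -volM mulrCA mulfV// mulr1.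
  by rewrite invf_div mulrCA mulfV// mulr1 -rpredN opprB.
exact: e.
Qed.

End AdditiveCharacters.

(** * Integration over the fiber Z Y = E *)

Section TwoVariables.
Variables (R : realType) (F : nonArchLocalFieldType R) (a b a' b' : nat).
Local Notation C := R[i].
Local Notation unif := (unif F).
Local Notation M := 'M[F]_(a, b).
Local Notation M' := 'M[F]_(a', b').

Definition schw2_at (W : nmodType) (s r : nat) (f : M -> M' -> W) :=
  (forall Y Z, (Y \notin lat (unif ^- s)) || (Z \notin lat (unif ^- s)) -> f Y Z = 0) /\
  (forall Y Z d e, d \in lat (unif ^+ r) -> e \in lat (unif ^+ r) ->
     f (Y + d) (Z + e) = f Y Z).

Definition schw2 (W : nmodType) (f : M -> M' -> W) := exists s r, schw2_at s r f.

Definition haar2 (W : lmodType C) (f : M -> M' -> W) : W := haar (fun Y => haar (f Y)).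

Lemma schw2_at_le (W : nmodType) s r s' r' (f : M -> M' -> W) :
  (s <= s')%N -> (r <= r')%N -> schw2_at s r f -> schw2_at s' r' f.
Proof.
move=> ss' rr' [fs fr]; split=> [Y Z YZ|Y Z d e dr er].
  apply: fs; apply: contraTT YZ; rewrite !negb_or !negbK => /andP[Ys Zs].
  by rewrite (lat_unifV ss' Ys) (lat_unifV ss' Zs).
by apply: fr; [apply: lat_unifX dr|apply: lat_unifX er].
Qed.

Lemma schw2_at_max (W W' : nmodType) (f : M -> M' -> W) (g : M -> M' -> W') :
  schw2 f -> schw2 g -> exists s r, schw2_at s r f /\ schw2_at s r g.
Proof.
move=> [s [r fsr]] [s' [r' gsr]]; exists (maxn s s'), (maxn r r').
by split; [apply: schw2_at_le fsr|apply: schw2_at_le gsr]; rewrite ?leq_maxl ?leq_maxr.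
Qed.

Lemma schw2_slice (W : nmodType) s r (f : M -> M' -> W) Y :
  schw2_at s r f -> schw_at s r (f Y).
Proof.
move=> [fs fr]; split=> [Z Zs|Z d dr]; first by rewrite fs// Zs orbT.
by rewrite -[Y in LHS]addr0 fr ?rpred0.
Qed.

Lemma schw2_haar (W : lmodType C) s r (f : M -> M' -> W) :
  schw2_at s r f -> schw_at s r (fun Y => haar (f Y)).
Proof.
move=> [fs fr]; split=> [Y Ys|Y d dr].
  have -> : f Y = fun=> 0 by apply/funext => Z; rewrite fs// Ys.
  exact: haar0.
by congr haar; apply/funext => Z; rewrite -[Z in LHS]addr0 fr ?rpred0.
Qed.

Lemma schw2D (W : nmodType) (f g : M -> M' -> W) : schw2 f -> schw2 g ->
  schw2 (fun Y Z => f Y Z + g Y Z).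
Proof.
move=> fS gS; have [s [r [[fs fr] [gs gr]]]] := schw2_at_max fS gS.
exists s, r; split=> [Y Z YZ|Y Z d e dr er]; first by rewrite fs// gs// addr0.
by rewrite fr// gr.
Qed.

Lemma schw2_comp (W W' : nmodType) (T : W -> W') (f : M -> M' -> W) :
  T 0 = 0 -> schw2 f -> schw2 (fun Y Z => T (f Y Z)).
Proof.
move=> T0 [s [r [fs fr]]]; exists s, r.
by split=> [Y Z YZ|Y Z d e dr er]; [rewrite fs|rewrite fr].
Qed.

Lemma schw2Z (W : lmodType C) c (f : M -> M' -> W) : schw2 f ->
  schw2 (fun Y Z => c *: f Y Z).
Proof. by apply: schw2_comp; rewrite scaler0. Qed.

Lemma schw2_0 (W : nmodType) : schw2 (fun _ _ => 0 : W).
Proof. by exists 0%N, 0%N. Qed.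

Lemma schw2_sum (I : Type) (l : seq I) (W : nmodType) (f : I -> M -> M' -> W) :
  (forall i, schw2 (f i)) -> schw2 (fun Y Z => \sum_(i <- l) f i Y Z).
Proof.
move=> fS; elim: l => [|i l IHl].
  have -> : (fun Y Z => \sum_(i <- [::]) f i Y Z) = (fun _ _ => 0).
    by apply/funext => Y; apply/funext => Z; rewrite big_nil.
  exact: schw2_0.
have -> : (fun Y Z => \sum_(j <- i :: l) f j Y Z) =
    (fun Y Z => f i Y Z + \sum_(j <- l) f j Y Z).
  by apply/funext => Y; apply/funext => Z; rewrite big_cons.
exact: schw2D.
Qed.

Lemma haar2D (W : lmodType C) (f g : M -> M' -> W) : schw2 f -> schw2 g ->
  haar2 (fun Y Z => f Y Z + g Y Z) = haar2 f + haar2 g.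
Proof.
move=> fS gS; have [s [r [fsr gsr]]] := schw2_at_max fS gS.
rewrite /haar2 -haarD; try by exists s, r; apply: schw2_haar.
congr haar; apply/funext => Y; rewrite haarD//.
  by exists s, r; exact: schw2_slice.
by exists s, r; exact: schw2_slice.
Qed.

Lemma haar2_linear (W W' : lmodType C) (T : {linear W -> W'}) (f : M -> M' -> W) :
  schw2 f -> haar2 (fun Y Z => T (f Y Z)) = T (haar2 f).
Proof.
move=> [s [r fsr]]; rewrite /haar2 -haar_linear; last by exists s, r; apply: schw2_haar.
congr haar; apply/funext => Y /=; rewrite -haar_linear//.
by exists s, r; exact: schw2_slice.
Qed.

Lemma haar2Z (W : lmodType C) c (f : M -> M' -> W) : schw2 f ->
  haar2 (fun Y Z => c *: f Y Z) = c *: haar2 f.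
Proof. exact: (haar2_linear ( *:%R c)). Qed.

Lemma haar2_0 (W : lmodType C) : haar2 (fun _ _ => 0 : W) = 0.
Proof. by rewrite /haar2 haar0 haar0. Qed.

Lemma haar2_sum (I : Type) (l : seq I) (W : lmodType C) (f : I -> M -> M' -> W) :
  (forall i, schw2 (f i)) ->
  haar2 (fun Y Z => \sum_(i <- l) f i Y Z) = \sum_(i <- l) haar2 (f i).
Proof.
move=> fS; elim: l => [|i l IHl].
  have -> : (fun Y Z => \sum_(i <- [::]) f i Y Z) = (fun _ _ => 0).
    by apply/funext => Y; apply/funext => Z; rewrite big_nil.
  by rewrite haar2_0 big_nil.
have -> : (fun Y Z => \sum_(j <- i :: l) f j Y Z) =
    (fun Y Z => f i Y Z + \sum_(j <- l) f j Y Z).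
  by apply/funext => Y; apply/funext => Z; rewrite big_cons.
by rewrite haar2D ?IHl ?big_cons//; exact: schw2_sum.
Qed.

Section Substitution.
Variables (A : 'M[F]_a) (B : 'M[F]_b) (A' : 'M[F]_a') (B' : 'M[F]_b').
Hypotheses (AU : A \in unitmx) (BU : B \in unitmx).
Hypotheses (AU' : A' \in unitmx) (BU' : B' \in unitmx).

Lemma schw2_mulmx (W : nmodType) (f : M -> M' -> W) : schw2 f ->
  schw2 (fun Y Z => f (A *m Y *m B) (A' *m Z *m B')).
Proof.
move=> [s [r [fs fr]]].
have [s1 As] := lat_bounded A; have [s2 Bs] := lat_bounded B.
have [s3 As'] := lat_bounded A'; have [s4 Bs'] := lat_bounded B'.
have [t1 iAs] := lat_bounded (invmx A); have [t2 iBs] := lat_bounded (invmx B).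
have [t3 iAs'] := lat_bounded (invmx A'); have [t4 iBs'] := lat_bounded (invmx B').
pose t := maxn (maxn t1 t2) (maxn t3 t4); pose u := maxn (maxn s1 s2) (maxn s3 s4).
exists (t + s + t)%N, (u + r + u)%N.
have tE : unif ^- (t + s + t) = unif ^- t * unif ^- s * unif ^- t.
  by rewrite !exprD !invfM.
have uE : unif ^+ r = unif ^- u * unif ^+ (u + r + u) * unif ^- u.
  by rewrite exprD mulrA mulfK ?unifX_neq0// exprD mulKf ?unifX_neq0.
have bnd c d (X : 'M[F]_(c, d)) x y : (x <= y)%N -> X \in lat (unif ^- x) -> X \in lat (unif ^- y).
  exact: lat_unifV.
have hA : A \in lat (unif ^- u) by apply: bnd As; rewrite !leq_max leqnn.
have hB : B \in lat (unif ^- u) by apply: bnd Bs; rewrite !leq_max leqnn ?orbT.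
have hA' : A' \in lat (unif ^- u) by apply: bnd As'; rewrite !leq_max leqnn ?orbT.
have hB' : B' \in lat (unif ^- u) by apply: bnd Bs'; rewrite !leq_max leqnn ?orbT.
have iA : invmx A \in lat (unif ^- t) by apply: bnd iAs; rewrite !leq_max leqnn.
have iB : invmx B \in lat (unif ^- t) by apply: bnd iBs; rewrite !leq_max leqnn ?orbT.
have iA' : invmx A' \in lat (unif ^- t) by apply: bnd iAs'; rewrite !leq_max leqnn ?orbT.
have iB' : invmx B' \in lat (unif ^- t) by apply: bnd iBs'; rewrite !leq_max leqnn ?orbT.
split=> [Y Z YZ|Y Z d e dr er].
  apply: fs; apply: contraTT YZ; rewrite !negb_or !negbK => /andP[Ys Zs].
  have -> : Y = invmx A *m (A *m Y *m B) *m invmx B by rewrite mulmxA mulmxK// mulKmx.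
  have -> : Z = invmx A' *m (A' *m Z *m B') *m invmx B' by rewrite mulmxA mulmxK// mulKmx.
  by rewrite tE (lat_mulmx (lat_mulmx iA Ys) iB) (lat_mulmx (lat_mulmx iA' Zs) iB').
by rewrite !mulmxDr !mulmxDl fr ?uE ?(lat_mulmx (lat_mulmx hA dr) hB)
  ?(lat_mulmx (lat_mulmx hA' er) hB').
Qed.

Lemma haar2_mulmx (W : lmodType C) (f : M -> M' -> W) : schw2 f ->
  haar2 (fun Y Z => f (A *m Y *m B) (A' *m Z *m B')) =
  (vol b (\det A) * vol a (\det B) * (vol b' (\det A') * vol a' (\det B')))^-1 *: haar2 f.
Proof.
move=> [s [r fsr]]; rewrite /haar2.
have fS Y : schw (f Y) by exists s, r; exact: schw2_slice.
have -> : (fun Y => haar (fun Z => f (A *m Y *m B) (A' *m Z *m B'))) =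
    (fun Y => (vol b' (\det A') * vol a' (\det B'))^-1 *: haar (f (A *m Y *m B))).
  apply/funext => Y.
  rewrite (haar_mull (f := fun Z => f (A *m Y *m B) (Z *m B')))//; last exact: schw_mulr.
  by rewrite haar_mulr// scalerA invfM.
have hS : schw (fun Y => haar (f Y)) by exists s, r; exact: schw2_haar.
rewrite haarZ; last first.
  apply: (schw_mulmx (f := fun Y => haar (f (Y *m B)))) => //.
  exact: (schw_mulr (f := fun Y => haar (f Y))).
rewrite (haar_mull (f := fun Y => haar (f (Y *m B))))//; last first.
  exact: (schw_mulr (f := fun Y => haar (f Y))).
rewrite (haar_mulr (f := fun Y => haar (f Y)))// !scalerA; congr (_ *: _).
by rewrite !invfM [RHS]mulrC mulrA.
Qed.

End Substitution.

Definition ind2 (A : M) (A' : M') (t : F) : M -> M' -> C^o :=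
  fun Y Z => ind A t Y *: ind A' t Z.

Lemma ind2E A A' t Y Z :
  ind2 A A' t Y Z = ((Y - A \in lat t) && (Z - A' \in lat t))%:R.
Proof.
rewrite /ind2 /ind; case: (_ \in _); last by rewrite scale0r.
by rewrite scale1r.
Qed.

Lemma ind2_schw_at A A' s r : A \in lat (unif ^- s) -> A' \in lat (unif ^- s) ->
  schw2_at s r (ind2 A A' (unif ^+ r)).
Proof.
move=> As As'; split=> [Y Z YZ|Y Z d e dr er]; rewrite !ind2E.
  case: (boolP (_ && _)) => // /andP[YA ZA]; case/orP: YZ => /negP[].
    by rewrite -(subrK A Y) rpredD//; exact: lat_unifXV YA.
  by rewrite -(subrK A' Z) rpredD//; exact: lat_unifXV ZA.
by rewrite ![_ + _ - _]addrAC (rpredDr _ dr) (rpredDr _ er).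
Qed.

Lemma ind2_schw A A' r : schw2 (ind2 A A' (unif ^+ r)).
Proof.
have [s As] := lat_bounded A; have [s' As'] := lat_bounded A'.
exists (maxn s s'), r; apply: ind2_schw_at.
  by apply: lat_unifV As; rewrite leq_maxl.
by apply: lat_unifV As'; rewrite leq_maxr.
Qed.

Lemma haar2_ind2 A A' r : haar2 (ind2 A A' (unif ^+ r)) =
  vol (a * b) (unif ^+ r) * vol (a' * b') (unif ^+ r).
Proof.
rewrite /haar2.
have -> : (fun Y => haar (ind2 A A' (unif ^+ r) Y)) =
    (fun Y => ind A (unif ^+ r) Y *: (vol (a' * b') (unif ^+ r) : C^o)).
  by apply/funext => Y; rewrite haarZ ?haar_ind//; exact: ind_schw.
by rewrite haar_scalar ?haar_ind//; exact: ind_schw.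
Qed.

Lemma schw2_decomp (W : lmodType C) s r (f : M -> M' -> W) : schw2_at s r f ->
  f = fun Y Z => \sum_(yz <- [seq (y, z) | y <- grid F a b s r, z <- grid F a' b' s r])
        ind2 yz.1 yz.2 (unif ^+ r) Y Z *: f yz.1 yz.2.
Proof.
move=> fsr; apply/funext => Y; apply/funext => Z; rewrite big_allpairs_dep/=.
have fYsr Z' : schw_at s r (f^~ Z').
  case: fsr => fs fr; split=> [Y' Ys|Y' d dr]; first by rewrite fs// Ys.
  by rewrite -[Z' in LHS]addr0 fr ?rpred0.
rewrite [LHS](schw_decomp (fYsr Z)); apply: eq_bigr => y _.
rewrite [in LHS](schw_decomp (schw2_slice y fsr)) scaler_sumr.
by apply: eq_bigr => z _; rewrite scalerA.
Qed.

End TwoVariables.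
Arguments ind2 {R F a b a' b'} A A' t Y Z.

(** * The measure on the fiber Z Y = E *)

Section FiberIntegral.
Variables (R : realType) (F : nonArchLocalFieldType R) (m p n : nat).
Local Notation C := R[i].
Local Notation unif := (unif F).
Local Notation M := 'M[F]_(m, p).
Local Notation M' := 'M[F]_(n, m).
Variable E : 'M[F]_(n, p).
Hypotheses (EE : E *m E^T = 1%:M) (E1 : E \in lat 1).

Section FiberIntegralValue.
Variable W : lmodType C.
Implicit Types (f : M -> M' -> W) (Psi : 'M[F]_(n, p) -> C^o).

Definition smear Psi f : M -> M' -> W := fun Y Z => Psi (Z *m Y - E) *: f Y Z.

Lemma smear_schw Psi f : schw Psi -> schw2 f -> schw2 (smear Psi f).
Proof.
move=> [s [r [Ps Pr]]] [s' [r' [fs fr]]].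
exists s', (maxn r' (s' + r)); split=> [Y Z YZ|Y Z d e dr er].
  by rewrite /smear fs// scaler0.
have dr' : d \in lat (unif ^+ r') by apply: lat_unifX dr; rewrite leq_maxl.
have er' : e \in lat (unif ^+ r') by apply: lat_unifX er; rewrite leq_maxl.
rewrite /smear fr//.
have [/andP[Ys Zs]|] := boolP ((Y \in lat (unif ^- s')) && (Z \in lat (unif ^- s'))); last first.
  by rewrite negb_and => /fs->; rewrite !scaler0.
congr (_ *: _).
have -> : (Z + e) *m (Y + d) - E = Z *m Y - E + (Z *m d + e *m Y + e *m d).
  by rewrite mulmxDr !mulmxDl [RHS]addrAC; congr (_ - _); rewrite !addrA; congr (_ + _); rewrite addrAC.
have rE : unif ^+ r = unif ^- s' * unif ^+ (s' + r) by rewrite unifVD.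
have dr2 : d \in lat (unif ^+ (s' + r)) by apply: lat_unifX dr; rewrite leq_maxr.
have er2 : e \in lat (unif ^+ (s' + r)) by apply: lat_unifX er; rewrite leq_maxr.
apply: Pr; apply: rpredD; first apply: rpredD.
- by rewrite rE (lat_mulmx Zs dr2).
- by rewrite rE mulrC (lat_mulmx er2 Ys).
- by rewrite rE (lat_mulmx _ dr2)//; exact: lat_unifXV er2.
Qed.

(* Right multiplication of [Y] by [1 + E^T x] moves the fiber over [E] to the
   one over [E + x], because [E E^T = 1]. *)
Lemma smear_trans s r u f x N : schw2_at s r f -> (s + r <= u)%N -> (0 < u)%N ->
  x \in lat (unif ^+ u) ->
  haar2 (smear (ind x (unif ^+ N)) f) = haar2 (smear (ind 0 (unif ^+ N)) f).
Proof.
move=> fsr sru u0 xu; have [fs fr] := fsr.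
have ETx : E^T *m x \in lat (unif ^+ u).
  by rewrite -[unif ^+ u]mul1r lat_mulmx ?lat_trmx.
pose A := 1%:M + E^T *m x.
have AO : A \in @GLO _ F p.
  by apply: (@GLO_near1 _ _ _ _ u.-1); rewrite /A addrC addKr prednK.
have AU := GLO_unit AO; have [_ /eqP dA] := andP AO.
have gS : schw2 (smear (ind x (unif ^+ N)) f).
  by apply: smear_schw; [exact: ind_schw|exists s, r].
have := haar2_mulmx (unitmx1 _ _) AU (unitmx1 _ _) (unitmx1 _ _) gS.
rewrite !det1 !vol1 /vol dA expr1n !mulr1 invr1 scale1r => <-; congr haar2.
apply/funext => Y; apply/funext => Z; rewrite mulmx1 !mul1mx /smear.
have -> : ind x (unif ^+ N) (Z *m (Y *m A) - E) = ind 0 (unif ^+ N) (Z *m Y - E).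
  rewrite /ind subr0; have -> : Z *m (Y *m A) - E - x = (Z *m Y - E) *m A.
    rewrite mulmxBl mulmxA -addrA -opprD; congr (_ - _).
    by rewrite /A mulmxDr mulmx1 mulmxA EE mul1mx.
  by rewrite GLO_latr.
congr (_ *: _).
have [Ys|Ys] := boolP (Y \in lat (unif ^- s)); last first.
  by rewrite fs ?fs ?GLO_latr ?Ys.
rewrite /A mulmxDr mulmx1 -[Z in LHS]addr0 fr ?rpred0//.
apply: (@lat_unifX _ _ _ _ _ r (u - s)); first by rewrite leq_subRL ?(leq_trans _ sru) ?leq_addr.
have -> : unif ^+ (u - s) = unif ^- s * unif ^+ u.
  by rewrite -[in RHS](subnKC (_ : s <= u)%N) ?unifVD// (leq_trans _ sru)// leq_addr.
exact: lat_mulmx.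
Qed.

Lemma smear_sum Psi f s N : schw_at s N Psi -> schw2 f ->
  haar2 (smear Psi f) = \sum_(x <- grid F n p s N) Psi x *: haar2 (smear (ind x (unif ^+ N)) f).
Proof.
move=> PsR fS.
have iS x : schw2 (smear (ind x (unif ^+ N)) f) by apply: smear_schw => //; exact: ind_schw.
have -> : smear Psi f = fun Y Z => \sum_(x <- grid F n p s N)
    (Psi x *: smear (ind x (unif ^+ N)) f Y Z).
  apply/funext => Y; apply/funext => Z; rewrite /smear [in LHS](schw_decomp PsR) scaler_suml.
  by apply: eq_bigr => x _; rewrite -[RHS]/(Psi x *: _) scalerA mulrC.
by rewrite haar2_sum => [|x]; [apply: eq_bigr => x _; rewrite haar2Z|exact: schw2Z].
Qed.

(** Decompose Psi into indicators of small balls. By [smear_trans] each contributes the same vector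
    whatever its center in [lat (unif ^+ u)], so the result depends on Psi only through its
    integral. *)
Lemma fiber_integral_exists s r u f : schw2_at s r f -> (s + r <= u)%N -> (0 < u)%N ->
  exists w, forall Psi, schw Psi -> (forall x, x \notin lat (unif ^+ u) -> Psi x = 0) ->
    haar2 (smear Psi f) = haar Psi *: w.
Proof.
move=> fsr sru u0; have fS : schw2 f by exists s, r.
pose J N := haar2 (smear (ind 0 (unif ^+ N)) f).
have main Psi s' N : schw_at s' N Psi -> (forall x, x \notin lat (unif ^+ u) -> Psi x = 0) ->
    haar2 (smear Psi f) = haar Psi *: ((vol (n * p) (unif ^+ N))^-1 *: J N).
  move=> PsR Pu; rewrite (smear_sum PsR fS) (haarE PsR) /haar_at scalerA.
  rewrite mulrAC divff ?mul1r ?vol_neq0 ?unifX_neq0// scaler_suml.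
  apply: eq_bigr => x _; have [xu|xu] := boolP (x \in lat (unif ^+ u)).
    by rewrite (smear_trans _ fsr sru).
  by rewrite (Pu _ xu) [LHS]scale0r [RHS]scale0r.
have iu N : (u <= N)%N -> schw_at 0 N (ind (0 : 'M[F]_(n, p)) (unif ^+ u)).
  move=> uR; apply: (schw_at_le (leqnn 0) uR).
  exact: (@ind_schw_at _ _ _ _ 0 0 u (rpred0 _)).
have iu0 x : x \notin lat (unif ^+ u) -> ind (0 : 'M[F]_(n, p)) (unif ^+ u) x = 0.
  by rewrite /ind subr0 => /negPf->.
exists ((vol (n * p) (unif ^+ u))^-1 *: J u) => Psi [s' [N PsR]] Pu.
have PsR' : schw_at s' (maxn u N) Psi by apply: schw_at_le PsR; rewrite ?leq_maxr.
rewrite (main _ _ _ PsR' Pu); congr (_ *: _).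
have := main _ _ _ (iu _ (leq_maxl u N)) iu0; rewrite haar_ind.
rewrite -/(J u) => ->; rewrite [RHS]scalerA mulVf ?scale1r//.
by rewrite vol_neq0 ?unifX_neq0.
Qed.

(* The density at 0 of the pushforward of f dY dZ under (Y, Z) |-> Z Y - E: Psi ranges
   over the Schwartz functions supported in a small lattice. *)
Definition fiber_integral f : W := xget 0 [set w | exists u, forall Psi, schw Psi ->
  (forall x, x \notin lat (unif ^+ u) -> Psi x = 0) -> haar2 (smear Psi f) = haar Psi *: w].

Lemma fiber_integral_uniq u f w : (forall Psi, schw Psi ->
    (forall x, x \notin lat (unif ^+ u) -> Psi x = 0) -> haar2 (smear Psi f) = haar Psi *: w) ->
  fiber_integral f = w.
Proof.
move=> uw; rewrite /fiber_integral; case: xgetP => [w' _ [u' uw']|]; last first.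
  by move=> /(_ w)/=; case; exists u.
pose Psi := ind (0 : 'M[F]_(n, p)) (unif ^+ (maxn u u')).
have PS : schw Psi by exact: ind_schw.
have P0 k : (k <= maxn u u')%N -> forall x, x \notin lat (unif ^+ k) -> Psi x = 0.
  move=> kuu x xk; rewrite /Psi /ind subr0; case: (boolP (_ \in _)) => // xu.
  by case/negP: xk; exact: lat_unifX xu.
have := uw _ PS (P0 _ (leq_maxl _ _)); rewrite (uw' _ PS (P0 _ (leq_maxr _ _))).
by rewrite haar_ind => /scalerI; apply; rewrite vol_neq0 ?unifX_neq0.
Qed.

Lemma fiber_integralE s r u f : schw2_at s r f -> (s + r <= u)%N -> (0 < u)%N ->
  forall Psi, schw Psi -> (forall x, x \notin lat (unif ^+ u) -> Psi x = 0) ->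
  haar2 (smear Psi f) = haar Psi *: fiber_integral f.
Proof.
move=> fsr sru u0; have [w uw] := fiber_integral_exists fsr sru u0.
by rewrite (fiber_integral_uniq uw).
Qed.

Lemma fiber_integral_at f s r : schw2_at s r f ->
  fiber_integral f = (vol (n * p) (unif ^+ (s + r).+1))^-1 *:
    haar2 (smear (ind 0 (unif ^+ (s + r).+1)) f).
Proof.
move=> fsr; rewrite (fiber_integralE fsr (leqnSn _))//; last 2 first.
- exact: ind_schw.
- by move=> x; rewrite /ind subr0 => /negPf->.
by rewrite haar_ind scalerA mulVf ?scale1r// vol_neq0 ?unifX_neq0.
Qed.

Lemma fiber_integralD f g : schw2 f -> schw2 g ->
  fiber_integral (fun Y Z => f Y Z + g Y Z) = fiber_integral f + fiber_integral g.
Proof.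
move=> fS gS; have [s [r [fsr gsr]]] := schw2_at_max fS gS.
apply: (@fiber_integral_uniq (s + r).+1) => Psi PS Pu.
rewrite scalerDr -(fiber_integralE fsr (leqnSn _))//.
rewrite -(fiber_integralE gsr (leqnSn _))// -haar2D; try exact: smear_schw.
by congr haar2; apply/funext => Y; apply/funext => Z; rewrite /smear scalerDr.
Qed.

(** If Z Y = E + x with x small, then with A = 1 + E^T x the point (Y A^-1, Z) lies on the fiber and
    within the invariance radius of (Y, Z). So f already vanishes on a whole tube around the fiber,
    where the smearing is concentrated. *)
Lemma fiber_integral_eq0 f : schw2 f -> (forall Y Z, Z *m Y = E -> f Y Z = 0) ->
  fiber_integral f = 0.
Proof.
move=> [s [r fsr]] f0; rewrite (fiber_integral_at fsr); have [fs fr] := fsr.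
have -> : smear (ind 0 (unif ^+ (s + r).+1)) f = fun _ _ => 0.
  apply/funext => Y; apply/funext => Z; rewrite /smear /ind subr0.
  have [xu|_] := boolP (_ \in _); last by rewrite scale0r.
  rewrite scale1r; set x := Z *m Y - E in xu.
  have [Ys|Ys] := boolP (Y \in lat (unif ^- s)); last by rewrite fs ?Ys.
  have ETx : E^T *m x \in lat (unif ^+ (s + r).+1).
    by rewrite -[unif ^+ _]mul1r lat_mulmx ?lat_trmx.
  pose A := 1%:M + E^T *m x.
  have A1 : A - 1%:M \in lat (unif ^+ (s + r).+1) by rewrite /A addrC addKr.
  have AU := GLO_unit (GLO_near1 A1).
  have iA : invmx A - 1%:M \in lat (unif ^+ (s + r)).
    by apply: lat_unifX (GLO_near1V A1).
  have EA : E *m A = Z *m Y.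
    by rewrite /A mulmxDr mulmx1 mulmxA EE mul1mx /x addrC subrK.
  rewrite -(f0 (Y *m invmx A) Z); last by rewrite mulmxA -EA mulmxK.
  have -> : Y *m invmx A = Y + Y *m (invmx A - 1%:M).
    by rewrite mulmxBr mulmx1 addrC subrK.
  rewrite -[Z in RHS]addr0 fr ?rpred0//.
  by rewrite -(unifVD F s r) lat_mulmx.
by rewrite haar2_0 scaler0.
Qed.

(** The relation d E = E b makes the substitution preserve the fiber. The factor combines the
    Jacobian |h|^(p-n) |b|^(-m) |d|^m of dY dZ with the Jacobian of x -> d^-1 x b on the target of Z
    Y - E, which acts on the test function. *)
Lemma fiber_integral_mulmx f (h : 'M[F]_m) (b : 'M[F]_p) (d : 'M[F]_n) :
  h \in unitmx -> b \in unitmx -> d \in unitmx -> d *m E = E *m b -> schw2 f ->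
  fiber_integral (fun Y Z => f (invmx h *m Y *m b) (invmx d *m Z *m h)) =
  (vol p (\det h) * vol m (\det d) * vol n (\det b)) /
  (vol n (\det h) * vol p (\det d) * vol m (\det b)) *: fiber_integral f.
Proof.
move=> hU bU dU dE fS; have [s [r fsr]] := fS.
have hU' : invmx h \in unitmx by rewrite unitmx_inv.
have dU' : invmx d \in unitmx by rewrite unitmx_inv.
have bU' : invmx b \in unitmx by rewrite unitmx_inv.
have f'S : schw2 (fun Y Z => f (invmx h *m Y *m b) (invmx d *m Z *m h)) by exact: schw2_mulmx.
have [s1 ds1] := lat_bounded (invmx d); have [s2 bs2] := lat_bounded b.
have v0 e k (x : 'M[F]_k) : x \in unitmx -> vol e (\det x) != 0.
  by move=> xU; rewrite vol_neq0// -unitfE -unitmxE.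
apply: (@fiber_integral_uniq (s1 + (s + r).+1 + s2)) => Psi PS Pu.
pose Psi' x := Psi (d *m x *m invmx b).
have PbS : schw (fun x => Psi (x *m invmx b)) by exact: schw_mulr.
have P'S : schw Psi' by exact: (schw_mulmx (f := fun x => Psi (x *m invmx b))).
have P'0 x : x \notin lat (unif ^+ (s + r).+1) -> Psi' x = 0.
  move=> xu; apply: Pu; apply: contra xu => xu.
  have -> : x = invmx d *m (d *m x *m invmx b) *m b.
    by rewrite mulmxA mulmxKV// mulKmx.
  have -> : unif ^+ (s + r).+1 = unif ^- s1 * unif ^+ (s1 + (s + r).+1 + s2) * unif ^- s2.
    by rewrite exprD mulrA mulfK ?unifX_neq0// exprD mulKf ?unifX_neq0.
  exact: lat_mulmx (lat_mulmx ds1 xu) bs2.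
have hP : haar Psi' = (vol p (\det d) * vol n (\det (invmx b)))^-1 *: haar Psi.
  rewrite /Psi' (haar_mull (f := fun x => Psi (x *m invmx b)))// haar_mulr//.
  by rewrite scalerA invfM.
have -> : smear Psi (fun Y Z => f (invmx h *m Y *m b) (invmx d *m Z *m h)) =
   (fun Y Z => smear Psi' f (invmx h *m Y *m b) (invmx d *m Z *m h)).
  apply/funext => Y; apply/funext => Z; rewrite /smear /Psi'; congr (Psi _ *: _).
  rewrite mulmxBr mulmxBl dE mulmxK//; congr (_ - _).
  rewrite !mulmxA mulmxK// mulmxV// mul1mx -!mulmxA mulKVmx//.
rewrite haar2_mulmx//; last exact: smear_schw.
rewrite (fiber_integralE fsr (leqnSn _))// hP !scalerA; congr (_ *: _).
rewrite !det_inv !volV -?unitfE -?unitmxE//.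
rewrite [LHS]mulrA [in LHS]invfM -!mulrA.
have := v0 p _ _ hU; have := v0 n _ _ hU; have := v0 m _ _ dU; have := v0 p _ _ dU.
have := v0 m _ _ bU; have := v0 n _ _ bU.
move: (vol p (\det h)) (vol n (\det h)) (vol m (\det d)) (vol p (\det d)) => h1 h2 d1 d2.
move: (vol m (\det b)) (vol n (\det b)) (haar Psi) => b1 b2 w b20 b10 d20 d10 h20 h10.
have key (c : C) : (h1^-1 * b1)^-1 * ((d1^-1 * h2)^-1 * ((d2 / b2)^-1 * c)) =
    c * (h1 * (d1 * (b2 / (h2 * (d2 * b1))))).
  by field; rewrite h20 h10 d20 d10 b20 b10.
exact: key.
Qed.

End FiberIntegralValue.

Lemma fiber_integral_linear (W W' : lmodType C) (T : {linear W -> W'}) f : schw2 f ->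
  fiber_integral (fun Y Z => T (f Y Z)) = T (fiber_integral f).
Proof.
move=> fS; have [s [r fsr]] := fS.
apply: (@fiber_integral_uniq _ (s + r).+1) => Psi PS Pu.
rewrite -linearZ_LR -(fiber_integralE fsr (leqnSn _))// -haar2_linear; last exact: smear_schw.
by congr haar2; apply/funext => Y; apply/funext => Z; rewrite /smear linearZ_LR.
Qed.

(** On the ball around an integral fiber point, Z Y - E already lies in [lat (unif ^+ N)], so
    smearing at that scale changes nothing and what remains is the volume of the ball. *)
Lemma fiber_integral_ind2 (Y0 : M) (Z0 : M') N : Y0 \in lat 1 -> Z0 \in lat 1 ->
  Z0 *m Y0 = E -> (0 < N)%N -> fiber_integral (ind2 Y0 Z0 (unif ^+ N)) != 0.
Proof.
move=> Y01 Z01 ZYE N0.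
have isr : schw2_at 0 N (ind2 Y0 Z0 (unif ^+ N)).
  by apply: ind2_schw_at; rewrite expr0 invr1.
pose Psi := ind (0 : 'M[F]_(n, p)) (unif ^+ N).
have P0 x : x \notin lat (unif ^+ N) -> Psi x = 0.
  by rewrite /Psi /ind subr0 => /negPf->.
have := fiber_integralE isr (leqnn _) N0 (ind_schw _ _) P0.
have -> : smear Psi (ind2 Y0 Z0 (unif ^+ N)) = ind2 Y0 Z0 (unif ^+ N).
  apply/funext => Y; apply/funext => Z; rewrite /smear ind2E /Psi /ind subr0.
  have [/andP[Yu Zu]|_] := boolP (_ && _); last by rewrite scaler0.
  suff -> : Z *m Y - E \in lat (unif ^+ N) by rewrite scale1r.
  have -> : Z *m Y - E = (Z - Z0) *m Y + Z0 *m (Y - Y0).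
    by rewrite mulmxBl mulmxBr ZYE addrA subrK.
  have Y1 : Y \in lat 1.
    by rewrite -(subrK Y0 Y) rpredD//; apply: lat_le Yu; rewrite absF1 unifX_le1.
  apply: rpredD; first by rewrite -[unif ^+ N]mulr1 lat_mulmx.
  by rewrite -[unif ^+ N]mul1r lat_mulmx.
rewrite haar2_ind2 haar_ind => h; apply: contra_eq_neq h => ->.
by rewrite scaler0 mulf_neq0// vol_neq0 ?unifX_neq0.
Qed.

Section FiberFunctions.
Variable W : lmodType C.
Implicit Types f g : M -> M' -> W.

(** The integrands of interest have meaning only on the fiber, so their integral is taken through a
    Schwartz extension; [xintE] shows that the extension does not matter. *)
Definition fiber_schw f := exists2 g, schw2 g & forall Y Z, Z *m Y = E -> g Y Z = f Y Z.

Definition xint f : W := if pselect (fiber_schw f) is left e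
  then fiber_integral (s2val (cid2 e)) else 0.

Lemma xintE f g : schw2 g -> (forall Y Z, Z *m Y = E -> g Y Z = f Y Z) ->
  xint f = fiber_integral g.
Proof.
move=> gS gf; rewrite /xint; case: pselect => [e|[]]; last by exists g.
case: cid2 => g' g'S g'f /=; apply/eqP; rewrite -subr_eq0; apply/eqP.
rewrite -scaleN1r -(fiber_integral_linear ( *:%R (-1)))//.
rewrite -fiber_integralD//; last exact: schw2Z.
apply: fiber_integral_eq0 => [|Y Z YZ]; first by apply: schw2D => //; exact: schw2Z.
by rewrite gf// g'f// /= scaleN1r addrN.
Qed.

(** Bounded support and local constancy along the fiber suffice for an extension: a finite cover
    yields one radius r, and the extension takes the value of f at any fiber point within that
    radius. *)
Lemma fiber_schwP (f : M -> M' -> W) (s : nat) :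
  (forall Y Z, (Y \notin lat (unif ^- s)) || (Z \notin lat (unif ^- s)) -> f Y Z = 0) ->
  (forall Y Z, exists r, forall Y1 Z1 Y2 Z2, Z1 *m Y1 = E -> Z2 *m Y2 = E ->
     Y1 - Y \in lat (unif ^+ r) -> Z1 - Z \in lat (unif ^+ r) ->
     Y2 - Y \in lat (unif ^+ r) -> Z2 - Z \in lat (unif ^+ r) -> f Y1 Z1 = f Y2 Z2) ->
  fiber_schw f.
Proof.
move=> fs floc; have /choice[rr rrP] : forall YZ : M * M', exists r, forall Y1 Z1 Y2 Z2,
   Z1 *m Y1 = E -> Z2 *m Y2 = E ->
   Y1 - YZ.1 \in lat (unif ^+ r) -> Z1 - YZ.2 \in lat (unif ^+ r) ->
   Y2 - YZ.1 \in lat (unif ^+ r) -> Z2 - YZ.2 \in lat (unif ^+ r) -> f Y1 Z1 = f Y2 Z2.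
  by move=> [Y Z]; exact: floc.
have [xs xsP] := lat_cover2 s (fun (Y : M) (Z : M') => rr (Y, Z)).
pose r := (\max_(yz <- xs) rr yz)%N.
pose near (Y : M) (Z : M') := [set p : M * M' |
  [/\ p.2 *m p.1 = E, p.1 - Y \in lat (unif ^+ r) & p.2 - Z \in lat (unif ^+ r)]].
pose g Y Z := if pselect (exists p, near Y Z p) is left e then
   f (projT1 (cid e)).1 (projT1 (cid e)).2 else 0.
(* Equality of these sets, rather than of their chosen elements, is what makes the extension
   invariant under small translations. *)
have near_eq Y Z d e : d \in lat (unif ^+ r) -> e \in lat (unif ^+ r) ->
    near (Y + d) (Z + e) = near Y Z.
  move=> dr er; apply/seteqP; split=> -[y z] [/= zy yY zZ]; split=> //=.
  - have -> : y - Y = y - (Y + d) + d by rewrite opprD addrA subrK.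
    exact: rpredD.
  - have -> : z - Z = z - (Z + e) + e by rewrite opprD addrA subrK.
    exact: rpredD.
  - by rewrite opprD addrA rpredB.
  - by rewrite opprD addrA rpredB.
have gE Y Z : g Y Z = if pselect (exists p, near Y Z p) is left e then
   f (projT1 (cid e)).1 (projT1 (cid e)).2 else 0 by [].
exists g.
  exists s, r; split=> [Y Z YZ|Y Z d e dr er]; last first.
    by rewrite !gE (near_eq _ _ _ _ dr er).
  rewrite gE; case: pselect => // e; case: cid => -[y z] [/= zy yY zZ].
  apply: fs; case/orP: YZ => h; apply/orP; [left|right]; apply: contra h => h.
    by rewrite -(subKr y Y) rpredB//; exact: lat_unifXV yY.
  by rewrite -(subKr z Z) rpredB//; exact: lat_unifXV zZ.
move=> Y Z ZY; rewrite gE; case: pselect => [e|[]]; last first.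
  by exists (Y, Z); split; rewrite //= subrr rpred0.
case: cid => -[y z] [/= zy yY zZ].
have [/andP[Ys Zs]|YZs] := boolP ((Y \in lat (unif ^- s)) && (Z \in lat (unif ^- s))).
  have [x xxs /andP[Yx Zx]] := xsP _ _ Ys Zs.
  have rx : (rr x <= r)%N by exact: leq_bigmax_seq.
  have yY' : y - Y \in lat (unif ^+ rr x) by exact: lat_unifX yY.
  have zZ' : z - Z \in lat (unif ^+ rr x) by exact: lat_unifX zZ.
  move: Yx Zx; rewrite -surjective_pairing => Yx Zx.
  apply: (rrP x) => //.
    by rewrite -(subrKA Y) rpredD.
  by rewrite -(subrKA Z) rpredD.
rewrite negb_and in YZs; rewrite [RHS]fs//; apply: fs.
case/orP: YZs => h; apply/orP; [left|right]; apply: contra h => h.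
  by rewrite -(subKr y Y) rpredB//; exact: lat_unifXV yY.
by rewrite -(subKr z Z) rpredB//; exact: lat_unifXV zZ.
Qed.

Lemma xintD f g : fiber_schw f -> fiber_schw g ->
  xint (fun Y Z => f Y Z + g Y Z) = xint f + xint g.
Proof.
move=> [f' fS ff'] [g' gS gg']; rewrite (xintE fS ff') (xintE gS gg') -fiber_integralD//.
by apply: xintE => [|Y Z YZ]; [exact: schw2D|rewrite ff'// gg'].
Qed.

Lemma xint_ext f g : (forall Y Z, Z *m Y = E -> f Y Z = g Y Z) -> fiber_schw g ->
  xint f = xint g.
Proof.
move=> fg [g' gS gg']; rewrite (xintE gS gg'); apply: xintE => // Y Z YZ.
by rewrite gg'// fg.
Qed.

Lemma xint_mulmx f (h : 'M[F]_m) (b : 'M[F]_p) (d : 'M[F]_n) :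
  h \in unitmx -> b \in unitmx -> d \in unitmx -> d *m E = E *m b -> fiber_schw f ->
  xint (fun Y Z => f (invmx h *m Y *m b) (invmx d *m Z *m h)) =
  (vol p (\det h) * vol m (\det d) * vol n (\det b)) /
  (vol n (\det h) * vol p (\det d) * vol m (\det b)) *: xint f.
Proof.
move=> hU bU dU dE [g gS gf]; rewrite (xintE gS gf) -fiber_integral_mulmx//.
apply: xintE => [|Y Z YZ].
  by apply: schw2_mulmx; rewrite // ?unitmx_inv.
apply: gf; rewrite mulmxA -!mulmxA mulKVmx// [Z *m (Y *m b)]mulmxA YZ -dE.
by rewrite mulKmx.
Qed.

End FiberFunctions.

Lemma xint_linear (W W' : lmodType C) (T : {linear W -> W'}) (f : M -> M' -> W) :
  fiber_schw f -> xint (fun Y Z => T (f Y Z)) = T (xint f).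
Proof.
move=> [g gS gf]; rewrite (xintE gS gf) -fiber_integral_linear//.
apply: xintE => [|Y Z YZ]; last by rewrite gf.
by apply: schw2_comp => //; exact: linear0.
Qed.
End FiberIntegral.

(** * Functionals near the base point of the fiber *)

(** Sylvester's identity: the same two block matrices, multiplied in the two orders, are block
    triangular with the two determinants in question. *)
Lemma det_1DmulC (K : comRingType) a b (A : 'M[K]_(a, b)) (B : 'M[K]_(b, a)) :
  \det (1%:M + A *m B) = \det (1%:M + B *m A).
Proof.
have e1 : block_mx 1%:M A (- B) 1%:M *m block_mx 1%:M 0 B 1%:M =
    block_mx (1%:M + A *m B) A 0 1%:M.
  by rewrite mulmx_block !mulmx1 !mul1mx !mulmx0 addNr !add0r.
have e2 : block_mx 1%:M 0 B 1%:M *m block_mx 1%:M A (- B) 1%:M =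
    block_mx 1%:M A 0 (1%:M + B *m A).
  by rewrite mulmx_block !mulmx1 !mul1mx !mul0mx subrr !addr0 addrC.
have := congr1 determinant e1; have := congr1 determinant e2.
by rewrite !det_mulmx !det_ublock !det1 mulr1 mul1r mulrC => -> ->.
Qed.

Section FiberGeometry.
Variables (R : realType) (F : nonArchLocalFieldType R) (m p n : nat).
Local Notation C := R[i].
Local Notation unif := (unif F).
Local Notation M := 'M[F]_(m, p).
Local Notation M' := 'M[F]_(n, m).
Variables (P : 'M[F]_(p, m)) (Q : 'M[F]_(n, m)) (E : 'M[F]_(n, p)).

(** P and Q select complementary sets of rows. Working with these identities instead of [block_mx]
    leaves the sizes m, p, n independent as types. *)
Definition row_splitting := [/\ P *m P^T = 1%:M, Q *m Q^T = 1%:M, P *m Q^T = 0 &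
  P^T *m P + Q^T *m Q = 1%:M].
Definition integral_splitting := [/\ P \in lat 1, Q \in lat 1, E \in lat 1 & E *m E^T = 1%:M].

Hypotheses (PQ : row_splitting) (PQE : integral_splitting).

Let PP : P *m P^T = 1%:M. Proof. by case: PQ. Qed.
Let QQ : Q *m Q^T = 1%:M. Proof. by case: PQ. Qed.
Let PQ0 : P *m Q^T = 0. Proof. by case: PQ. Qed.
Let PQ1 : P^T *m P + Q^T *m Q = 1%:M. Proof. by case: PQ. Qed.
Let QP0 : Q *m P^T = 0.
Proof. by rewrite -[Q]trmxK -trmx_mul PQ0 trmx0. Qed.
Let EE : E *m E^T = 1%:M. Proof. by case: PQE. Qed.
Let P1 : P \in lat 1. Proof. by case: PQE. Qed.
Let Q1 : Q \in lat 1. Proof. by case: PQE. Qed.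
Let E1 : E \in lat 1. Proof. by case: PQE. Qed.

(** The block upper triangular matrix with diagonal blocks b, g and upper right block z, in the
    coordinates given by P and Q. *)
Definition blockU (b : 'M[F]_p) (z : 'M[F]_(p, n)) (g : 'M[F]_n) : 'M[F]_m :=
  P^T *m b *m P + P^T *m z *m Q + Q^T *m g *m Q.

Lemma blockU1 : blockU 1%:M 0 1%:M = 1%:M.
Proof. by rewrite /blockU !mulmx1 mulmx0 mul0mx addr0 PQ1. Qed.

Lemma P_blockU b z g : P *m blockU b z g = b *m P + z *m Q.
Proof. by rewrite /blockU !mulmxDr !mulmxA PP PQ0 !mul1mx !mul0mx addr0. Qed.

Lemma Q_blockU b z g : Q *m blockU b z g = g *m Q.
Proof. by rewrite /blockU !mulmxDr !mulmxA QP0 QQ !mul0mx !add0r mul1mx. Qed.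

Lemma blockU_P b z g : blockU b z g *m P^T = P^T *m b.
Proof. by rewrite /blockU !mulmxDl -!mulmxA PP QP0 !mulmx0 !addr0 mulmx1. Qed.

Lemma blockUM b z g b' z' g' :
  blockU b z g *m blockU b' z' g' = blockU (b *m b') (b *m z' + z *m g') (g *m g').
Proof.
rewrite {1}/blockU !mulmxDl -!mulmxA P_blockU Q_blockU /blockU !mulmxDr !mulmxDl.
by rewrite !mulmxA !addrA.
Qed.

Lemma det_blockU1 z g : \det (blockU 1%:M z g) = \det g.
Proof.
have -> : blockU 1%:M z g = 1%:M + (P^T *m z + Q^T *m (g - 1%:M)) *m Q.
  rewrite /blockU mulmx1 -PQ1 mulmxDl mulmxBr mulmxBl mulmx1 -!addrA; congr (_ + _).
  by rewrite addrCA [Q^T *m Q + _]addrC subrK.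
rewrite det_1DmulC mulmxDr !mulmxA QP0 QQ mul0mx mul1mx add0r addrC subrK//.
Qed.

Lemma det_blockU_diag b : \det (blockU b 0 1%:M) = \det b.
Proof.
have -> : blockU b 0 1%:M = 1%:M + (P^T *m (b - 1%:M)) *m P.
  rewrite /blockU mulmx0 mul0mx addr0 mulmx1 -PQ1 mulmxBr mulmxBl mulmx1.
  by rewrite addrAC addrCA subrr addr0 addrC.
by rewrite det_1DmulC mulmxA PP mul1mx addrC subrK.
Qed.

Lemma det_blockU b z g : b \in unitmx -> \det (blockU b z g) = \det b * \det g.
Proof.
move=> bU; have -> : blockU b z g = blockU b 0 1%:M *m blockU 1%:M (invmx b *m z) g.
  by rewrite blockUM mulmx1 mul1mx mul0mx addr0 mulKVmx.
by rewrite det_mulmx det_blockU_diag det_blockU1.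
Qed.

Definition inj_mx (Y : M) := forall v : 'cV[F]_p, Y *m v = 0 -> v = 0.

(** P and Y^T both have full row rank p, hence the same rank normal form. Their row bases are
    matched in GL_m, their column bases through the lift [blockU c 0 1%:M], which yields H with P H
    = Y^T. *)
Lemma inj_mx_complete (Y : M) : inj_mx Y -> exists2 h, h \in unitmx & h *m P^T = Y.
Proof.
move=> Yi; have rf (A : 'M[F]_(p, m)) : inj_mx A^T -> row_free A.
  move=> Ai; apply/row_freeP; case: (boolP (row_free A)) => [/row_freeP//|].
  rewrite -kermx_eq0 => /eqP kA; case: kA; apply/row_matrixP => i; rewrite row0.
  apply: trmx_inj; rewrite trmx0; apply: Ai; rewrite -trmx_mul -row_mul mulmx_ker.
  by rewrite row0 trmx0.
have rfP : row_free P by apply/row_freeP; exists P^T.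
have rfY : row_free Y^T by apply: rf; rewrite trmxK.
have /eqP rP := rfP; have /eqP rY := rfY.
have eP := mulmx_ebase P; rewrite rP in eP.
have eY := mulmx_ebase Y^T; rewrite rY in eY.
pose c := col_ebase Y^T *m invmx (col_ebase P).
have cU : c \in unitmx by rewrite unitmx_mul unitmx_inv !col_ebase_unit.
pose H := blockU c 0 1%:M *m (invmx (row_ebase P) *m row_ebase Y^T).
have HU : H \in unitmx.
  rewrite !unitmx_mul unitmx_inv !row_ebase_unit !andbT.
  by rewrite unitmxE det_blockU_diag -unitmxE.
exists H^T; first by rewrite unitmx_tr.
apply: trmx_inj; rewrite trmx_mul !trmxK /H mulmxA P_blockU mul0mx addr0.
rewrite -{1}eP /c !mulmxA mulmxKV ?col_ebase_unit// mulmxK ?row_ebase_unit//.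
Qed.

(** A completion h of Y satisfies Z h = E P up to an error in the last columns. A unipotent
    correction with block [s] leaves Y alone and removes the error because E E^T = 1. *)
Lemma fiber_transitive (Y : M) (Z : M') : inj_mx Y -> Z *m Y = E ->
  exists2 h, h \in unitmx & h *m P^T = Y /\ Z *m h = E *m P.
Proof.
move=> /inj_mx_complete[h hU hY] ZY.
pose s := - (E^T *m Z *m h *m Q^T).
have sU : blockU 1%:M s 1%:M \in unitmx by rewrite unitmxE det_blockU1 det1 unitr1.
exists (h *m blockU 1%:M s 1%:M); first by rewrite unitmx_mul hU.
split; first by rewrite -mulmxA blockU_P mulmx1.
have Zh : Z *m h = E *m P + Z *m h *m Q^T *m Q.
  by rewrite -[LHS]mulmx1 -PQ1 mulmxDr !mulmxA -(mulmxA Z h) hY ZY.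
rewrite mulmxA {1}Zh mulmxDl -!mulmxA P_blockU Q_blockU !mul1mx mulmxDr.
rewrite /s mulNmx mulmxN !mulmxA EE mul1mx.
by rewrite addrAC -!addrA addrN addr0.
Qed.

Lemma fiber_section r (Y : M) (Z : M') : Z *m Y = E ->
  Y - P^T \in lat (unif ^+ r) -> Z - E *m P \in lat (unif ^+ r) ->
  exists h, [/\ h - 1%:M \in lat (unif ^+ r), h *m P^T = Y & Z *m h = E *m P].
Proof.
move=> ZY Yr Zr; pose S := (1%:M - Y *m E^T *m Z) *m Q^T.
have ur1 : absF (unif ^+ r) <= absF (1 : F) by rewrite absF1 unifX_le1.
have Y1 : Y \in lat 1.
  by rewrite -(subrK P^T Y) rpredD ?lat_trmx//; exact: lat_le Yr.
exists (Y *m P + S *m Q); split.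
- have -> : Y *m P + S *m Q - 1%:M = (Y - P^T) *m P - Y *m E^T *m ((Z - E *m P) *m Q^T) *m Q.
    rewrite -PQ1 mulmxBl !(mulmxBl Z) -(mulmxA E) PQ0 mulmx0 subr0 /S mulmxBl mul1mx mulmxBl.
    by rewrite !mulmxA opprD addrACA; congr (_ + _); rewrite addrAC subrr add0r.
  apply: rpredB; first by rewrite -[unif ^+ r]mulr1 lat_mulmx.
  have h1 : (Z - E *m P) *m Q^T \in lat (unif ^+ r).
    by rewrite -[unif ^+ r]mulr1 lat_mulmx ?lat_trmx.
  have h2 : Y *m E^T \in lat 1 by rewrite -[1]mulr1 lat_mulmx ?lat_trmx.
  by rewrite -[unif ^+ r]mulr1 lat_mulmx// -[unif ^+ r]mul1r lat_mulmx.
- by rewrite mulmxDl -!mulmxA PP QP0 mulmx1 !mulmx0 addr0.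
- have ZS : Z *m S = 0 by rewrite /S mulmxA mulmxBr mulmx1 !mulmxA ZY EE mul1mx subrr mul0mx.
  by rewrite mulmxDr mulmxA ZY [Z *m (S *m Q)]mulmxA ZS mul0mx addr0.
Qed.

Lemma near_base_inj r (Y : M) : Y - P^T \in lat (unif ^+ r.+1) -> inj_mx Y.
Proof.
move=> Yr v Yv; pose h := 1%:M + (Y - P^T) *m P.
have hU : h \in unitmx.
  apply: GLO_unit; apply: (@GLO_near1 _ _ _ _ r); rewrite /h addrC addKr.
  by rewrite -[unif ^+ _]mulr1 lat_mulmx.
have hP : h *m P^T = Y by rewrite /h mulmxDl mul1mx -mulmxA PP mulmx1 addrC subrK.
move: Yv; rewrite -hP -mulmxA => /(congr1 (mulmx (invmx h))).
rewrite mulKmx// mulmx0 => /(congr1 (mulmx P)).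
by rewrite mulmxA PP mul1mx mulmx0.
Qed.

Lemma mulmx_near (Y : M) (Z : M') N : exists r, forall Y' Z',
  Y' - Y \in lat (unif ^+ r) -> Z' - Z \in lat (unif ^+ r) -> Z' *m Y' - Z *m Y \in lat (unif ^+ N).
Proof.
have [s Ys] := lat_bounded Y; have [s' Zs'] := lat_bounded Z; pose t := maxn s s'.
have Yt : Y \in lat (unif ^- t) by apply: lat_unifV Ys; rewrite leq_maxl.
have Zt : Z \in lat (unif ^- t) by apply: lat_unifV Zs'; rewrite leq_maxr.
have NE : unif ^+ N = unif ^- t * unif ^+ (t + N) by rewrite unifVD.
exists (t + N)%N => Y' Z' Y'r Z'r.
have Zt' : Z' \in lat (unif ^- t) by rewrite -(subrK Z Z') rpredD//; exact: lat_unifXV Z'r.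
have -> : Z' *m Y' - Z *m Y = (Z' - Z) *m Y + Z' *m (Y' - Y).
  by rewrite mulmxBl mulmxBr [RHS]addrC subrKA.
by rewrite rpredD// NE; [rewrite mulrC|]; exact: lat_mulmx.
Qed.

Lemma fiber_closed (Y : M) (Z : M') : Z *m Y <> E -> exists r, forall Y' Z',
  Y' - Y \in lat (unif ^+ r) -> Z' - Z \in lat (unif ^+ r) -> Z' *m Y' <> E.
Proof.
move=> /eqP; rewrite -subr_eq0 => ne.
have [N EN] : exists N, Z *m Y - E \notin lat (unif ^+ N).
  apply: contrapT => h; move/eqP: ne; apply; apply: lat_unif0 => N.
  by apply: contrapT => /negP hN; apply: h; exists N.
have [r rP] := mulmx_near Y Z N; exists r => Y' Z' Yr Zr ZY'; case/negP: EN.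
by rewrite -opprB rpredN -ZY'; exact: rP.
Qed.

End FiberGeometry.

(** * Functionals supported on the fiber *)

Section FiberFunctionals.
Variables (R : realType) (F : nonArchLocalFieldType R) (m p n : nat).
Local Notation C := R[i].
Local Notation unif := (unif F).
Local Notation M := 'M[F]_(m, p).
Local Notation M' := 'M[F]_(n, m).
Local Notation Phi := (M -> M' -> C^o).
Variables (P : 'M[F]_(p, m)) (Q : 'M[F]_(n, m)) (E : 'M[F]_(n, p)).
Hypotheses (PQ : row_splitting P Q) (PQE : integral_splitting P Q E).

Let PP : P *m P^T = 1%:M. Proof. by case: PQ. Qed.
Let EE : E *m E^T = 1%:M. Proof. by case: PQE. Qed.
Let P1 : P \in lat 1. Proof. by case: PQE. Qed.
Let E1 : E \in lat 1. Proof. by case: PQE. Qed.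

(** Functionals are total on raw functions and linearity is asked only on S, so the domain can be
    enlarged later without changing types. *)
Definition linear_on (S : Phi -> Prop) (W : lmodType C) (B : Phi -> W) :=
  forall c f g, S f -> S g -> B (fun Y Z => c *: f Y Z + g Y Z) = c *: B f + B g.

Definition fiber_supported (S : Phi -> Prop) (W : lmodType C) (B : Phi -> W) :=
  forall f, S f -> (forall Y Z, Z *m Y = E -> f Y Z = 0) -> B f = 0.

Definition schw2_sub (S : Phi -> Prop) :=
  [/\ forall f, S f -> schw2 f, S (fun _ _ => 0) &
      forall c f g, S f -> S g -> S (fun Y Z => c *: f Y Z + g Y Z)].

Lemma schw2_subT : schw2_sub (@schw2 R F m p n m C^o).
Proof.
split=> // [|c f g fS gS]; first exact: schw2_0.
by apply: schw2D => //; exact: schw2Z.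
Qed.

Lemma linear_on0 S (W : lmodType C) (B : Phi -> W) : schw2_sub S -> linear_on S B ->
  B (fun _ _ => 0) = 0.
Proof.
move=> [_ S0 _] lB; have := lB 1 _ _ S0 S0.
have -> : (fun (_ : M) (_ : M') => (1 : C) *: (0 : C^o) + 0) = (fun _ _ => 0).
  by apply/funext => Y; apply/funext => Z; rewrite scaler0 addr0.
by rewrite scale1r => /eqP; rewrite -subr_eq0 opprD addNKr oppr_eq0 => /eqP.
Qed.

Lemma linear_onZ S (W : lmodType C) (B : Phi -> W) c f : schw2_sub S -> linear_on S B ->
  S f -> B (fun Y Z => c *: f Y Z) = c *: B f.
Proof.
move=> SS lB Sf; have [_ S0 _] := SS; rewrite -[RHS]addr0 -(linear_on0 SS lB) -lB//.
by congr B; apply/funext => Y; apply/funext => Z; rewrite addr0.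
Qed.

Lemma linear_on_sum S (W : lmodType C) (B : Phi -> W) (I : Type) (l : seq I)
    (c : I -> C) (f : I -> Phi) : schw2_sub S -> linear_on S B -> (forall i, S (f i)) ->
  B (fun Y Z => \sum_(i <- l) c i *: f i Y Z) = \sum_(i <- l) c i *: B (f i).
Proof.
move=> SS lB fS; have [_ S0 SD] := SS.
suff [] : S (fun Y Z => \sum_(i <- l) c i *: f i Y Z) /\
  B (fun Y Z => \sum_(i <- l) c i *: f i Y Z) = \sum_(i <- l) c i *: B (f i) by [].
elim: l => [|i l [IHS IHl]].
  have -> : (fun Y Z => \sum_(i <- [::]) c i *: f i Y Z) = (fun _ _ => 0).
    by apply/funext => Y; apply/funext => Z; rewrite big_nil.
  by rewrite big_nil; split=> //; exact: linear_on0 lB.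
have -> : (fun Y Z => \sum_(j <- i :: l) c j *: f j Y Z) =
    (fun Y Z => c i *: f i Y Z + \sum_(j <- l) c j *: f j Y Z).
  by apply/funext => Y; apply/funext => Z; rewrite big_cons.
by split; [exact: SD|rewrite lB// IHl big_cons].
Qed.

(** A finite cover gives one scale N at which f is a finite combination of indicators, each of them
    killed by B. This replaces a partition of unity and needs no continuity of B. *)
Lemma local_vanishing (W : lmodType C) (B : Phi -> W) f :
  linear_on (@schw2 R F m p n m C^o) B -> schw2 f ->
  (forall Y Z, exists r, forall N y z, (r <= N)%N ->
     y - Y \in lat (unif ^+ r) -> z - Z \in lat (unif ^+ r) ->
     f y z != 0 -> B (ind2 y z (unif ^+ N)) = 0) -> B f = 0.
Proof.
move=> lB [s [r fsr]] fB; have [fs _] := fsr.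
have /choice[rr rrP] := fun YZ : M * M' => fB YZ.1 YZ.2.
have [xs xsP] := lat_cover2 s (fun (Y : M) (Z : M') => rr (Y, Z)).
pose N := maxn r (\max_(yz <- xs) rr yz)%N.
have fsN : schw2_at s N f by apply: schw2_at_le fsr; rewrite ?leq_maxl.
have -> : f = fun Y Z => \sum_(yz <- [seq (y, z) | y <- grid F m p s N, z <- grid F n m s N])
      (f yz.1 yz.2 : C) *: ind2 yz.1 yz.2 (unif ^+ N) Y Z.
  rewrite [LHS](schw2_decomp fsN); apply/funext => Y; apply/funext => Z.
  by apply: eq_bigr => yz _; exact: mulrC.
rewrite (linear_on_sum _ _ schw2_subT lB) => [|yz]; last exact: ind2_schw.
rewrite big1// => -[y z] _ /=; have [->|fyz] := eqVneq (f y z) 0; first by rewrite scale0r.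
have yzs : (y \in lat (unif ^- s)) && (z \in lat (unif ^- s)).
  by apply: contraNT fyz; rewrite negb_and => /fs->.
have [ys zs] := andP yzs; have [[Y Z] Yxs /andP[yY zZ]] := xsP _ _ ys zs.
rewrite (rrP (Y, Z) N) ?scaler0//.
by rewrite /N leq_max; apply/orP; right; exact: leq_bigmax_seq.
Qed.

Definition base_ind N : Phi := ind2 P^T (E *m P) (unif ^+ N).

Definition near_base N (Y : M) (Z : M') :=
  Y - P^T \in lat (unif ^+ N) /\ Z - E *m P \in lat (unif ^+ N).

Lemma base_fiber : (E *m P) *m P^T = E.
Proof. by rewrite -mulmxA PP mulmx1. Qed.

Lemma base_lat : P^T \in lat 1 /\ E *m P \in lat 1.
Proof. by rewrite lat_trmx; split=> //; rewrite -[1]mulr1 lat_mulmx. Qed.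

Lemma base_ind_schw_at N : schw2_at 0 N (base_ind N).
Proof. by have [PL EPL] := base_lat; apply: ind2_schw_at; rewrite expr0 invr1. Qed.

Lemma base_ind_schw N : schw2 (base_ind N).
Proof. by exists 0%N, N; exact: base_ind_schw_at. Qed.

Lemma base_ind_near N r Y Z : (r <= N)%N -> base_ind N Y Z != 0 -> near_base r Y Z.
Proof.
move=> rN; rewrite /base_ind ind2E; case: (boolP (_ && _)) => [/andP[YN ZN] _|_].
  by split; [exact: lat_unifX YN|exact: lat_unifX ZN].
by rewrite eqxx.
Qed.

Definition meets N (yz : M * M') := exists Y Z,
  [/\ Z *m Y = E, Y - yz.1 \in lat (unif ^+ N) & Z - yz.2 \in lat (unif ^+ N)].

(** This number depends on f alone and not on the functional, which is why two invariant functionals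
    are proportional near the base point. *)
Definition base_coef s N (f : Phi) : C :=
  \sum_(yz <- [seq (y, z) | y <- grid F m p s N, z <- grid F n m s N])
    (`[< meets N yz >])%:R * f yz.1 yz.2.

Section Local.
Variables (W : lmodType C) (B : Phi -> W) (r : nat).
Hypotheses (linB : linear_on (@schw2 R F m p n m C^o) B).
Hypotheses (supB : fiber_supported (@schw2 R F m p n m C^o) B) (r0 : (0 < r)%N).
Hypothesis invB : forall h f, h - 1%:M \in lat (unif ^+ r) -> schw2 f ->
  B (fun Y Z => f (invmx h *m Y) (Z *m h)) = B f.

(* The matrices h with h - 1 in lat (unif ^+ r) act transitively on the part of the
   fiber lying within unif ^+ r of the base point, so an invariant functional takes the
   same value on all indicator functions of balls that meet it. *)
Lemma local_ind N yz : (r <= N)%N -> near_base r yz.1 yz.2 ->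
  B (ind2 yz.1 yz.2 (unif ^+ N)) = (`[< meets N yz >])%:R *: B (base_ind N).
Proof.
case: yz => y z /= rN [yr zr]; case: asboolP => [[Y [Z /= [ZY Yy Zz]]]|nm]; last first.
  rewrite scale0r; apply: supB => [|Y Z ZY]; first exact: ind2_schw.
  rewrite ind2E; case: (boolP (_ && _)) => // /andP[Yy Zz]; case: nm.
  by exists Y, Z.
rewrite scale1r.
have Yr : Y - P^T \in lat (unif ^+ r).
  by rewrite -(subrKA y) rpredD//; exact: lat_unifX Yy.
have Zr : Z - E *m P \in lat (unif ^+ r).
  by rewrite -(subrKA z) rpredD//; exact: lat_unifX Zz.
have [h [hr hY hZ]] := fiber_section PQ PQE ZY Yr Zr.
have hO : h \in @GLO _ F m by apply: (@GLO_near1 _ _ _ _ r.-1); rewrite prednK.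
have hU := GLO_unit hO.
rewrite -(invB hr (base_ind_schw N)); congr B.
apply/funext => Y'; apply/funext => Z'; rewrite /base_ind !ind2E.
congr (nat_of_bool (_ && _))%:R.
  have -> : invmx h *m Y' - P^T = invmx h *m (Y' - Y) by rewrite mulmxBr -hY mulKmx.
  rewrite GLO_lat; last exact: GLO_inv.
  by rewrite -(rpredDr (Y' - Y) Yy) subrKA.
have -> : Z' *m h - E *m P = (Z' - Z) *m h by rewrite mulmxBl hZ.
by rewrite GLO_latr// -(rpredDr (Z' - Z) Zz) subrKA.
Qed.

Lemma local_coef s N f : (r <= N)%N -> schw2_at s N f ->
  (forall Y Z, f Y Z != 0 -> near_base r Y Z) -> B f = base_coef s N f *: B (base_ind N).
Proof.
move=> rN fsN fn.
have -> : B f = B (fun Y Z => \sum_(yz <- [seq (y, z) | y <- grid F m p s N, z <- grid F n m s N])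
      (f yz.1 yz.2 : C) *: ind2 yz.1 yz.2 (unif ^+ N) Y Z).
  congr B; rewrite [LHS](schw2_decomp fsN); apply/funext => Y; apply/funext => Z.
  by apply: eq_bigr => yz _; exact: mulrC.
rewrite (linear_on_sum _ _ schw2_subT linB) => [|yz]; last exact: ind2_schw.
rewrite /base_coef scaler_suml; apply: eq_bigr => yz _.
have [->|fyz] := eqVneq (f yz.1 yz.2) 0; first by rewrite mulr0 !scale0r.
by rewrite (local_ind rN (fn _ _ fyz)) scalerA mulrC.
Qed.

End Local.

(** At a fine scale N, both B and mu equal [base_coef] times their value on [base_ind N]. Applying
    this to f and to [base_ind r] and dividing eliminates N. *)
Lemma local_uniqueness (W : lmodType C) (B : Phi -> W) (mu : Phi -> C^o) r :
  linear_on (@schw2 R F m p n m C^o) B -> fiber_supported (@schw2 R F m p n m C^o) B ->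
  linear_on (@schw2 R F m p n m C^o) mu -> fiber_supported (@schw2 R F m p n m C^o) mu ->
  (0 < r)%N ->
  (forall h f, h - 1%:M \in lat (unif ^+ r) -> schw2 f ->
    B (fun Y Z => f (invmx h *m Y) (Z *m h)) = B f) ->
  (forall h f, h - 1%:M \in lat (unif ^+ r) -> schw2 f ->
    mu (fun Y Z => f (invmx h *m Y) (Z *m h)) = mu f) ->
  (forall N, (0 < N)%N -> mu (base_ind N) != 0) ->
  forall f, schw2 f -> (forall Y Z, f Y Z != 0 -> near_base r Y Z) ->
  B f = mu f *: ((mu (base_ind r) : C)^-1 *: B (base_ind r)).
Proof.
move=> lB sB lm sm r0 iB im m0 f [s [N' fsN']] fn.
pose N := maxn r N'; have rN : (r <= N)%N by rewrite leq_maxl.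
have fsN : schw2_at s N f by apply: schw2_at_le fsN'; rewrite ?leq_maxr.
have bsN : schw2_at s N (base_ind r) by apply: schw2_at_le (base_ind_schw_at r).
have bn Y Z : base_ind r Y Z != 0 -> near_base r Y Z by exact: base_ind_near.
have mN0 : mu (base_ind N) != 0 by apply: m0; rewrite (leq_trans r0).
rewrite (local_coef lB sB r0 iB rN fsN fn) (local_coef lm sm r0 im rN fsN fn).
rewrite (local_coef lB sB r0 iB rN bsN bn) (local_coef lm sm r0 im rN bsN bn).
have c0 : base_coef s N (base_ind r) != 0.
  have := m0 _ r0; rewrite (local_coef lm sm r0 im rN bsN bn).
  by apply: contra_neq => ->; rewrite scale0r.
rewrite !scalerA; congr (_ *: _).
have key (c d x : C) : c != 0 -> x != 0 -> d = d * x * (c * x)^-1 * c.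
  by move=> c1 x1; field; rewrite c1 x1.
exact: key.
Qed.

End FiberFunctionals.

Section AbsDet.
Variables (R : realType) (F : nonArchLocalFieldType R).

Lemma abs_det_vol q k (A : 'M[F]_q) : vol k (\det A) = abs_det A k%:R.
Proof. by rewrite /vol /abs_det powR_mulrn// absF_ge0. Qed.

Lemma abs_detD q (A : 'M[F]_q) s t : A \in unitmx ->
  abs_det A (s + t) = abs_det A s * abs_det A t.
Proof.
move=> AU; rewrite /abs_det -rmorphM -powRD//.
by rewrite absF_eq0 -unitfE -unitmxE AU implybT.
Qed.

Lemma abs_det_0 q (A : 'M[F]_q) : abs_det A 0 = 1.
Proof. by rewrite /abs_det powRr0. Qed.

Lemma abs_det_neq0 q (A : 'M[F]_q) s : A \in unitmx -> abs_det A s != 0.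
Proof.
move=> AU; rewrite /abs_det fmorph_eq0 gt_eqF// powR_gt0// absF_gt0.
by rewrite -unitfE -unitmxE.
Qed.

Lemma abs_detNr q (A : 'M[F]_q) s : A \in unitmx -> abs_det A (- s) = (abs_det A s)^-1.
Proof.
move=> AU; apply: (mulfI (abs_det_neq0 s AU)).
by rewrite -abs_detD// subrr abs_det_0 mulfV// abs_det_neq0.
Qed.

Lemma abs_detV q (A : 'M[F]_q) s : A \in unitmx -> abs_det (invmx A) s = (abs_det A s)^-1.
Proof.
move=> AU; apply: (mulfI (abs_det_neq0 s AU)).
by rewrite -abs_detM mulmxV// abs_det1 mulfV// abs_det_neq0.
Qed.

Lemma abs_det_GLO q (A : 'M[F]_q) s : A \in @GLO _ F q -> abs_det A s = 1.
Proof. by case/andP => _ /eqP dA; rewrite /abs_det dA powR1. Qed.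

Lemma abs_det_eq q q' (A : 'M[F]_q) (B : 'M[F]_q') s :
  \det A = \det B -> abs_det A s = abs_det B s.
Proof. by rewrite /abs_det => ->. Qed.

End AbsDet.

(** * The vector attached to an invariant functional at the base point *)

Section BaseValue.
Variables (R : realType) (F : nonArchLocalFieldType R) (m p n : nat).
Local Notation C := R[i].
Local Notation unif := (unif F).
Local Notation M := 'M[F]_(m, p).
Local Notation M' := 'M[F]_(n, m).
Local Notation Phi := (M -> M' -> C^o).
Local Notation S2 := (@schw2 R F m p n m C^o).
Variables (P : 'M[F]_(p, m)) (Q : 'M[F]_(n, m)) (E : 'M[F]_(n, p)).
Hypotheses (PQ : row_splitting P Q) (PQE : integral_splitting P Q E).
Variables (V : rep C (GL F m)) (W : lmodType C) (alpha : R).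

Let PP : P *m P^T = 1%:M. Proof. by case: PQ. Qed.
Let EE : E *m E^T = 1%:M. Proof. by case: PQE. Qed.
Let P1 : P \in lat 1. Proof. by case: PQE. Qed.
Let E1 : E \in lat 1. Proof. by case: PQE. Qed.

Definition fixed_by r (v : V) :=
  forall h : GL F m, val h - 1%:M \in lat (unif ^+ r) -> act V h v = v.

Hypothesis smoothV : forall v : V, exists r, fixed_by r v.

Lemma fixed_by_le r r' (v : V) : (r <= r')%N -> fixed_by r v -> fixed_by r' v.
Proof. by move=> rr' vr h hr; apply: vr; exact: lat_unifX hr. Qed.

Lemma exists_level (v : V) : exists r, (0 < r)%N /\ fixed_by r v.
Proof.
by have [r vr] := smoothV v; exists r.+1; split=> //; exact: fixed_by_le vr.
Qed.

(** The level is taken positive so that the congruence subgroup fixing v lies in GL(O), where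
    determinants have absolute value 1. *)
Definition level (v : V) : nat := projT1 (cid (exists_level v)).
Lemma level_gt0 v : (0 < level v)%N.
Proof. by case: (projT2 (cid (exists_level v))). Qed.
Lemma level_fixed v : fixed_by (level v) v.
Proof. by case: (projT2 (cid (exists_level v))). Qed.

Local Notation mu := (@fiber_integral R F m p n E C^o).
Local Notation bind := (@base_ind R F m p n P E).

Definition act_pt (h : GL F m) (f : Phi) : Phi :=
  fun Y Z => abs_det (val h) alpha *: f (invmx (val h) *m Y) (Z *m val h).

Definition model_functional (S : Phi -> Prop) (B : Phi -> V -> W) :=
  [/\ forall v, linear_on S (B^~ v), forall f, S f -> linear (B f),
      forall v, fiber_supported E S (B^~ v) &
      forall h f v, S f -> B (act_pt h f) (act V h v) = B f v].

Lemma mu_linear : linear_on S2 mu.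
Proof.
move=> c f g fS gS; have [_ _ _ EE'] := PQE.
rewrite (fiber_integralD EE' E1 (schw2Z c fS) gS); congr (_ + _).
exact: (fiber_integral_linear EE' E1 ( *:%R c)).
Qed.

Lemma mu_supported : fiber_supported E S2 mu.
Proof. by move=> f fS; exact: fiber_integral_eq0. Qed.

Lemma mu_invariant r h f : (0 < r)%N -> h - 1%:M \in lat (unif ^+ r) -> S2 f ->
  mu (fun Y Z => f (invmx h *m Y) (Z *m h)) = mu f.
Proof.
move=> r0 hr fS.
have hO : h \in @GLO _ F m by apply: (@GLO_near1 _ _ _ _ r.-1); rewrite prednK.
have hU := GLO_unit hO.
have := fiber_integral_mulmx EE E1 hU (unitmx1 _ _) (unitmx1 _ _) _ fS.
rewrite mul1mx mulmx1 => /(_ erefl); rewrite !det1 !vol1 !mulr1.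
have [_ /eqP dh] := andP hO; rewrite /vol dh !expr1n divr1 scale1r => <-.
by congr fiber_integral; apply/funext => Y; apply/funext => Z; rewrite invmx1 mul1mx mulmx1.
Qed.

Lemma mu_base N : (0 < N)%N -> mu (bind N) != 0.
Proof.
have [PL EPL] := base_lat PQE => N0; apply: fiber_integral_ind2 => //.
by rewrite (base_fiber E PQ).
Qed.

Section Functional.
Variable B : Phi -> V -> W.
Hypothesis mB : model_functional S2 B.

(** This is ell(v): the ratio of B to the fiber measure on a small ball around the base point, which
    by [base_valueE] no longer depends on the ball. *)
Definition base_value (v : V) : W := (mu (bind (level v)) : C)^-1 *: B (bind (level v)) v.

Lemma model_invariant r v h f : (0 < r)%N -> fixed_by r v ->
  h - 1%:M \in lat (unif ^+ r) -> S2 f ->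
  B (fun Y Z => f (invmx h *m Y) (Z *m h)) v = B f v.
Proof.
move=> r0 vr hr fS; have [_ _ _ B3] := mB.
have hO : h \in @GLO _ F m by apply: (@GLO_near1 _ _ _ _ r.-1); rewrite prednK.
pose g : GL F m := Sub h (GLO_unit hO).
have := B3 g f v fS; rewrite (vr g)//.
have -> // : act_pt g f = fun Y Z => f (invmx h *m Y) (Z *m h).
by apply/funext => Y; apply/funext => Z; rewrite /act_pt /= abs_det_GLO// scale1r.
Qed.

Lemma model_local r v f : (0 < r)%N -> fixed_by r v -> S2 f ->
  (forall Y Z, f Y Z != 0 -> near_base P E r Y Z) ->
  B f v = mu f *: ((mu (bind r) : C)^-1 *: B (bind r) v).
Proof.
move=> r0 vr fS fn; have [B1 _ B2 _] := mB.
have iB h g : h - 1%:M \in lat (unif ^+ r) -> S2 g ->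
    B (fun Y Z => g (invmx h *m Y) (Z *m h)) v = B g v.
  by move=> hr gS; exact: model_invariant hr gS.
have im h g : h - 1%:M \in lat (unif ^+ r) -> S2 g ->
    mu (fun Y Z => g (invmx h *m Y) (Z *m h)) = mu g by exact: mu_invariant.
exact: (local_uniqueness PQ PQE (B1 v) (B2 v) mu_linear mu_supported r0 iB im mu_base fS fn).
Qed.

Lemma base_valueE r v f : (0 < r)%N -> fixed_by r v -> S2 f ->
  (forall Y Z, f Y Z != 0 -> near_base P E r Y Z) -> B f v = mu f *: base_value v.
Proof.
move=> r0 vr fS fn; rewrite (model_local r0 vr fS fn); congr (_ *: _).
have key a b : (0 < a)%N -> (a <= b)%N -> fixed_by a v ->
    (mu (bind a) : C)^-1 *: B (bind a) v = (mu (bind b) : C)^-1 *: B (bind b) v.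
  move=> a0 ab va; rewrite (@model_local a v (bind b))//.
  - by rewrite [RHS]scalerA mulVf ?scale1r// mu_base// (leq_trans a0).
  - exact: (base_ind_schw PQE).
  - by move=> Y Z; exact: base_ind_near.
rewrite /base_value; case: (leqP r (level v)) => [rl|/ltnW lr]; first exact: key.
by apply/esym/key => //; [exact: level_gt0|exact: level_fixed].
Qed.

Lemma base_value_bind N r v : (0 < r)%N -> (r <= N)%N -> fixed_by r v ->
  B (bind N) v = mu (bind N) *: base_value v.
Proof.
move=> r0 rN vr; apply: (@base_valueE r) => //; first exact: (base_ind_schw PQE).
by move=> Y Z; exact: base_ind_near.
Qed.

Lemma base_value_linear : linear base_value.
Proof.
move=> c u v; pose r := maxn (level u) (level v).
have r0 : (0 < r)%N by rewrite leq_max level_gt0.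
have ur : fixed_by r u by exact: (fixed_by_le (leq_maxl _ _) (@level_fixed u)).
have vr : fixed_by r v by exact: (fixed_by_le (leq_maxr _ _) (@level_fixed v)).
have cr : fixed_by r (c *: u + v) by move=> h hr; rewrite linearP/= ur// vr.
have [_ B1' _ _] := mB; have m0 : mu (bind r) != 0 by exact: mu_base.
apply: (scalerI m0); rewrite -(@base_value_bind r r)// B1'; last exact: (base_ind_schw PQE).
by rewrite (@base_value_bind r r u)// (@base_value_bind r r v)// scalerDr !scalerA [c * _]mulrC.
Qed.

(** The hypotheses say that h and (b, d) together fix the base point, so the substitution carries
    small balls there to small neighbourhoods of the same point. The scalar is [kappa] times the
    modulus of the fiber measure from [fiber_integral_mulmx]. *)
Lemma base_value_equiv (h : GL F m) (b : 'M[F]_p) (d : 'M[F]_n) (T : {linear W -> W})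
    (kappa : C) v :
  b \in unitmx -> d \in unitmx -> d *m E = E *m b -> val h *m P^T = P^T *m b ->
  E *m P *m val h = d *m E *m P ->
  (forall f, S2 f -> B (fun Y Z => kappa *: f (invmx (val h) *m Y *m b)
     (invmx d *m Z *m val h)) (act V h v) = T (B f v)) ->
  (kappa * ((vol p (\det (val h)) * vol m (\det d) * vol n (\det b)) /
  (vol n (\det (val h)) * vol p (\det d) * vol m (\det b)))) *: base_value (act V h v) =
  T (base_value v).
Proof.
move=> bU dU dE hP Ph BT; have hU : val h \in unitmx := valP h.
pose r := maxn (level v) (level (act V h v)).
have r0 : (0 < r)%N by rewrite leq_max level_gt0.
have vr : fixed_by r v by exact: (fixed_by_le (leq_maxl _ _) (@level_fixed v)).
have hvr : fixed_by r (act V h v).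
  exact: (fixed_by_le (leq_maxr _ _) (@level_fixed (act V h v))).
have [s1 hs] := lat_bounded (val h); have [s2 bs] := lat_bounded (invmx b).
have [s3 ds] := lat_bounded d; have [s4 ihs] := lat_bounded (invmx (val h)).
pose s := (maxn (maxn s1 s2) (maxn s3 s4)).
have hs' : val h \in lat (unif ^- s) by apply: lat_unifV hs; rewrite !leq_max leqnn.
have bs' : invmx b \in lat (unif ^- s) by apply: lat_unifV bs; rewrite !leq_max leqnn ?orbT.
have ds' : d \in lat (unif ^- s) by apply: lat_unifV ds; rewrite !leq_max leqnn ?orbT.
have ihs' : invmx (val h) \in lat (unif ^- s).
  by apply: lat_unifV ihs; rewrite !leq_max leqnn ?orbT.
(* The matrices and their inverses lose at most s digits on each side, so the image of the ball of
   level N stays within the ball of level r. *)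
pose N := (s + r + s)%N.
have rE : unif ^+ r = unif ^- s * unif ^+ N * unif ^- s.
  by rewrite /N exprD mulrA mulfK ?unifX_neq0// exprD mulKf ?unifX_neq0.
have rN : (r <= N)%N by rewrite /N addnAC leq_addl.
pose f : Phi := fun Y Z => bind N (invmx (val h) *m Y *m b) (invmx d *m Z *m val h).
have bS : S2 (bind N) by exact: (base_ind_schw PQE).
have fS : S2 f by apply: schw2_mulmx; rewrite ?unitmx_inv.
have kfS : S2 (fun Y Z => kappa *: f Y Z) by exact: schw2Z.
have kfn Y Z : kappa *: f Y Z != 0 -> near_base P E r Y Z.
  rewrite scaler_eq0 negb_or => /andP[_] /(base_ind_near (leqnn N))[YN ZN].
  have -> : Y = val h *m (invmx (val h) *m Y *m b) *m invmx b.
    by rewrite mulmxA mulmxK// mulKVmx.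
  have -> : Z = d *m (invmx d *m Z *m val h) *m invmx (val h).
    by rewrite mulmxA mulmxK// mulKVmx.
  split.
    have -> : P^T = val h *m P^T *m invmx b by rewrite hP mulmxK.
    by rewrite -mulmxBl -mulmxBr rE (lat_mulmx (lat_mulmx hs' YN) bs').
  have -> : E *m P = d *m (E *m P) *m invmx (val h) by rewrite mulmxA -Ph mulmxK.
  by rewrite -mulmxBl -mulmxBr rE (lat_mulmx (lat_mulmx ds' ZN) ihs').
have := BT _ bS; rewrite (@base_valueE r _ _ r0 hvr kfS kfn).
rewrite (@base_value_bind N r v)// (linearZ_LR T).
have -> : mu (fun Y Z => kappa *: f Y Z) = kappa *: mu f.
  exact: (fiber_integral_linear EE E1 ( *:%R kappa)).
rewrite (fiber_integral_mulmx EE E1 hU bU dU dE bS).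
set c := (_ / _); rewrite -[kappa *: _]/(kappa * (c * mu (bind N))) => e.
have m0 : mu (bind N) != 0 by apply: mu_base; rewrite (leq_trans r0).
apply: (scalerI m0); rewrite -[RHS]e scalerA; congr (_ *: _).
by rewrite mulrC -mulrA.
Qed.

Hypothesis value0 : forall v, base_value v = 0.

(** Transitivity moves the point to the base point, where B is the fiber measure times [base_value];
    the vector becomes h^-1 v, and its level fixes the radius. *)
Lemma model_local_eq0 v (Y : M) (Z : M') : Z *m Y = E -> inj_mx Y -> exists r,
  forall f, S2 f -> (forall Y' Z', f Y' Z' != 0 ->
     Y' - Y \in lat (unif ^+ r) /\ Z' - Z \in lat (unif ^+ r)) -> B f v = 0.
Proof.
move=> ZY Yi; have [h hU [hY hZ]] := fiber_transitive PQ PQE Yi ZY.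
pose g : GL F m := Sub h hU; pose u := act V g^-1%g v.
have [s hs] := lat_bounded h; have [t iht] := lat_bounded (invmx h).
exists (maxn s t + level u)%N => f fS fn; have [_ _ _ B3] := mB.
have hs' : h \in lat (unif ^- maxn s t) by apply: lat_unifV hs; rewrite leq_maxl.
have iht' : invmx h \in lat (unif ^- maxn s t) by apply: lat_unifV iht; rewrite leq_maxr.
have f'S : S2 (act_pt g^-1%g f).
  apply: schw2Z; have hU' : invmx h \in unitmx by rewrite unitmx_inv.
  have := schw2_mulmx hU (unitmx1 F p) (unitmx1 F n) hU' fS.
  by under eq_fun do under eq_fun do rewrite mulmx1 mul1mx; rewrite GL_valV invmxK.
rewrite -(B3 g^-1%g f v fS) -/u (@base_valueE (level u))//.
- by rewrite value0 scaler0.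
- exact: level_gt0.
- exact: level_fixed.
move=> Y' Z'; rewrite /act_pt GL_valV/= invmxK scaler_eq0 negb_or => /andP[_] /fn[Yr Zr].
have rE : unif ^+ level u = unif ^- maxn s t * unif ^+ (maxn s t + level u) by rewrite unifVD.
split.
  have -> : Y' - P^T = invmx h *m (h *m Y' - Y) by rewrite mulmxBr mulKmx// -hY mulKmx.
  by rewrite rE lat_mulmx.
have -> : Z' - E *m P = (Z' *m invmx h - Z) *m h by rewrite mulmxBl mulmxKV// hZ.
by rewrite rE mulrC lat_mulmx.
Qed.

(** By [local_vanishing] three kinds of points remain: off the fiber the support condition applies,
    at injective Y the base value does, and near a degenerate fiber point f itself vanishes. *)
Lemma base_value_eq0 f v : S2 f ->
  (forall Y Z, Z *m Y = E -> ~ inj_mx Y -> f Y Z = 0) -> B f v = 0.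
Proof.
move=> fS f0; have [s [r [_ fr]]] := fS; have [B1 _ B2 _] := mB.
apply: (local_vanishing (B1 v) fS) => Y Z.
have [ZY|ZY] := pselect (Z *m Y = E); last first.
  have [r0 r0P] := fiber_closed ZY; exists r0 => N y z r0N yY zZ _.
  apply: B2 => [|Y' Z' ZY']; first exact: ind2_schw.
  rewrite ind2E; case: (boolP (_ && _)) => // /andP[Yy Zz]; case: (r0P Y' Z') => //.
    by rewrite -(subrKA y) rpredD//; exact: lat_unifX Yy.
  by rewrite -(subrKA z) rpredD//; exact: lat_unifX Zz.
have [Yi|Yi] := pselect (inj_mx Y); last first.
  exists r => N y z rN yY zZ; rewrite -(subrK Y y) -(subrK Z z) addrC [_ + Z]addrC.
  by rewrite fr// f0// eqxx.
have [r0 r0P] := model_local_eq0 v ZY Yi; exists r0 => N y z r0N yY zZ _.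
apply: r0P => [|Y' Z']; first exact: ind2_schw.
rewrite ind2E; case: (boolP (_ && _)) => [/andP[Yy Zz] _|]; last by rewrite eqxx.
split; first by rewrite -(subrKA y) rpredD//; exact: lat_unifX Yy.
by rewrite -(subrKA z) rpredD//; exact: lat_unifX Zz.
Qed.

End Functional.
End BaseValue.

(** * Extension through the degenerate points *)

Section Extension.
Variables (R : realType) (F : nonArchLocalFieldType R) (m p n : nat).
Local Notation C := R[i].
Local Notation unif := (unif F).
Local Notation M := 'M[F]_(m, p).
Local Notation M' := 'M[F]_(n, m).
Local Notation Phi := (M -> M' -> C^o).
Local Notation S2 := (@schw2 R F m p n m C^o).
Variables (E : 'M[F]_(n, p)) (lv : 'I_p -> nat) (K : nat) (chi : 'M[F]_p -> C).

Definition upper_mx (b : 'M[F]_p) := forall r c, b r c != 0 -> (lv r <= lv c)%N.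

(** 1 + nu runs over the unipotent radical of a maximal block parabolic. It is abelian because nu
    nu' = 0, so the twists at one level commute. *)
Definition jump_mx j (nu : 'M[F]_p) := forall r c, nu r c != 0 -> (lv r < j <= lv c)%N.

(** Non-injectivity is filtered by the levels met by a kernel vector. No Y is degenerate at level 0,
    which is where the descent ends. *)
Definition degenerate j (Y : M) := exists v : 'cV[F]_p,
  [/\ v != 0, forall r, v r 0 != 0 -> (lv r < j)%N & Y *m v = 0].

Definition nondeg_sub j (f : Phi) := S2 f /\ forall Y Z, degenerate j Y -> f Y Z = 0.

(** Genericity of the character: a column v that is nonzero at level j can be paired with a row at
    level j + 1 so that chi detects the product. *)
Hypothesis chi_generic : forall j (v : 'cV[F]_p), (j.+1 < K)%N ->
  (exists r, lv r = j /\ v r 0 != 0) ->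
  exists w : 'rV[F]_p, (forall c, w 0 c != 0 -> lv c = j.+1) /\ chi (v *m w) != 1.
Hypothesis EJ : forall j nu, (j < K)%N -> jump_mx j nu -> E *m nu = 0.

Lemma sum_neq0 (T : finType) (f : T -> F) : \sum_i f i != 0 -> exists i, f i != 0.
Proof.
move=> s0; apply: contrapT => h; move: s0; rewrite big1 ?eqxx// => i _.
by apply: contrapT => /eqP fi; apply: h; exists i.
Qed.

Lemma jump_mulmx j nu nu' : jump_mx j nu -> jump_mx j nu' -> nu *m nu' = 0.
Proof.
move=> nj nj'; apply/matrixP => r c; rewrite !mxE; apply: contrapT => /eqP h.
have [k] := sum_neq0 h; rewrite mulf_eq0 negb_or => /andP[/nj/andP[_ jk] /nj'/andP[kj _]].
by rewrite ltnNge jk in kj.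
Qed.

Lemma jump_mulE j nu nu' : jump_mx j nu -> jump_mx j nu' ->
  (1%:M + nu) *m (1%:M + nu') = 1%:M + nu + nu'.
Proof.
by move=> nj nj'; rewrite mulmxDl mulmxDr !mulmx1 mul1mx mulmxDr mulmx1 (jump_mulmx nj nj') addr0 addrAC.
Qed.

Lemma jumpN j nu : jump_mx j nu -> jump_mx j (- nu).
Proof. by move=> nj r c; rewrite mxE oppr_eq0; exact: nj. Qed.

Lemma jump_unit j nu : jump_mx j nu -> 1%:M + nu \in unitmx.
Proof.
move=> nj; have := jump_mulE nj (jumpN nj); rewrite addrK => h.
by case/mulmx1_unit: h.
Qed.

Lemma jump_upper j nu : jump_mx j nu -> upper_mx (1%:M + nu).
Proof.
move=> nj r c; rewrite !mxE; have [-> //|rc] := eqVneq r c.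
by rewrite add0r => /nj/andP[rj jc]; rewrite (leq_trans (ltnW rj)).
Qed.

Lemma degenerate_upper j (b : 'M[F]_p) Y : b \in unitmx -> upper_mx b ->
  degenerate j (Y *m b) -> degenerate j Y.
Proof.
move=> bU bu [v [v0 vj Yv]]; exists (b *m v); split; last by rewrite mulmxA.
  by apply: contra_neq v0 => bv; rewrite -[v](mulKmx bU) bv mulmx0.
move=> r; rewrite mxE => h.
have [c] := sum_neq0 h; rewrite mulf_eq0 negb_or => /andP[/bu rc /vj cj].
exact: leq_ltn_trans cj.
Qed.

Lemma degenerate_le i j Y : (i <= j)%N -> degenerate i Y -> degenerate j Y.
Proof.
move=> ij [v [v0 vi Yv]]; exists v; split=> // r /vi ri; exact: leq_trans ij.
Qed.

Lemma degenerate0 Y : ~ degenerate 0 Y.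
Proof.
move=> [v [v0 vi _]]; case/eqP: v0; apply/colP => r; rewrite mxE.
by apply: contrapT => /eqP /vi.
Qed.

Lemma nondeg_schw2_sub j : schw2_sub (nondeg_sub j).
Proof.
have [S1 S0 SD] := schw2_subT F m p n.
split=> [f []//||c f g [fS fj] [gS gj]]; first by split.
by split=> [|Y Z Yj]; [exact: SD|rewrite fj// gj// scaler0 addr0].
Qed.

(* The element (u - 1) / (chi(u) - 1) of the group algebra, with u = 1 + nu: it acts
   as the identity on functionals that are chi-equivariant under u. *)
Definition twist_step (nu : 'M[F]_p) (f : Phi) : Phi :=
  fun Y Z => (chi nu - 1)^-1 *: (f (Y *m (1%:M + nu)) Z - f Y Z).

Definition twist (l : seq 'M[F]_p) (f : Phi) : Phi := foldr twist_step f l.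

Definition good_jumps j (l : seq 'M[F]_p) :=
  forall nu, nu \in l -> jump_mx j nu /\ chi nu != 1.

Lemma good_jumps_cons j nu l : good_jumps j (nu :: l) ->
  [/\ jump_mx j nu, chi nu != 1 & good_jumps j l].
Proof.
move=> g; have [nj n1] := g nu (mem_head _ _); split=> // nu' nl.
by apply: g; rewrite inE nl orbT.
Qed.

Lemma good_jumps_cat j l l' : good_jumps j l -> good_jumps j l' -> good_jumps j (l ++ l').
Proof. by move=> gl gl' nu; rewrite mem_cat => /orP[/gl|/gl']. Qed.

Lemma twist_cat l l' f : twist (l ++ l') f = twist l (twist l' f).
Proof. by rewrite /twist foldr_cat. Qed.

Lemma twist_step_comm j nu nu' f : jump_mx j nu -> jump_mx j nu' ->
  twist_step nu (twist_step nu' f) = twist_step nu' (twist_step nu f).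
Proof.
move=> nj nj'; apply/funext => Y; apply/funext => Z; rewrite /twist_step.
rewrite -!mulmxA (jump_mulE nj nj') (jump_mulE nj' nj) [1%:M + nu' + nu]addrAC.
have key (a b x y z t : C) : a * (b * (x - y) - b * (z - t)) = b * (a * (x - z) - a * (y - t)).
  by ring.
exact: key.
Qed.

(** Commutation is used twice: to merge the twists that serve different regions, and to compare two
    choices of twist for the same function. *)
Lemma twist_comm j l l' f : good_jumps j l -> good_jumps j l' ->
  twist l (twist l' f) = twist l' (twist l f).
Proof.
move=> gl gl'; elim: l gl => [|nu l IHl] //= /good_jumps_cons[nj _ gl].
rewrite IHl//; elim: l' gl' {IHl} => [|nu' l' IHl'] //= /good_jumps_cons[nj' _ gl'].
by rewrite (twist_step_comm _ nj nj') IHl'.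
Qed.

Lemma twist_linear l c f g : twist l (fun Y Z => c *: f Y Z + g Y Z) =
  fun Y Z => c *: twist l f Y Z + twist l g Y Z.
Proof.
elim: l => [|nu l IHl] //=; rewrite IHl; apply/funext => Y; apply/funext => Z.
rewrite /twist_step.
have key (a c' x y z t : C) : a * (c' * x + y - (c' * z + t)) = c' * (a * (x - z)) + a * (y - t).
  by ring.
exact: key.
Qed.

Definition jump_stable j (T : M -> M' -> Prop) := forall nu Y Z, jump_mx j nu ->
  T Y Z -> T (Y *m (1%:M + nu)) Z.

Lemma twist_vanish j l f (T : M -> M' -> Prop) : good_jumps j l -> jump_stable j T ->
  (forall Y Z, T Y Z -> f Y Z = 0) -> forall Y Z, T Y Z -> twist l f Y Z = 0.
Proof.
move=> gl sT fT; elim: l gl => [|nu l IHl] //= /good_jumps_cons[nj _ gl] Y Z TYZ.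
by rewrite /twist_step !IHl ?subrr ?scaler0//; exact: sT.
Qed.

Lemma degenerate_stable i j : jump_stable j (fun Y _ => degenerate i Y).
Proof.
move=> nu Y Z nj; have nU := jump_unit nj; have := jump_upper (jumpN nj) => nu'.
rewrite -[Y in degenerate i Y -> _](mulmxK nU); apply: degenerate_upper.
  by rewrite unitmx_inv.
have -> // : invmx (1%:M + nu) = 1%:M - nu.
apply: (can_inj (mulKmx nU)); rewrite mulmxV//.
by rewrite (jump_mulE nj (jumpN nj)) addrK.
Qed.

Lemma twist_nondeg i j l f : good_jumps j l -> nondeg_sub i f -> nondeg_sub i (twist l f).
Proof.
move=> gl [fS fi]; split; last exact: (twist_vanish gl (@degenerate_stable i j) fi).
elim: l gl => [|nu l IHl] //= /good_jumps_cons[nj _ /IHl lS].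
have nS : S2 (fun Y Z => twist l f (Y *m (1%:M + nu)) Z).
  have := schw2_mulmx (unitmx1 F m) (jump_unit nj) (unitmx1 F n) (unitmx1 F m) lS.
  by under eq_fun do under eq_fun do rewrite !mul1mx mulmx1.
apply: schw2Z; have := schw2D nS (schw2Z (-1) lS).
by under eq_fun do under eq_fun do rewrite scaleN1r.
Qed.

(** Right multiplication by it keeps the columns of level below j. These are the only columns that a
    vector witnessing degeneracy meets, and jumps at level j leave them unchanged. *)
Definition proj_lt j : 'M[F]_p := diag_mx (\row_c (lv c < j)%:R).

Lemma proj_lt_col j (v : 'cV[F]_p) : (forall r, v r 0 != 0 -> (lv r < j)%N) ->
  proj_lt j *m v = v.
Proof.
move=> vj; apply/colP => r; rewrite mul_diag_mx !mxE.
have [->|/vj->] := eqVneq (v r 0) 0; first by rewrite mulr0.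
by rewrite mul1r.
Qed.

Lemma proj_lt_supp j (v : 'cV[F]_p) r : (proj_lt j *m v) r 0 != 0 -> (lv r < j)%N.
Proof. by rewrite mul_diag_mx !mxE; case: (lv r < j)%N => //; rewrite mul0r eqxx. Qed.

Lemma proj_lt_lat j t (Y : M) : Y \in lat t -> Y *m proj_lt j \in lat t.
Proof.
move=> /latP Yt; apply/latP => r c; rewrite mul_mx_diag !mxE absFM.
by case: (lv c < j)%N; rewrite ?absF1 ?absF0 ?mulr1 ?mulr0 ?absF_ge0.
Qed.

Lemma jump_proj_lt j nu : jump_mx j nu -> nu *m proj_lt j = 0.
Proof.
move=> nj; apply/matrixP => r c; rewrite mul_mx_diag !mxE.
have [->|/nj/andP[_]] := eqVneq (nu r c) 0; first by rewrite mul0r.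
by rewrite leqNgt => /negPf->; rewrite mulr0.
Qed.

Lemma proj_lt_jump j nu (Y : M) : jump_mx j nu ->
  (Y *m (1%:M + nu)) *m proj_lt j = Y *m proj_lt j.
Proof.
by move=> nj; rewrite mulmxDr mulmx1 mulmxDl -mulmxA jump_proj_lt// mulmx0 addr0.
Qed.

Lemma det_jump j nu : jump_mx j nu -> \det (1%:M + nu) = 1.
Proof.
move=> nj; have -> : nu = proj_lt j *m nu.
  apply/matrixP => r c; rewrite mul_diag_mx !mxE.
  have [->|/nj/andP[-> _]] := eqVneq (nu r c) 0; first by rewrite mulr0.
  by rewrite mul1r.
by rewrite det_1DmulC jump_proj_lt// addr0 det1.
Qed.

(* If Y v = 0 with v of top level j, some w in level j + 1 makes chi (v w) <> 1, and
   right translation by 1 + v w fixes Y, so the twist vanishes near Y. *)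
Lemma twist_tube j f (X : M) : (j.+1 < K)%N -> nondeg_sub j f ->
  exists rl : nat * seq 'M[F]_p, good_jumps j.+1 rl.2 /\
    forall Y Z, degenerate j.+1 Y -> Y *m proj_lt j.+1 - X \in lat (unif ^+ rl.1) ->
      twist rl.2 f Y Z = 0.
Proof.
move=> jK [[s [r [fs fr]]] fj]; have frY Y d Z : d \in lat (unif ^+ r) -> f (Y + d) Z = f Y Z.
  by move=> dr; rewrite -[Z in LHS]addr0 fr ?rpred0.
have [[v [v0 vj Xv]]|Xi] := pselect (degenerate j.+1 X).
  have [vtop|vtop] := pselect (exists k, lv k = j /\ v k 0 != 0).
    have [w [wj chi1]] := chi_generic jK vtop; pose nu := v *m w.
    have nj : jump_mx j.+1 nu.
      move=> k c; rewrite mxE big_ord1 mulf_eq0 negb_or => /andP[/vj-> /wj->].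
      by rewrite leqnn.
    have [t nt] := lat_bounded nu.
    exists ((t + r)%N, [:: nu]); split=> [nu'|Y Z _ YX /=].
      by rewrite inE => /eqP->.
    rewrite /twist_step mulmxDr mulmx1 frY ?subrr ?scaler0//.
    have -> : Y *m nu = (Y *m proj_lt j.+1 - X) *m nu.
      by rewrite /nu mulmxBl !mulmxA Xv mul0mx subr0 -(mulmxA Y (proj_lt _)) proj_lt_col.
    by rewrite -(unifVD F t r) mulrC lat_mulmx.
  exists (r, [::]); split=> // Y Z _ YX /=; set d := _ - X in YX.
  rewrite -(subrK d Y) frY//; apply: fj; exists v; split=> // [k vk|].
    have := vj k vk; rewrite ltnS leq_eqVlt => /orP[/eqP kj|//].
    by case: vtop; exists k.
  by rewrite mulmxBl /d mulmxBl -mulmxA proj_lt_col// Xv subr0 subrr.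
(* When X is injective on levels up to j, a partial left inverse G bounds nearby matrices from
   below; then no Y near X is degenerate and the claim is vacuous. *)
have [G GP] : exists G, G *m (X *m proj_lt j.+1) = proj_lt j.+1.
  suff /submxP[G GE] : (proj_lt j.+1 <= X *m proj_lt j.+1)%MS by exists G.
  rewrite submxE; apply/eqP; suff ck k : col k (proj_lt j.+1 *m cokermx (X *m proj_lt j.+1)) = 0.
    by apply/matrixP => r0 k; have /colP/(_ r0) := ck k; rewrite !mxE.
  apply: contrapT => /eqP; rewrite colE -mulmxA => pk0; apply: Xi.
  exists (proj_lt j.+1 *m (cokermx (X *m proj_lt j.+1) *m delta_mx k 0)).
  split=> // [c|]; first exact: proj_lt_supp.
  by rewrite mulmxA [_ *m (cokermx _ *m _)]mulmxA mulmx_coker mul0mx.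
have [t Gt] := lat_bounded G.
exists ((t + 1)%N, [::]); split=> // Y Z [v [v0 vj Yv]] YX.
exfalso; case/eqP: v0; set d := _ - X in YX.
have dv : d *m v = - (X *m v) by rewrite /d mulmxBl -mulmxA proj_lt_col// Yv sub0r.
have Gd : G *m d \in lat (unif ^+ 1) by rewrite -(unifVD F t 1) lat_mulmx.
have GdU : 1%:M + G *m d \in unitmx.
  by apply: GLO_unit; apply: (@GLO_near1 _ _ _ _ 0); rewrite addrC addKr.
rewrite -[v](mulKmx GdU) mulmxDl mul1mx -mulmxA dv mulmxN.
have -> : G *m (X *m v) = v by rewrite -[in LHS](proj_lt_col vj) !mulmxA -(mulmxA G) GP proj_lt_col.
by rewrite subrr mulmx0.
Qed.

(** Compactness leaves finitely many tubes; concatenating their lists works because each twist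
    preserves the vanishing achieved on the other tubes. *)
Lemma twist_exists j f : (j.+1 < K)%N -> nondeg_sub j f ->
  exists l, good_jumps j.+1 l /\ nondeg_sub j.+1 (twist l f).
Proof.
move=> jK fN; have [[s [r fsr]] fj] := fN; have [fs fr] := fsr.
have /choice[g gP] := fun X => twist_tube X jK fN.
have [xs xsP] := lat_cover s (fun X => (g X).1).
have gl ys : good_jumps j.+1 (flatten [seq (g x).2 | x <- ys]).
  elim: ys => [|x ys IHys] //=; apply: good_jumps_cat => //; exact: (gP x).1.
exists (flatten [seq (g x).2 | x <- xs]); split=> //.
have fS : nondeg_sub j (twist (flatten [seq (g x).2 | x <- xs]) f) by exact: twist_nondeg fN.
split; first exact: fS.1.
(* Columns of level above j may be changed by jumps and stay unbounded, so the cover concerns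
   [Y *m proj_lt j.+1] only. Where this part is large f is 0, and remains so under twisting. *)
move=> Y Z Yj; have [Ys|Ys] := boolP (Y *m proj_lt j.+1 \in lat (unif ^- s)); last first.
  apply: (twist_vanish (gl xs) (T := fun Y _ => Y *m proj_lt j.+1 \notin lat (unif ^- s))) => //.
    by move=> nu Y' Z' nj; rewrite proj_lt_jump.
  move=> Y' Z' Ys'; apply: fs; apply/orP; left; apply: contra Ys'; exact: proj_lt_lat.
have [x xxs Yx] := xsP _ Ys.
pose T Y' (Z' : M') := degenerate j.+1 Y' /\ Y' *m proj_lt j.+1 - x \in lat (unif ^+ (g x).1).
have sT : jump_stable j.+1 T.
  move=> nu Y' Z' nj [Yd' Yx']; split; last by rewrite proj_lt_jump.
  exact: (@degenerate_stable j.+1 _ nu Y' Z' nj Yd').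
have TYZ : T Y Z by [].
have gx Y' Z' : T Y' Z' -> twist (g x).2 f Y' Z' = 0 by case; exact: (gP x).2.
(* The list attached to x is commuted to the innermost place, where it kills f on its tube; the
   remaining twists keep the zero since the tube is stable under jumps. *)
elim: xs xxs {xsP fS} Y Z TYZ {Yj Ys Yx} => // y ys IHys.
rewrite inE => /orP[/eqP <-|xys] Y Z TYZ /=; rewrite twist_cat.
  rewrite (twist_comm _ (gP x).1 (gl ys)).
  exact: (twist_vanish (gl ys) sT gx).
exact: (twist_vanish (gP y).1 sT (IHys xys)).
Qed.

Variables (V : rep C (GL F m)) (W : lmodType C) (alpha : R).
(** [Tset] abstracts the pairs of diagonal blocks (b, d) of elements of GL_n^Delta N, and [tau]
    their prescribed action on the target. *)
Variables (Tset : GL F p -> GL F n -> Prop) (tau : GL F p -> GL F n -> {linear W -> W}).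

Definition act_levi (b : GL F p) (d : GL F n) (f : Phi) : Phi := fun Y Z =>
  (abs_det (val b) (m%:R / 2) * abs_det (val d) (- (m%:R / 2))) *:
    f (Y *m val b) (invmx (val d) *m Z).

Definition full_model (S : Phi -> Prop) (B : Phi -> V -> W) :=
  model_functional E alpha S B /\ forall b d, Tset b d ->
    forall f v, S f -> B (act_levi b d f) v = tau b d (B f v).

Hypothesis Tjump : forall j nu (b : GL F p), (j < K)%N -> jump_mx j nu -> val b = 1%:M + nu ->
  Tset b 1%g /\ forall w, tau b 1%g w = chi nu *: w.
Hypothesis Tconj : forall j nu (b : GL F p) d, (j < K)%N -> Tset b d -> jump_mx j nu ->
  jump_mx j (val b *m nu *m invmx (val b)) /\ chi (val b *m nu *m invmx (val b)) = chi nu.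
Hypothesis Tupper : forall (b : GL F p) d, Tset b d -> upper_mx (invmx (val b)).

Lemma twist_act_pt l h f : twist l (act_pt alpha h f) = act_pt alpha h (twist l f).
Proof.
elim: l => [|nu l IHl] //=; rewrite IHl; apply/funext => Y; apply/funext => Z.
rewrite /twist_step /act_pt mulmxA.
have key (a c x y : C) : a * (c * x - c * y) = c * (a * (x - y)) by ring.
exact: key.
Qed.

Lemma twist_act_levi j l b d f : (j < K)%N -> Tset b d -> good_jumps j l ->
  exists2 l', good_jumps j l' & twist l' (act_levi b d f) = act_levi b d (twist l f).
Proof.
move=> jK Tbd; elim: l => [|nu l IHl]; first by exists [::].
case/good_jumps_cons => nj n1 /IHl[l' gl' l'E].
have [cj cchi] := Tconj jK Tbd nj.
exists ((val b *m nu *m invmx (val b)) :: l').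
  by move=> nu'; rewrite inE => /orP[/eqP->|/gl'//]; rewrite cchi.
rewrite /= l'E; apply/funext => Y; apply/funext => Z; rewrite /twist_step /act_levi cchi.
have -> : Y *m (1%:M + val b *m nu *m invmx (val b)) *m val b = Y *m val b *m (1%:M + nu).
  rewrite -!mulmxA; congr (Y *m _).
  by rewrite mulmxDl mul1mx -!mulmxA mulVmx ?(valP b)// mulmx1 mulmxDr mulmx1.
have key (a c x y : C) : a * (c * x - c * y) = c * (a * (x - y)) by ring.
exact: key.
Qed.

Lemma act_pt_nondeg j h f : nondeg_sub j f -> nondeg_sub j (act_pt alpha h f).
Proof.
move=> [fS fj]; split=> [|Y Z [v [v0 vj Yv]]].
  apply: schw2Z; have hU' : invmx (val h) \in unitmx by rewrite unitmx_inv (valP h).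
  have := schw2_mulmx hU' (unitmx1 F p) (unitmx1 F n) (valP h) fS.
  by under eq_fun do under eq_fun do rewrite mulmx1 mul1mx.
by rewrite /act_pt fj ?scaler0//; exists v; split=> //; rewrite -mulmxA Yv mulmx0.
Qed.

Lemma act_levi_schw b d f : S2 f -> S2 (act_levi b d f).
Proof.
move=> fS; apply: schw2Z; have dU' : invmx (val d) \in unitmx by rewrite unitmx_inv (valP d).
have := schw2_mulmx (unitmx1 F m) (valP b) dU' (unitmx1 F m) fS.
by under eq_fun do under eq_fun do rewrite mulmx1 mul1mx.
Qed.

Lemma act_levi_nondeg j b d f : Tset b d -> nondeg_sub j f -> nondeg_sub j (act_levi b d f).
Proof.
move=> Tbd [fS fj]; split=> [|Y Z Yd]; first exact: act_levi_schw.
rewrite /act_levi fj ?scaler0//; apply: (degenerate_upper _ (Tupper Tbd)).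
  by rewrite unitmx_inv (valP b).
by rewrite mulmxK// (valP b).
Qed.

Lemma nondeg_sub_le i j f : (i <= j)%N -> nondeg_sub j f -> nondeg_sub i f.
Proof.
by move=> ij [fS fj]; split=> // Y Z Yi; apply: fj; exact: degenerate_le Yi.
Qed.

(** By equivariance, translating by 1 + nu multiplies B by chi(nu); the normalization of
    [twist_step] turns (chi(nu) - 1) B into B. *)
Lemma full_model_step i j (B : Phi -> V -> W) l f v : (j < K)%N ->
  full_model (nondeg_sub i) B -> good_jumps j l -> nondeg_sub i f ->
  B (twist l f) v = B f v.
Proof.
move=> jK [[B1 _ _ _] BT]; elim: l => [|nu l IHl] // gl fN.
have [nj n1 gl'] := good_jumps_cons gl; rewrite -(IHl gl' fN) /=.
set g := twist l f; have gN : nondeg_sub i g by exact: (twist_nondeg gl' fN).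
pose b : GL F p := Sub (1%:M + nu) (jump_unit nj).
have [Tb tb] := Tjump jK nj (erefl : val b = 1%:M + nu).
have bgN : nondeg_sub i (act_levi b 1%g g) by exact: act_levi_nondeg.
have gE : act_levi b 1%g g = fun Y Z => g (Y *m (1%:M + nu)) Z.
  apply/funext => Y; apply/funext => Z; rewrite /act_levi GL_val1 invmx1 mul1mx abs_det1 mulr1.
  suff -> : abs_det (val b) (m%:R / 2) = 1 by rewrite scale1r.
  by rewrite /abs_det (det_jump nj) absF1 powR1.
have SS := nondeg_schw2_sub i.
have -> : twist_step nu g = fun Y Z => (chi nu - 1)^-1 *: act_levi b 1%g g Y Z +
    (- (chi nu - 1)^-1) *: g Y Z.
  by apply/funext => Y; apply/funext => Z; rewrite gE /twist_step scaleNr scalerBr.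
have lB := B1 v.
have gN' : nondeg_sub i (fun Y Z => (- (chi nu - 1)^-1) *: g Y Z).
  have [_ S0 SD] := SS; have := SD (- (chi nu - 1)^-1) _ _ gN S0.
  by under eq_fun do under eq_fun do rewrite addr0.
rewrite (lB _ _ _ bgN gN') (linear_onZ _ SS lB gN) BT// tb scalerA -scalerDl.
by rewrite -[X in _ - X]mulr1 -mulrBr mulVf ?scale1r// subr_eq0.
Qed.

(** B' evaluates B on any twist of f that is nondegenerate at the next level; commutation and
    [full_model_step] show that the choice of list is irrelevant. Equivariance survives because
    elements of [Tset] conjugate jumps to jumps with the same chi, and the support condition because
    E nu = 0. *)
Lemma full_model_extend j (B : Phi -> V -> W) : (j.+1 < K)%N ->
  full_model (nondeg_sub j.+1) B ->
  exists B', full_model (nondeg_sub j) B' /\ forall f, nondeg_sub j.+1 f -> B' f = B f.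
Proof.
move=> jK mB; have [[B1 B1' B2 B3] BT] := mB.
have /choice[L LP] : forall f, exists l, nondeg_sub j f ->
    good_jumps j.+1 l /\ nondeg_sub j.+1 (twist l f).
  move=> f; have [fN|fN] := pselect (nondeg_sub j f); last by exists [::].
  by have [l lP] := twist_exists jK fN; exists l.
pose B' f := B (twist (L f) f).
have key f l : nondeg_sub j f -> good_jumps j.+1 l -> nondeg_sub j.+1 (twist l f) ->
    B' f = B (twist l f).
  move=> fN gl lN; have [gL LN] := LP f fN; apply/funext => v; rewrite /B'.
  rewrite -(full_model_step v jK mB gl LN) (twist_comm _ gl gL).
  by rewrite (full_model_step v jK mB gL lN).
exists B'; split; last first.
  by move=> f fN; rewrite (key f [::])//; exact: nondeg_sub_le fN.
have join f g : nondeg_sub j f -> nondeg_sub j g -> exists l, [/\ good_jumps j.+1 l,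
    nondeg_sub j.+1 (twist l f) & nondeg_sub j.+1 (twist l g)].
  move=> fN gN; have [gf fL] := LP f fN; have [gg gL] := LP g gN.
  exists (L g ++ L f); split; first exact: good_jumps_cat.
    by rewrite twist_cat; exact: (twist_nondeg gg fL).
  by rewrite twist_cat (twist_comm _ gg gf); exact: (twist_nondeg gf gL).
have SS := nondeg_schw2_sub j.
split; first split.
- move=> v c f g fN gN; have [l [gl fl gl']] := join f g fN gN.
  have [_ _ SD] := SS; have cfg := SD c f g fN gN.
  have [_ _ SD'] := nondeg_schw2_sub j.+1.
  rewrite (key f l)// (key g l)// (key _ l)// twist_linear; first exact: (B1 v).
  exact: SD'.
- by move=> f fN; have [gL LN] := LP f fN; exact: B1'.
- move=> v f fN f0; have [gL LN] := LP f fN; apply: (B2 v) => // Y Z ZY.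
  apply: (twist_vanish gL (T := fun Y Z => Z *m Y = E)) => // nu Y' Z' nj ZY'.
  by rewrite mulmxA ZY' mulmxDr mulmx1 (EJ jK nj) addr0.
- move=> h f v fN; have [gL LN] := LP f fN.
  have aN := act_pt_nondeg h fN.
  have aL : nondeg_sub j.+1 (twist (L f) (act_pt alpha h f)).
    by rewrite twist_act_pt; exact: act_pt_nondeg.
  by rewrite (key _ _ aN gL aL) twist_act_pt; exact: B3.
move=> b d Tbd f v fN; have [gL LN] := LP f fN.
have [l' gl' l'E] := twist_act_levi f jK Tbd gL.
have aN := act_levi_nondeg Tbd fN.
have aL : nondeg_sub j.+1 (twist l' (act_levi b d f)).
  by rewrite l'E; exact: act_levi_nondeg.
by rewrite (key _ _ aN gl' aL) l'E; exact: BT.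
Qed.

End Extension.

(** * From a base value to an equivariant functional *)

Section Existence.
Variables (R : realType) (F : nonArchLocalFieldType R) (m p n : nat).
Local Notation C := R[i].
Local Notation unif := (unif F).
Local Notation M := 'M[F]_(m, p).
Local Notation M' := 'M[F]_(n, m).
Local Notation Phi := (M -> M' -> C^o).
Local Notation S2 := (@schw2 R F m p n m C^o).
Variables (P : 'M[F]_(p, m)) (Q : 'M[F]_(n, m)) (E : 'M[F]_(n, p)).
Hypotheses (PQ : row_splitting P Q) (PQE : integral_splitting P Q E).
Variables (lv : 'I_p -> nat) (K : nat) (V : rep C (GL F m)) (W : lmodType C) (alpha : R).
Variables (Tset : GL F p -> GL F n -> Prop) (tau : GL F p -> GL F n -> {linear W -> W}).
Hypothesis smoothV : forall v : V, exists r, fixed_by r v.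
Hypothesis mE : m = (p + n)%N.
Hypothesis alphaE : alpha = n%:R - m%:R / 2.
Hypothesis TE : forall (b : GL F p) (d : GL F n), Tset b d -> val d *m E = E *m val b.
Hypothesis Etop : forall v : 'cV[F]_p, E *m v = 0 -> forall r, (lv r).+1 = K -> v r 0 = 0.
Hypothesis lvK : forall r, (lv r < K)%N.

Let PP : P *m P^T = 1%:M. Proof. by case: PQ. Qed.
Let PQ0 : P *m Q^T = 0. Proof. by case: PQ. Qed.
Let PQ1 : P^T *m P + Q^T *m Q = 1%:M. Proof. by case: PQ. Qed.
Let EE : E *m E^T = 1%:M. Proof. by case: PQE. Qed.
Let P1 : P \in lat 1. Proof. by case: PQE. Qed.
Let E1 : E \in lat 1. Proof. by case: PQE. Qed.

(** Equivariance under GL_n^Delta' H split into two parts: the stabilizer of the base point in GL_m,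
    and the block elements that move it only together with (b, d). *)
Definition base_equivariant (ell : V -> W) :=
  [/\ linear ell,
      forall (k : GL F m) z g v, val k = blockU P Q 1%:M z g -> E *m z = 0 ->
        ell (act V k v) = abs_det (val k) alpha *: ell v &
      forall b d (k : GL F m) v, Tset b d -> val k = blockU P Q (val b) 0 1%:M ->
        ell (act V k v) = abs_det (val d) (- alpha) *: tau b d (ell v)].

Variable ell : V -> W.
Hypothesis ellP : base_equivariant ell.

Definition at_base (Y : M) (Z : M') (h : GL F m) := val h *m P^T = Y /\ Z *m val h = E *m P.

(** The integrand at the point h . base, with an arbitrary choice of h; the default 0 is taken where
    no h exists, in particular at non-injective Y. *)
Definition orbit_value (Y : M) (Z : M') (v : V) : W :=
  if pselect (exists h, at_base Y Z h) is left e
  then abs_det (val (projT1 (cid e))) alpha *: ell (act V (projT1 (cid e))^-1%g v) else 0.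

(** Two choices of h differ by an element of the base stabilizer. It has the form [blockU 1%:M z g]
    with E z = 0, exactly the shape in the second clause of [base_equivariant]. *)
Lemma orbit_valueE h Y Z v : at_base Y Z h ->
  orbit_value Y Z v = abs_det (val h) alpha *: ell (act V h^-1%g v).
Proof.
move=> hYZ; rewrite /orbit_value; case: pselect => [e|[]]; last by exists h.
case: cid => h1 [/= h1Y h1Z]; have [hY hZ] := hYZ; have [_ L2 _] := ellP.
have [k [kE kh]] : exists k : GL F m,
    val k = invmx (val h1) *m val h /\ (k * h^-1)%g = (h1^-1)%g.
  by exists (h1^-1 * h)%g; rewrite -mulgA mulgV mulg1.
have kP : val k *m P^T = P^T by rewrite kE -mulmxA hY -h1Y mulKmx// (valP h1).
have Pk : E *m P *m val k = E *m P.
  by rewrite kE -h1Z mulmxA mulmxK ?(valP h1)// h1Z hZ.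
have kU : val k = blockU P Q 1%:M (P *m val k *m Q^T) (Q *m val k *m Q^T).
  rewrite /blockU mulmx1 !mulmxA -addrA -!mulmxDl PQ1 mul1mx.
  by rewrite -[LHS]mulmx1 -PQ1 mulmxDr !mulmxA kP.
have Ez : E *m (P *m val k *m Q^T) = 0 by rewrite !mulmxA Pk -mulmxA PQ0 mulmx0.
have := L2 k _ _ (act V h^-1%g v) kU Ez; rewrite -actM.
rewrite kh => ->; rewrite scalerA kE abs_detM abs_detV ?(valP h1)// mulrA.
by rewrite mulfV ?mul1r// abs_det_neq0// (valP h1).
Qed.

Lemma orbit_value_linear Y Z : linear (orbit_value Y Z).
Proof.
move=> c u v; rewrite /orbit_value; case: pselect => [e|_]; last by rewrite scaler0 addr0.
have [L1 _ _] := ellP.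
by rewrite linearP L1 scalerDr !scalerA mulrC.
Qed.

Lemma orbit_exists Y Z : inj_mx Y -> Z *m Y = E -> exists h, at_base Y Z h.
Proof.
move=> Yi ZY; have [h hU hP] := fiber_transitive PQ PQE Yi ZY.
by exists (Sub h hU).
Qed.

(** On the fiber, Y v = 0 forces E v = 0, so the top level of v vanishes. This is why level [K.-1]
    already captures every non-injective Y. *)
Lemma noninj_degenerate (Y : M) (Z : M') : Z *m Y = E -> ~ inj_mx Y ->
  degenerate lv K.-1 Y.
Proof.
move=> ZY Yi; apply: contrapT => nd; apply: Yi => v Yv; apply: contrapT => /eqP v0.
apply: nd; exists v; split=> // r vr.
have Ev : E *m v = 0 by rewrite -ZY -mulmxA Yv mulmx0.
have := lvK r; case: (K) (Etop Ev) => // k top; rewrite ltnS leq_eqVlt /= => /orP[/eqP rk|//].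
by move: vr; rewrite top ?eqxx// rk.
Qed.

(** Near a non-injective fiber point f vanishes. Near an injective one, [fiber_section] reaches
    neighbouring points by h k with k so close to 1 that it fixes h^-1 v, so the integrand is
    locally constant. *)
Lemma fiber_schw_orbit f v : nondeg_sub lv K.-1 f ->
  fiber_schw E (fun Y Z => f Y Z *: orbit_value Y Z v).
Proof.
move=> [[s [r [fs fr]]] fd]; apply: (@fiber_schwP _ _ _ _ _ _ _ _ s) => [Y Z YZ|Y Z].
  by rewrite fs// scale0r.
have frY Y1 Z1 : Y1 - Y \in lat (unif ^+ r) -> Z1 - Z \in lat (unif ^+ r) -> f Y1 Z1 = f Y Z.
  by move=> Yr Zr; rewrite -(subrK Y Y1) -(subrK Z Z1) addrC [_ + Z]addrC fr.
have [ZY|/fiber_closed[r0 r0P]] := pselect (Z *m Y = E); last first.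
  by exists r0 => Y1 Z1 Y2 Z2 ZY1 _ Yr Zr; case: (r0P Y1 Z1).
have [Yi|Yi] := pselect (inj_mx Y); last first.
  exists r => Y1 Z1 Y2 Z2 _ _ Y1r Z1r Y2r Z2r; rewrite !frY//.
  by rewrite (fd _ _ (noninj_degenerate ZY Yi)) !scale0r.
have [h [hY hZ]] := orbit_exists Yi ZY; pose u := act V h^-1%g v.
have hU := valP h.
have [s1 ihs] := lat_bounded (invmx (val h)); have [s2 hs] := lat_bounded (val h).
pose t := maxn s1 s2; pose l := level smoothV u.
have ihs' : invmx (val h) \in lat (unif ^- t) by apply: lat_unifV ihs; rewrite leq_maxl.
have hs' : val h \in lat (unif ^- t) by apply: lat_unifV hs; rewrite leq_maxr.
have lE : unif ^+ l = unif ^- t * unif ^+ (t + l) by rewrite unifVD.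
have near Y1 Z1 : Z1 *m Y1 = E -> Y1 - Y \in lat (unif ^+ (t + l)) ->
    Z1 - Z \in lat (unif ^+ (t + l)) ->
    orbit_value Y1 Z1 v = abs_det (val h) alpha *: ell u.
  move=> ZY1 Yr Zr.
  have Yr' : invmx (val h) *m Y1 - P^T \in lat (unif ^+ l).
    have -> : invmx (val h) *m Y1 - P^T = invmx (val h) *m (Y1 - Y).
      by rewrite mulmxBr -hY mulKmx.
    by rewrite lE lat_mulmx.
  have Zr' : Z1 *m val h - E *m P \in lat (unif ^+ l).
    by rewrite -hZ -mulmxBl lE mulrC lat_mulmx.
  have ZY' : Z1 *m val h *m (invmx (val h) *m Y1) = E by rewrite mulmxA mulmxK.
  have [k [kl kY kZ]] := fiber_section PQ PQE ZY' Yr' Zr'.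
  have l0 : (0 < l)%N by exact: level_gt0.
  have kO : k \in @GLO _ F m by apply: (@GLO_near1 _ _ _ _ l.-1); rewrite prednK.
  pose kG : GL F m := Sub k (GLO_unit kO).
  have hk : at_base Y1 Z1 (h * kG)%g.
    by split; [rewrite GL_valM -mulmxA kY mulKVmx|rewrite GL_valM mulmxA].
  rewrite (orbit_valueE _ hk) GL_valM abs_detM (abs_det_GLO _ kO) mulr1 invgM actM.
  have kl' : val (kG^-1)%g - 1%:M \in lat (unif ^+ l).
    by have := @GLO_near1V _ _ _ k l.-1; rewrite prednK//; apply.
  by rewrite (level_fixed kl').
exists (maxn r (t + l)) => Y1 Z1 Y2 Z2 ZY1 ZY2 Y1r Z1r Y2r Z2r.
have le1 : (r <= maxn r (t + l))%N by rewrite leq_maxl.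
have le2 : (t + l <= maxn r (t + l))%N by rewrite leq_maxr.
rewrite !frY; try by apply: (lat_unifX le1).
by rewrite !near//; apply: (lat_unifX le2).
Qed.

Definition orbit_integral (f : Phi) (v : V) : W :=
  xint E (fun Y Z => f Y Z *: orbit_value Y Z v).

Lemma xintZ c (f : M -> M' -> W) : fiber_schw E f ->
  xint E (fun Y Z => c *: f Y Z) = c *: xint E f.
Proof. exact: (xint_linear EE E1 ( *:%R c)). Qed.

Lemma fiber_schwZ c (f : M -> M' -> W) : fiber_schw E f -> fiber_schw E (fun Y Z => c *: f Y Z).
Proof. by move=> [g gS gf]; exists (fun Y Z => c *: g Y Z) => [|Y Z /gf->]//; exact: schw2Z. Qed.

Lemma fiber_schw_mulmx (f : M -> M' -> W) (h : 'M[F]_m) (b : 'M[F]_p) (d : 'M[F]_n) :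
  h \in unitmx -> b \in unitmx -> d \in unitmx -> d *m E = E *m b -> fiber_schw E f ->
  fiber_schw E (fun Y Z => f (invmx h *m Y *m b) (invmx d *m Z *m h)).
Proof.
move=> hU bU dU dE [g gS gf].
exists (fun Y Z => g (invmx h *m Y *m b) (invmx d *m Z *m h)).
  by apply: schw2_mulmx; rewrite // ?unitmx_inv.
move=> Y Z ZY; apply: gf; rewrite mulmxA -!mulmxA mulKVmx// [Z *m (Y *m b)]mulmxA ZY -dE.
by rewrite mulKmx.
Qed.

Hypothesis Tupper : forall (b : GL F p) d, Tset b d -> upper_mx lv (invmx (val b)).

Lemma alpha_eq : alpha = m%:R / 2 - p%:R.
Proof.
by rewrite alphaE mE natrD; field.
Qed.

(** For h, the action and the change of [orbit_value] give |det h|^(2 alpha), cancelled by |det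
    h|^(p-n) from the fiber measure. For (b, d), the powers of |det b| and |det d| from the Weil
    action, ell and the fiber measure cancel separately. *)
Lemma orbit_integral_model : full_model E alpha Tset tau (nondeg_sub lv K.-1) orbit_integral.
Proof.
have hU (h : GL F m) := valP h.
split; first split.
- move=> v c f g fN gN; have fF := fiber_schw_orbit v fN; have gF := fiber_schw_orbit v gN.
  rewrite /orbit_integral -xintZ// -xintD//; last exact: fiber_schwZ.
  by congr xint; apply/funext => Y; apply/funext => Z; rewrite scalerDl scalerA.
- move=> f fN c u v; have uF := fiber_schw_orbit u fN; have vF := fiber_schw_orbit v fN.
  rewrite /orbit_integral -xintZ// -xintD//; last exact: fiber_schwZ.
  congr xint; apply/funext => Y; apply/funext => Z.
  by rewrite orbit_value_linear scalerDr !scalerA mulrC.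
- move=> v f fN f0; rewrite /orbit_integral (xintE EE E1 (@schw2_0 R F m p n m W)) => [|Y Z ZY].
    by rewrite (fiber_integral_eq0 EE E1)//; exact: schw2_0.
  by rewrite f0// scale0r.
- move=> h f v fN; rewrite /orbit_integral.
  have fF := fiber_schw_orbit v fN.
  have e Y Z : Z *m Y = E -> act_pt alpha h f Y Z *: orbit_value Y Z (act V h v) =
      (abs_det (val h) alpha * abs_det (val h) alpha) *:
      (f (invmx (val h) *m Y *m 1%:M) (invmx 1%:M *m Z *m val h) *:
       orbit_value (invmx (val h) *m Y *m 1%:M) (invmx 1%:M *m Z *m val h) v).
    rewrite /act_pt mulmx1 invmx1 mul1mx => ZY.
    have ZY' : Z *m val h *m (invmx (val h) *m Y) = E by rewrite mulmxA mulmxK.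
    have [Yi|Yi] := pselect (inj_mx (invmx (val h) *m Y)); last first.
      rewrite fN.2; last exact: noninj_degenerate ZY' Yi.
      by rewrite scaler0 !scale0r scaler0.
    have [k [kY kZ]] := orbit_exists Yi ZY'.
    have hk : at_base Y Z (h * k)%g.
      by split; [rewrite GL_valM -mulmxA kY mulKVmx|rewrite GL_valM mulmxA].
    rewrite (orbit_valueE _ hk) (orbit_valueE _ (conj kY kZ)) GL_valM abs_detM invgM.
    rewrite actM -[act V h^-1%g _]actM mulVg act1 !scalerA; congr (_ *: _).
    have key (a x b : C) : a * x * (a * b) = a * a * x * b by ring.
    exact: key.
  have fF' := fiber_schw_mulmx (hU h) (unitmx1 _ _) (unitmx1 _ _)
    (etrans (mul1mx _) (esym (mulmx1 _))) fF.
  rewrite (xint_ext EE E1 e (fiber_schwZ _ fF')) (xintZ _ fF').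
  rewrite (xint_mulmx EE E1 (hU h) (unitmx1 _ _) (unitmx1 _ _) _ fF); last first.
    by rewrite mul1mx mulmx1.
  rewrite !det1 !vol1 !mulr1 scalerA -[RHS]scale1r; congr (_ *: _).
  rewrite !abs_det_vol -(abs_detNr _ (hU h)) -!abs_detD// -(abs_det_0 (val h)).
  by congr abs_det; rewrite {1}alphaE alpha_eq; ring.
move=> b d Tbd f v fN; rewrite /orbit_integral.
have fF := fiber_schw_orbit v fN; have [_ _ L3] := ellP.
have bU := valP b; have dU := valP d; have dE := TE Tbd.
have fF' := fiber_schw_mulmx (unitmx1 _ _) bU dU dE fF.
have e Y Z : Z *m Y = E -> act_levi b d f Y Z *: orbit_value Y Z v =
    (abs_det (val b) (m%:R / 2) * abs_det (val d) (- (m%:R / 2)) *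
     (abs_det (val b) (- alpha) * abs_det (val d) (- alpha))) *:
    tau b d (f (invmx 1%:M *m Y *m val b) (invmx (val d) *m Z *m 1%:M) *:
      orbit_value (invmx 1%:M *m Y *m val b) (invmx (val d) *m Z *m 1%:M) v).
  rewrite /act_levi mulmx1 invmx1 mul1mx => ZY.
  have ZY' : invmx (val d) *m Z *m (Y *m val b) = E.
    by rewrite mulmxA -(mulmxA _ Z) ZY -mulmxA -dE mulKmx.
  have [Yi|Yi] := pselect (inj_mx Y); last first.
    have fd := noninj_degenerate ZY Yi; have [_ fN'] := act_levi_nondeg Tupper Tbd fN.
    have := fN' _ Z fd; rewrite /act_levi => ->; rewrite scale0r.
    have := fN' _ Z fd; rewrite /act_levi => /eqP; rewrite scaler_eq0.
    rewrite mulf_eq0 (negPf (abs_det_neq0 (m%:R / 2) bU)).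
    rewrite (negPf (abs_det_neq0 (- (m%:R / 2)) dU)) /= => /eqP->.
    by rewrite scale0r linear0 scaler0.
  have [h [hY hZ]] := orbit_exists Yi ZY.
  have [k kE] : exists k : GL F m, val k = blockU P Q (val b) 0 1%:M.
    have kU : blockU P Q (val b) 0 1%:M \in unitmx.
      by rewrite unitmxE (det_blockU_diag PQ) -unitmxE.
    by exists (Sub (blockU P Q (val b) 0 1%:M) kU).
  have kd : \det (val k) = \det (val b) by rewrite kE (det_blockU_diag PQ).
  have hk : at_base (Y *m val b) (invmx (val d) *m Z) (h * k)%g.
    split; rewrite GL_valM kE.
      by rewrite -mulmxA (blockU_P PQ) mulmxA hY.
    rewrite mulmxA -(mulmxA _ Z) hZ -!mulmxA (P_blockU PQ) mul0mx addr0.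
    by rewrite (mulmxA E) -dE -mulmxA mulKmx.
  have := L3 b d k (act V (h * k)^-1%g v) Tbd kE.
  rewrite -actM invgM mulgA mulgV mul1g => Lh.
  rewrite (orbit_valueE _ (conj hY hZ)) (orbit_valueE _ hk) Lh invgM GL_valM abs_detM.
  rewrite (abs_det_eq alpha kd) 2!(linearZ_LR (tau b d)) !scalerA; congr (_ *: _).
  rewrite !(abs_detNr alpha)//.
  have b0 := abs_det_neq0 alpha bU; have d0 := abs_det_neq0 alpha dU.
  move: (abs_det (val b) alpha) (abs_det (val d) alpha) (abs_det (val h) alpha) b0 d0.
  move: (abs_det _ _) (abs_det _ _) => a1 a2 a3 a4 a5 a3n a4n.
  have key (x : C) : a2 * a1 * x * (a5 * a4^-1) =
      a2 * a1 * (a3^-1 * a4^-1) * (x * (a5 * a3)).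
    by field; rewrite a3n a4n.
  exact: key.
have tF' : fiber_schw E (fun Y Z => tau b d
    (f (invmx 1%:M *m Y *m val b) (invmx (val d) *m Z *m 1%:M) *:
      orbit_value (invmx 1%:M *m Y *m val b) (invmx (val d) *m Z *m 1%:M) v)).
  have [g gS gf] := fF'; exists (fun Y Z => tau b d (g Y Z)) => [|Y Z ZY]; last by rewrite gf.
  by apply: schw2_comp => //; exact: linear0.
rewrite (xint_ext EE E1 e (fiber_schwZ _ tF')) (xintZ _ tF') (xint_linear EE E1 (tau b d) fF').
rewrite (xint_mulmx EE E1 (unitmx1 _ _) bU dU dE fF) (linearZ_LR (tau b d)) scalerA -[RHS]scale1r.
congr (_ *: _); rewrite !det1 !vol1 !mul1r !abs_det_vol.
rewrite invfM -!(abs_detNr _ bU) -!(abs_detNr _ dU).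
have key (x1 y1 x2 y2 y3 x3 y4 x4 : C) : x1 * y1 * (x2 * y2) * (y3 * x3 * (y4 * x4)) =
   (x1 * x2 * x3 * x4) * (y1 * y2 * y3 * y4) by ring.
rewrite key -!abs_detD//.
transitivity (abs_det (val b) 0 * abs_det (val d) 0); last by rewrite !abs_det_0 mulr1.
congr (_ * _); congr abs_det; first by rewrite alphaE; field.
by rewrite alpha_eq; field.
Qed.

Lemma base_ind_nondeg N : nondeg_sub lv K.-1 (@base_ind R F m p n P E N.+1).
Proof.
split=> [|Y Z [v [v0 _ Yv]]]; first exact: (base_ind_schw PQE).
apply: contrapT => /eqP /(base_ind_near (leqnn _))[YN _]; case/eqP: v0.
exact: (near_base_inj PQ PQE YN).
Qed.

(** Each fiber point in this ball is k . base with k so close to 1 that it fixes v and has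
    determinant of absolute value 1, so the integrand is the constant vector ell v. *)
Lemma orbit_integral_base N v : fixed_by N.+1 v ->
  orbit_integral (base_ind P E N.+1) v = fiber_integral E (base_ind P E N.+1) *: ell v.
Proof.
move=> vN; rewrite /orbit_integral; set f := base_ind P E N.+1.
have lw : linear (fun c : C^o => c *: ell v : W) by move=> c x y; rewrite scalerDl scalerA.
pose T : {linear C^o -> W} := HB.pack (fun c : C^o => c *: ell v : W)
  (GRing.isLinear.Build C C^o W *:%R (fun c : C^o => c *: ell v : W) lw).
have fF : fiber_schw E f by exists f => //; exact: (base_ind_schw PQE).
have TF : fiber_schw E (fun Y Z => T (f Y Z)).
  by exists (fun Y Z => T (f Y Z)) => //; apply: schw2_comp; [exact: linear0|exact: (base_ind_schw PQE)].
have e Y Z : Z *m Y = E -> f Y Z *: orbit_value Y Z v = T (f Y Z).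
  move=> ZY; rewrite /T /=; have [->|fYZ] := eqVneq (f Y Z) 0; first by rewrite !scale0r.
  congr (_ *: _); have [YN ZN] := base_ind_near (leqnn _) fYZ.
  have [k [kN kY kZ]] := fiber_section PQ PQE ZY YN ZN.
  have kO : k \in @GLO _ F m by exact: GLO_near1 kN.
  pose kG : GL F m := Sub k (GLO_unit kO).
  rewrite (@orbit_valueE kG)// (abs_det_GLO _ kO) scale1r vN//.
  exact: GLO_near1V.
rewrite (xint_ext EE E1 e TF) (xint_linear EE E1 T fF).
by rewrite (xintE EE E1 (base_ind_schw PQE N.+1)).
Qed.

Variable chi : 'M[F]_p -> C.
Hypothesis K0 : (0 < K)%N.
Hypothesis chi_generic : forall j (v : 'cV[F]_p), (j.+1 < K)%N ->
  (exists r, lv r = j /\ v r 0 != 0) ->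
  exists w : 'rV[F]_p, (forall c, w 0 c != 0 -> lv c = j.+1) /\ chi (v *m w) != 1.
Hypothesis EJ : forall j nu, (j < K)%N -> jump_mx lv j nu -> E *m nu = 0.
Hypothesis Tjump : forall j nu (b : GL F p), (j < K)%N -> jump_mx lv j nu -> val b = 1%:M + nu ->
  Tset b 1%g /\ forall w, tau b 1%g w = chi nu *: w.
Hypothesis Tconj : forall j nu (b : GL F p) d, (j < K)%N -> Tset b d -> jump_mx lv j nu ->
  jump_mx lv j (val b *m nu *m invmx (val b)) /\ chi (val b *m nu *m invmx (val b)) = chi nu.

Lemma exists_model : exists B, full_model E alpha Tset tau S2 B /\
  forall v, base_value P E smoothV B v = ell v.
Proof.
have ext i : (i <= K.-1)%N -> exists B, full_model E alpha Tset tau (nondeg_sub lv (K.-1 - i)) B /\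
    forall f, nondeg_sub lv K.-1 f -> B f = orbit_integral f.
  elim: i => [_|i IHi iK].
    by exists orbit_integral; rewrite subn0; split=> //; exact: orbit_integral_model.
  have [B [mB Bf]] := IHi (ltnW iK).
  have Ki : (K.-1 - i = (K.-1 - i.+1).+1)%N by rewrite subnSK.
  have iK' : ((K.-1 - i.+1).+1 < K)%N.
    by rewrite -Ki -(prednK K0) ltnS leq_subr.
  rewrite Ki in mB.
  have [B' [mB' B'f]] := full_model_extend chi_generic EJ Tjump Tconj Tupper iK' mB.
  exists B'; split=> // f fN; rewrite -Bf// B'f//.
  by apply: nondeg_sub_le fN; rewrite -Ki leq_subr.
have [B [mB Bf]] := ext K.-1 (leqnn _); rewrite subnn in mB.
have N0 f : S2 f -> nondeg_sub lv 0 f by move=> fS; split=> // Y Z /degenerate0.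
exists B; split.
  have [[B1 B1' B2 B3] BT] := mB; split; first split.
  - by move=> v c f g /N0 fN /N0 gN; exact: B1.
  - by move=> f /N0; exact: B1'.
  - by move=> v f /N0; exact: B2.
  - by move=> h f v /N0; exact: B3.
  by move=> b d Tbd f v /N0; exact: BT.
move=> v; rewrite /base_value.
have l0 := level_gt0 smoothV v; rewrite -(prednK l0) Bf; last exact: base_ind_nondeg.
rewrite orbit_integral_base ?prednK//; last exact: level_fixed.
by rewrite scalerA mulVf ?scale1r//; exact: (mu_base PQ PQE).
Qed.

Lemma full_model_restrict j (B : Phi -> V -> W) : full_model E alpha Tset tau S2 B ->
  full_model E alpha Tset tau (nondeg_sub lv j) B.
Proof.
move=> [[B1 B1' B2 B3] BT]; split; first split.
- by move=> v c f g [fS _] [gS _]; exact: B1.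
- by move=> f [fS _]; exact: B1'.
- by move=> v f [fS _]; exact: B2.
- by move=> h f v [fS _]; exact: B3.
by move=> b d Tbd f v [fS _]; exact: BT.
Qed.

(** The same descent gives uniqueness: twisting does not change B and carries f to level [K.-1],
    where [base_value_eq0] applies. *)
Lemma full_model_eq0 (B : Phi -> V -> W) : full_model E alpha Tset tau S2 B ->
  (forall v, base_value P E smoothV B v = 0) -> forall f v, S2 f -> B f v = 0.
Proof.
move=> mB B0; have claim i f v : (i <= K.-1)%N -> nondeg_sub lv (K.-1 - i) f -> B f v = 0.
  elim: i f v => [|i IHi] f v iK.
    rewrite subn0 => -[fS fd]; apply: (base_value_eq0 PQ PQE mB.1 B0 v fS) => Y Z ZY Yi.
    exact: fd (noninj_degenerate ZY Yi).
  have Ki : (K.-1 - i = (K.-1 - i.+1).+1)%N by rewrite subnSK.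
  have iK' : ((K.-1 - i.+1).+1 < K)%N.
    by rewrite -Ki -(prednK K0) ltnS leq_subr.
  move=> fN; have [l [gl lN]] := twist_exists chi_generic iK' fN.
  rewrite -(full_model_step Tjump Tupper v iK' (full_model_restrict _ mB) gl fN).
  by apply: IHi (ltnW iK) _; rewrite Ki.
move=> f v fS; apply: (claim K.-1) => //; rewrite subnn.
by split=> // Y Z /degenerate0.
Qed.

End Existence.

(** * Equivariance of the base value *)

Section BaseEquivariance.
Variables (R : realType) (F : nonArchLocalFieldType R) (m p n : nat).
Local Notation C := R[i].
Local Notation S2 := (@schw2 R F m p n m C^o).
Variables (P : 'M[F]_(p, m)) (Q : 'M[F]_(n, m)) (E : 'M[F]_(n, p)).
Hypotheses (PQ : row_splitting P Q) (PQE : integral_splitting P Q E).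
Variables (V : rep C (GL F m)) (W : lmodType C) (alpha : R).
Variables (Tset : GL F p -> GL F n -> Prop) (tau : GL F p -> GL F n -> {linear W -> W}).
Hypothesis smoothV : forall v : V, exists r, fixed_by r v.
Hypothesis mE : m = (p + n)%N.
Hypothesis alphaE : alpha = n%:R - m%:R / 2.
Hypothesis TE : forall (b : GL F p) (d : GL F n), Tset b d -> val d *m E = E *m val b.

(** For the stabilizer, [base_value_equiv] gives the exponent alpha + p - n = -alpha on the
    left-hand side, hence alpha once moved across. For (b, d) the powers of |det b| cancel and |det
    d|^alpha remains. *)
Lemma base_value_equivariant (B : ('M[F]_(m, p) -> 'M[F]_(n, m) -> C^o) -> V -> W) :
  full_model E alpha Tset tau S2 B ->
  base_equivariant P Q E alpha Tset tau (base_value P E smoothV B).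
Proof.
move=> [mB BT]; have [B1 B1' B2 B3] := mB; have [PP QQ PQ0 PQ1] := PQ.
split.
- exact: (base_value_linear PQ PQE smoothV mB).
- move=> h z g v hE Ez; have hU := valP h.
  have := base_value_equiv PQ PQE smoothV mB (h := h) (b := 1%:M) (d := 1%:M) (T := idfun)
    (kappa := abs_det (val h) alpha) (v := v) (unitmx1 _ _) (unitmx1 _ _).
  rewrite mul1mx !mulmx1 !det1 !vol1 !mulr1 hE (blockU_P PQ) mulmx1 -mulmxA (P_blockU PQ).
  rewrite mul1mx mulmxDr mulmxA Ez mul0mx addr0 -hE.
  move=> /(_ erefl erefl erefl) e.
  rewrite -[base_value P E smoothV B v]/(idfun (base_value P E smoothV B v)).
  rewrite -e => [|f fS]; last first.
    rewrite -(B3 h f v fS); congr (B _ _); apply/funext => Y; apply/funext => Z.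
    by rewrite /act_pt mulmx1 invmx1 mul1mx.
  rewrite scalerA -[LHS]scale1r; congr (_ *: _).
  rewrite !abs_det_vol -(abs_detNr _ hU) -!abs_detD// -(abs_det_0 (val h)).
  by congr abs_det; rewrite alphaE mE natrD; field.
move=> b d h v Tbd hE; have hU := valP h; have bU := valP b; have dU := valP d.
have dE := TE Tbd; have hd : \det (val h) = \det (val b) by rewrite hE (det_blockU_diag PQ).
pose kappa := abs_det (val b) (m%:R / 2) * abs_det (val d) (- (m%:R / 2)) *
  abs_det (val b) alpha.
have := base_value_equiv PQ PQE smoothV mB (h := h) (T := tau b d)
    (kappa := kappa) (v := v) bU dU dE.
rewrite {1 2}hE (blockU_P PQ) -!mulmxA (P_blockU PQ) mul0mx addr0 !mulmxA dE.
move=> /(_ erefl erefl) e; rewrite -e => [|f fS]; last first.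
  have aS : S2 (act_pt alpha h f).
    apply: schw2Z; have hU' : invmx (val h) \in unitmx by rewrite unitmx_inv.
    have := schw2_mulmx hU' (unitmx1 F p) (unitmx1 F n) hU fS.
    by under eq_fun do under eq_fun do rewrite mulmx1 mul1mx.
  rewrite -(B3 h f v fS) -(BT b d Tbd _ _ aS); congr (B _ _).
  apply/funext => Y; apply/funext => Z; rewrite /act_levi /act_pt scalerA /kappa.
  by rewrite (abs_det_eq alpha hd) !mulmxA.
rewrite scalerA -[LHS]scale1r; congr (_ *: _).
rewrite hd !abs_det_vol !invfM -!(abs_detNr _ bU) -!(abs_detNr _ dU) /kappa.
have key (y1 x1 y2 x2 x3 y3 x4 x5 y4 x6 : C) :
    y1 * (x1 * y2 * x2 * (x3 * y3 * x4 * (x5 * y4 * x6))) =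
    (x1 * x2 * x3 * x4 * x5 * x6) * (y1 * y2 * y3 * y4) by ring.
rewrite key -!abs_detD//.
transitivity (abs_det (val b) 0 * abs_det (val d) 0); first by rewrite !abs_det_0 mulr1.
by congr (_ * _); congr abs_det; rewrite alphaE mE natrD; field.
Qed.

End BaseEquivariance.

(** * Partial Fourier transform of the Weil representation *)

Section PartialFourier.
Variables (R : realType) (F : nonArchLocalFieldType R) (m p n : nat).
Local Notation C := R[i].
Local Notation unif := (unif F).
Local Notation S2 := (@schw2 R F m p n m C^o).
Variables (psi : F -> C) (delta : F) (P : 'M[F]_(p, m)) (Q : 'M[F]_(n, m)).
Hypotheses (psiP : char_conductor psi delta) (PQ : row_splitting P Q).
Hypotheses (PL : P \in lat 1) (QL : Q \in lat 1).

Let PP : P *m P^T = 1%:M. Proof. by case: PQ. Qed.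
Let QQ : Q *m Q^T = 1%:M. Proof. by case: PQ. Qed.
Let PQ0 : P *m Q^T = 0. Proof. by case: PQ. Qed.
Let QP0 : Q *m P^T = 0. Proof. by rewrite -[Q]trmxK -trmx_mul PQ0 trmx0. Qed.
Let PQ1 : P^T *m P + Q^T *m Q = 1%:M. Proof. by case: PQ. Qed.

Definition rows_mx (X : 'M[F]_(p, m)) (Z : 'M[F]_(n, m)) : 'M[F]_m := P^T *m X + Q^T *m Z.

Lemma P_rows_mx X Z : P *m rows_mx X Z = X.
Proof. by rewrite mulmxDr !mulmxA PP PQ0 mul1mx mul0mx addr0. Qed.

Lemma Q_rows_mx X Z : Q *m rows_mx X Z = Z.
Proof. by rewrite mulmxDr !mulmxA QP0 QQ mul1mx mul0mx add0r. Qed.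

Lemma rows_mxK (X : 'M[F]_m) : rows_mx (P *m X) (Q *m X) = X.
Proof. by rewrite /rows_mx !mulmxA -mulmxDl PQ1 mul1mx. Qed.

Lemma rows_mxM (b : 'M[F]_p) w (d : 'M[F]_n) X Z :
  blockU P Q b w d *m rows_mx X Z = rows_mx (b *m X + w *m Z) (d *m Z).
Proof.
rewrite -[LHS]rows_mxK !mulmxA P_blockU// Q_blockU// mulmxDl.
by rewrite -!mulmxA P_rows_mx Q_rows_mx.
Qed.

Lemma rows_mxMr (h : 'M[F]_m) X Z : rows_mx X Z *m h = rows_mx (X *m h) (Z *m h).
Proof. by rewrite /rows_mx mulmxDl !mulmxA. Qed.

Lemma lat_rows_mx t X Z : rows_mx X Z \in lat t <-> (X \in lat t) && (Z \in lat t).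
Proof.
have mulL a (A : 'M[F]_(a, m)) (Y : 'M[F]_m) : A \in lat 1 -> Y \in lat t -> A *m Y \in lat t.
  by move=> A1 Yt; rewrite -(mul1r t) lat_mulmx.
split=> [XZ|/andP[Xt Zt]].
  by rewrite -(P_rows_mx X Z) -[X in _ && (X \in _)](Q_rows_mx X) !mulL.
by rewrite /rows_mx rpredD// -(mul1r t) lat_mulmx// lat_trmx.
Qed.

Lemma schw_at_rows s r (phi : 'M[F]_m -> C^o) Z : schw_at s r phi ->
  schw_at s r (fun X => phi (rows_mx X Z)).
Proof.
move=> [ps pr]; split=> [X Xs|X d dr].
  by rewrite ps//; apply: contra Xs => /lat_rows_mx/andP[].
have -> : rows_mx (X + d) Z = rows_mx X Z + rows_mx d 0.
  by rewrite /rows_mx mulmx0 addr0 mulmxDr addrAC.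
by rewrite pr//; apply/lat_rows_mx; rewrite dr rpred0.
Qed.

Definition pfourier (phi : 'M[F]_m -> C^o) (Y : 'M[F]_(m, p)) (Z : 'M[F]_(n, m)) : C^o :=
  fourier psi (fun X => phi (rows_mx X Z)) Y.

(** The factor in front undoes the constant in [fourier_inversion], since psi need not be self-dual
    for this measure. *)
Definition ipfourier (f : 'M[F]_(m, p) -> 'M[F]_(n, m) -> C^o) (X : 'M[F]_m) : C^o :=
  (vol (p * m) delta)^-1 *: fourier (fun x => psi (- x)) (f^~ (Q *m X)) (P *m X).

Lemma schw_rows (phi : 'M[F]_m -> C^o) Z : schw phi -> schw (fun X => phi (rows_mx X Z)).
Proof. by move=> [s [r psr]]; exists s, r; exact: schw_at_rows. Qed.

Lemma pfourier_schw (phi : 'M[F]_m -> C^o) : schw phi -> S2 (pfourier phi).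
Proof.
move=> [s [r psr]]; have [s' [r' fsr]] := schw_fourier psiP C^o p m s r.
have fZ Z := fsr _ (schw_at_rows Z psr).
exists (maxn s' s), (maxn r' r); split=> [Y Z /orP[Ys|Zs]|Y Z d e dr er].
- apply: (fZ Z).1; apply: contra Ys; apply: lat_unifV; exact: leq_maxl.
- rewrite /pfourier (_ : (fun _ => _) = fun=> 0) ?/fourier; last first.
    apply/funext => X; apply: psr.1; apply: contra Zs => /lat_rows_mx/andP[_].
    apply: lat_unifV; exact: leq_maxr.
  by under eq_fun do rewrite scaler0; rewrite haar0.
rewrite /pfourier (fZ _).2; last by apply: lat_unifX dr; exact: leq_maxl.
congr (fourier _ _ _); apply/funext => X.
have -> : rows_mx X (Z + e) = rows_mx X Z + rows_mx 0 e.
  by rewrite /rows_mx mulmx0 add0r mulmxDr addrA.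
rewrite psr.2//; apply/lat_rows_mx; rewrite rpred0/=.
by apply: lat_unifX er; exact: leq_maxr.
Qed.

Lemma schw2_at_fst s r (f : 'M[F]_(m, p) -> 'M[F]_(n, m) -> C^o) Z :
  schw2_at s r f -> schw_at s r (f^~ Z).
Proof.
move=> [fs fr]; split=> [Y Ys|Y d dr]; first by rewrite fs// Ys.
by rewrite -[Z in LHS]addr0 fr ?rpred0.
Qed.

Lemma schw2_fst (f : 'M[F]_(m, p) -> 'M[F]_(n, m) -> C^o) Z : S2 f -> schw (f^~ Z).
Proof. by move=> [s [r fsr]]; exists s, r; exact: schw2_at_fst. Qed.

Lemma ipfourier_schw f : S2 f -> schw (ipfourier f).
Proof.
move=> [s [r fsr]]; apply: schwZ.
have [s' [r' gsr]] := schw_fourier (char_conductorN psiP) C^o m p s r.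
have gZ Z := gsr _ (schw2_at_fst Z fsr).
exists (maxn s' s), (maxn r' r); split=> [X Xs|X d dr].
  have : (P *m X \notin lat (unif ^- s')) || (Q *m X \notin lat (unif ^- s)).
    rewrite -negb_and; apply: contra Xs => /andP[PX QX]; rewrite -(rows_mxK X).
    by apply/lat_rows_mx/andP; split; [apply: lat_unifV PX|apply: lat_unifV QX];
      rewrite ?leq_maxl ?leq_maxr.
  case/orP => [PX|QX]; first exact: (gZ _).1.
  rewrite (_ : f^~ _ = fun=> 0) /fourier; last first.
    by apply/funext => Y; apply: fsr.1; rewrite QX orbT.
  by under eq_fun do rewrite scaler0; rewrite haar0.
move: dr; rewrite -{1}(rows_mxK d) => /lat_rows_mx/andP[Pd Qd].
rewrite !mulmxDr (gZ _).2; last by apply: lat_unifX Pd; exact: leq_maxl.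
congr (fourier _ _ _); apply/funext => Y; rewrite -[Y in LHS]addr0 fsr.2 ?rpred0//.
by apply: lat_unifX Qd; exact: leq_maxr.
Qed.

Lemma pfourierK (phi : 'M[F]_m -> C^o) : schw phi -> ipfourier (pfourier phi) = phi.
Proof.
move=> pS; apply/funext => X; rewrite /ipfourier.
rewrite (fourier_inversion _ psiP (schw_rows _ pS)) rows_mxK scalerA mulVf ?scale1r//.
exact: vol_neq0 (conductor_neq0 psiP).
Qed.

Lemma ipfourierK f : S2 f -> pfourier (ipfourier f) = f.
Proof.
move=> fS; apply/funext => Y; apply/funext => Z; rewrite /pfourier /ipfourier.
under eq_fun do rewrite P_rows_mx Q_rows_mx.
rewrite (fourierZ psiP); last first.
  have [s [r fsr]] := fS; have [s' [r' gsr]] := schw_fourier (char_conductorN psiP) C^o m p s r.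
  by exists s', r'; apply: gsr; exact: schw2_at_fst.
have psiNN : psi = fun x => psi (- - x) by apply/funext => x; rewrite opprK.
rewrite [X in fourier X]psiNN (fourier_inversion _ (char_conductorN psiP) (schw2_fst _ fS)).
by rewrite scalerA mulnC mulVf ?scale1r// vol_neq0// (conductor_neq0 psiP).
Qed.

Lemma pfourier_linear c (phi phi' : 'M[F]_m -> C^o) : schw phi -> schw phi' ->
  pfourier (c *: phi + phi') = fun Y Z => c *: pfourier phi Y Z + pfourier phi' Y Z.
Proof.
move=> pS pS'; apply/funext => Y; apply/funext => Z; rewrite /pfourier.
have pZ := schw_rows Z pS; have pZ' := schw_rows Z pS'.
by rewrite -(fourierZ psiP c) // -(fourierD psiP) //; exact: schwZ.
Qed.

Lemma fourier_mulmx (W : lmodType C) (b : 'M[F]_p) (h : 'M[F]_m) (f : 'M[F]_(p, m) -> W) Y :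
  b \in unitmx -> h \in unitmx -> schw f ->
  fourier psi (fun X => f (invmx b *m X *m h)) Y =
  (vol m (\det b) / vol p (\det h)) *: fourier psi f (invmx h *m Y *m b).
Proof.
move=> bU hU fS; have bU' : invmx b \in unitmx by rewrite unitmx_inv.
pose g X := psi (\tr (X *m (invmx h *m Y *m b))) *: f X.
have gS : schw g by exact: (schw_char psiP).
have -> : fourier psi (fun X => f (invmx b *m X *m h)) Y = haar (fun X => g (invmx b *m X *m h)).
  congr haar; apply/funext => X; rewrite /g; congr (psi _ *: _).
  by rewrite [RHS]mxtrace_mulC !mulmxA mulmxK//;
    rewrite [RHS]mxtrace_mulC !mulmxA mulmxV// mul1mx mxtrace_mulC.
rewrite (haar_mull (f := fun X => g (X *m h)) bU' (schw_mulr hU gS)) (haar_mulr hU gS).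
by rewrite scalerA det_inv volV ?invrK // -unitfE -unitmxE.
Qed.

Lemma blockU_inv b w d : b \in unitmx -> d \in unitmx ->
  invmx (blockU P Q b w d) = blockU P Q (invmx b) (- (invmx b *m w *m invmx d)) (invmx d).
Proof.
move=> bU dU; have gU : blockU P Q b w d \in unitmx.
  by rewrite unitmxE (det_blockU PQ)// unitrM -!unitmxE bU.
apply: (can_inj (mulKmx gU)); rewrite mulmxV// (blockUM PQ) mulmxV// mulmxV//.
by rewrite mulmxN !mulmxA mulmxV// mul1mx addNr (blockU1 PQ).
Qed.

Lemma pfourier_weil b w d h (phi : 'M[F]_m -> C^o) :
  b \in unitmx -> d \in unitmx -> h \in unitmx -> schw phi ->
  pfourier (fun X => phi (invmx (blockU P Q b w d) *m X *m h)) =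
  fun Y Z => (psi (\tr (w *m invmx d *m Z *m Y)) * (vol m (\det b) / vol p (\det h))) *:
    pfourier phi (invmx h *m Y *m b) (invmx d *m Z *m h).
Proof.
move=> bU dU hU pS; apply/funext => Y; apply/funext => Z; rewrite /pfourier blockU_inv//.
pose f X := phi (rows_mx X (invmx d *m Z *m h)).
have fS : schw f by exact: schw_rows.
pose f' X := f (invmx b *m X *m h).
have -> : (fun X => phi (blockU P Q (invmx b) (- (invmx b *m w *m invmx d)) (invmx d) *m
    rows_mx X Z *m h)) = (fun X => f' (X + (- (w *m invmx d *m Z)))).
  apply/funext => X; rewrite rows_mxM /f' /f; congr phi.
  by rewrite rows_mxMr mulmxDr mulNmx mulmxN !mulmxA.
have fS' : schw f'.
  have bU' : invmx b \in unitmx by rewrite unitmx_inv.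
  exact: (schw_mulmx (f := fun X => f (X *m h)) bU' (schw_mulr hU fS)).
rewrite (fourier_trans psiP _ _ fS') mulNmx (raddfN (@mxtrace F p)) opprK.
by rewrite fourier_mulmx// scalerA.
Qed.

End PartialFourier.

(** * Block matrices *)

Section BlockIndices.
Variables (R : realType) (F : nonArchLocalFieldType R) (K n : nat).
Local Notation q := (\sum_(i < K) n)%N.
Implicit Types (A B : 'M[F]_q).

Definition bidx (i : 'I_K) (a : 'I_n) : 'I_q := @tagnat.Rank K (fun=> n) i a.
Definition bidx1 (r : 'I_q) : 'I_K := @tagnat.sig1 K (fun=> n) r.
Definition bidx2 (r : 'I_q) : 'I_n := @tagnat.sig2 K (fun=> n) r.

Lemma bidxK r : bidx (bidx1 r) (bidx2 r) = r.
Proof. exact: tagnat.sig2K. Qed.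

Lemma bidx1K i a : bidx1 (bidx i a) = i.
Proof. exact: (@tagnat.Rank1K K (fun=> n)). Qed.

Lemma eq_bidx i a j b : (bidx i a == bidx j b) = (i == j) && (a == b).
Proof. exact: (@tagnat.eq_Rank K (fun=> n)). Qed.

Lemma bidx2K i a : bidx2 (bidx i a) = a.
Proof.
have := bidxK (bidx i a); rewrite bidx1K => /eqP; rewrite eq_bidx eqxx => /eqP.
exact.
Qed.

Definition lvl (r : 'I_q) : nat := bidx1 r.

Definition blk A (i j : 'I_K) : 'M[F]_n := @submxblock F K K (fun=> n) (fun=> n) A i j.

Lemma blkE A i j a b : blk A i j a b = A (bidx i a) (bidx j b).
Proof. by rewrite mxE. Qed.

Lemma blk_eq A B : (forall i j, blk A i j = blk B i j) -> A = B.
Proof.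
move=> AB; apply/matrixP => r c; rewrite -(bidxK r) -(bidxK c).
by have /matrixP/(_ (bidx2 r) (bidx2 c)) := AB (bidx1 r) (bidx1 c); rewrite !blkE.
Qed.

Lemma blk_mul A B i j : blk (A *m B) i j = \sum_k blk A i k *m blk B k j.
Proof.
rewrite /blk -{1}(@submxblockK F K K (fun=> n) (fun=> n) A).
by rewrite -{1}(@submxblockK F K K (fun=> n) (fun=> n) B) mul_mxblock mxblockK.
Qed.

Lemma blkD A B i j : blk (A + B) i j = blk A i j + blk B i j.
Proof. exact: submxblockD. Qed.

Lemma blk1 i j : blk 1%:M i j = (i == j)%:R%:M.
Proof.
apply/matrixP => a b; rewrite blkE !mxE eq_bidx.
by case: eqP => //= _; case: eqP.
Qed.

Lemma upper_blkP A : upper_mx lvl A <-> forall i j : 'I_K, (j < i)%N -> blk A i j = 0.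
Proof.
split=> [uA i j ji|uA r c].
  apply/matrixP => a b; rewrite blkE mxE; apply: contrapT => /eqP /uA.
  by rewrite /lvl !bidx1K leqNgt ji.
rewrite leqNgt; apply: contra_neqN => cr.
by have /matrixP/(_ (bidx2 r) (bidx2 c)) := uA _ _ cr; rewrite blkE !bidxK mxE.
Qed.

Lemma upper_mul A B : upper_mx lvl A -> upper_mx lvl B -> upper_mx lvl (A *m B).
Proof.
move=> uA uB r c; rewrite mxE => h.
have [k] := sum_neq0 h; rewrite mulf_eq0 negb_or => /andP[/uA rk /uB kc].
exact: leq_trans rk kc.
Qed.

Lemma upper_blk_diag A B i : upper_mx lvl A -> upper_mx lvl B ->
  blk (A *m B) i i = blk A i i *m blk B i i.
Proof.
move=> /upper_blkP uA /upper_blkP uB; rewrite blk_mul (bigD1 i)//= big1 ?addr0// => k ki.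
have [ik|ik|/val_inj ik] := ltngtP i k; last by rewrite ik eqxx in ki.
  by rewrite uB// mulmx0.
by rewrite uA// mul0mx.
Qed.

Lemma upper_blk_super A B (i j : 'I_K) : j = i.+1 :> nat -> upper_mx lvl A -> upper_mx lvl B ->
  blk (A *m B) i j = blk A i i *m blk B i j + blk A i j *m blk B j j.
Proof.
move=> ji /upper_blkP uA /upper_blkP uB.
have ij : j != i by rewrite -val_eqE /= ji gtn_eqF.
rewrite blk_mul (bigD1 i)//= (bigD1 j)//= big1 ?addr0// => k /andP[ki kj].
have [ik|ik|/val_inj ik] := ltngtP i k; last by rewrite ik eqxx in ki.
  have jk : (j < k)%N by rewrite ltn_neqAle eq_sym kj ji.
  by rewrite uB// mulmx0.
by rewrite uA// mul0mx.
Qed.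

Definition unipotent A := (forall i j : 'I_K, (j < i)%N -> blk A i j = 0) /\
  forall i, blk A i i = 1%:M.

Lemma unipotent_upper A : unipotent A -> upper_mx lvl A.
Proof. by case=> uA _; apply/upper_blkP. Qed.

Lemma unipotent1 : unipotent 1%:M.
Proof.
split=> [i j ji|i]; last by rewrite blk1 eqxx.
by rewrite blk1 -val_eqE gtn_eqF// mulr0n raddf0.
Qed.

(** Back substitution from the last block row: once the rows below row i are known to be block upper
    triangular, A B = 1 determines row i. *)
Lemma unipotent_inv A : A \in unitmx -> unipotent A -> unipotent (invmx A).
Proof.
move=> AU [uA A1]; set B := invmx A.
have AB i j : \sum_k blk A i k *m blk B k j = (i == j)%:R%:M.
  by rewrite -blk_mul mulmxV// blk1.
have step (i j : 'I_K) : (forall k : 'I_K, (i < k)%N -> blk B k j = 0) ->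
    blk B i j = (i == j)%:R%:M.
  move=> Bk; rewrite -AB (bigD1 i)//= A1 mul1mx big1 ?addr0// => k ki.
  have [ik|ik|/val_inj ik] := ltngtP i k; last by rewrite ik eqxx in ki.
    by rewrite Bk// mulmx0.
  by rewrite uA// mul0mx.
have low t (i j : 'I_K) : (K - i <= t)%N -> (j < i)%N -> blk B i j = 0.
  elim: t i => [|t IHt] i it ji.
    by move: it; rewrite leqn0 subn_eq0 leqNgt ltn_ord.
  rewrite step => [|k ik].
    by rewrite -val_eqE gtn_eqF// mulr0n raddf0.
  apply: IHt (ltn_trans ji ik); rewrite -ltnS (leq_trans _ it)// ltn_sub2l//.
split=> [i j|i]; first exact: (low _ _ _ (leqnn _)).
by rewrite step ?eqxx// => k; exact: (low _ _ _ (leqnn _)).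
Qed.

(** The additive form behind the character of N: [N_char] is psi applied to it, by [N_charE]. *)
Definition supertrace A : F := \sum_(i < K) \sum_(j < K | j == i.+1 :> nat) \tr (blk A i j).

Lemma supertraceD A B : supertrace (A + B) = supertrace A + supertrace B.
Proof.
rewrite /supertrace -big_split; apply: eq_bigr => i _; rewrite -big_split.
by apply: eq_bigr => j _; rewrite blkD mxtraceD.
Qed.

Lemma supertrace1 : supertrace 1%:M = 0.
Proof.
rewrite /supertrace big1// => i _; rewrite big1// => j /eqP ji.
by rewrite blk1 -val_eqE /= ji ltn_eqF// mulr0n raddf0 mxtrace0.
Qed.

Lemma supertrace_delta (v : 'cV[F]_q) c (i j : 'I_K) a : j = i.+1 :> nat ->
  supertrace (v *m (c *: delta_mx 0 (bidx j a))) = v (bidx i a) 0 * c.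
Proof.
move=> ji; rewrite /supertrace.
have e i' j' : \tr (blk (v *m (c *: delta_mx 0 (bidx j a))) i' j') =
    (j' == j)%:R * (v (bidx i' a) 0 * c).
  rewrite /mxtrace (bigD1 a)//= [X in _ + X]big1 => [|b ba].
    by rewrite blkE mxE big_ord1 !mxE eqxx/= eq_bidx eqxx andbT addr0 mulrA mulrC.
  by rewrite blkE mxE big_ord1 !mxE eqxx/= eq_bidx (negPf ba) andbF !mulr0.
under eq_bigr do under eq_bigr do rewrite e.
rewrite (bigD1 i)//= (big_pred1 j) => [|j']; last by rewrite /= -val_eqE /= ji.
rewrite eqxx mul1r [X in _ + X]big1 ?addr0// => i' ii'; rewrite big1// => j' /eqP ji'.
have -> : (j' == j) = false by rewrite -val_eqE /= ji' ji; exact: negPf ii'.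
by rewrite mul0r.
Qed.

Definition bdiag (d : 'M[F]_n) : 'M[F]_q := @mxdiag F K (fun=> n) (fun=> d).

Lemma blk_bdiag d i j : blk (bdiag d) i j = if i == j then d else 0.
Proof. by rewrite /blk mxblockK; case: eqP => // ij; rewrite conform_mx_id. Qed.

Lemma bdiag_upper d : upper_mx lvl (bdiag d).
Proof. by apply/upper_blkP => i j ji; rewrite blk_bdiag -val_eqE gtn_eqF. Qed.

Lemma bdiag_conj d d' A i j : blk (bdiag d *m A *m bdiag d') i j = d *m blk A i j *m d'.
Proof.
rewrite blk_mul (bigD1 j)//= blk_bdiag eqxx [X in _ + X]big1 ?addr0 => [|k kj]; last first.
  by rewrite blk_bdiag (negPf kj) mulmx0.
rewrite blk_mul (bigD1 i)//= blk_bdiag eqxx [X in _ + X]big1 ?addr0// => k ki.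
by rewrite blk_bdiag eq_sym (negPf ki) mul0mx.
Qed.

Lemma bdiag1 : bdiag 1%:M = 1%:M.
Proof.
by apply: blk_eq => i j; rewrite blk_bdiag blk1; case: eqP => // _; rewrite raddf0.
Qed.

Lemma bdiagM d d' : bdiag d *m bdiag d' = bdiag (d *m d').
Proof.
apply: blk_eq => i j; rewrite -[bdiag d]mulmx1 bdiag_conj blk1 blk_bdiag.
by case: eqP => _; rewrite ?mulmx1// raddf0 mulmx0 mul0mx.
Qed.

Lemma bdiag_inv d : d \in unitmx -> invmx (bdiag d) = bdiag (invmx d).
Proof.
move=> dU; have e : bdiag d *m bdiag (invmx d) = 1%:M by rewrite bdiagM mulmxV// bdiag1.
have [DU _] := mulmx1_unit e.
by apply: (can_inj (mulKmx DU)); rewrite mulmxV.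
Qed.

Lemma supertrace_conj d A : d \in unitmx ->
  supertrace (bdiag d *m A *m bdiag (invmx d)) = supertrace A.
Proof.
move=> dU; rewrite /supertrace; apply: eq_bigr => i _; apply: eq_bigr => j _.
by rewrite bdiag_conj mxtrace_mulC mulmxA mulVmx// mul1mx.
Qed.

(** Conjugating a strictly upper triangular matrix by a unipotent one alters only blocks beyond the
    first superdiagonal. *)
Lemma supertrace_unip_conj A (nu : 'M[F]_q) : A \in unitmx -> unipotent A ->
  (forall r c, nu r c != 0 -> (lvl r < lvl c)%N) -> supertrace (A *m nu *m invmx A) = supertrace nu.
Proof.
move=> AU uA nuP; have uI := unipotent_inv AU uA; have uA' := unipotent_upper uA.
have uI' := unipotent_upper uI; have un : upper_mx lvl nu by move=> r c /nuP/ltnW.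
have nuii i : blk nu i i = 0.
  apply/matrixP => a b; rewrite blkE mxE; apply: contrapT => /eqP/nuP.
  by rewrite /lvl !bidx1K ltnn.
rewrite /supertrace; apply: eq_bigr => i _; apply: eq_bigr => j /eqP ji; congr mxtrace.
rewrite upper_blk_super//; last exact: upper_mul.
rewrite upper_blk_diag// nuii mulmx0 mul0mx add0r upper_blk_super//.
by rewrite uA.2 uI.2 nuii mulmx0 addr0 mulmx1 mul1mx.
Qed.

End BlockIndices.

Section LastBlock.
Variables (R : realType) (F : nonArchLocalFieldType R) (k n : nat).
Local Notation K := k.+1.
Local Notation p := (\sum_(i < K) n)%N.
Local Notation m := (\sum_(i < K.+1) n)%N.
Local Notation wid := (widen_ord (leqnSn K)).

Definition head_idx (r : 'I_p) : 'I_m := bidx (wid (bidx1 r)) (bidx2 r).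
Definition last_idx (a : 'I_n) : 'I_m := bidx ord_max a.

Definition head_rows : 'M[F]_(p, m) := rowsub head_idx 1%:M.
Definition last_rows : 'M[F]_(n, m) := rowsub last_idx 1%:M.
Definition corner_rows : 'M[F]_(n, p) := rowsub (bidx ord_max) 1%:M.
Local Notation P := head_rows.
Local Notation Q := last_rows.
Local Notation E := corner_rows.

Lemma block_size : m = (p + n)%N.
Proof. by rewrite big_ord_recr. Qed.

Lemma wid_neq_max (i : 'I_K) : (wid i == ord_max) = false.
Proof. by rewrite -val_eqE /= ltn_eqF. Qed.

Lemma wid_eq (i j : 'I_K) : (wid i == wid j) = (i == j).
Proof. by rewrite -val_eqE. Qed.

Lemma ord_last_ind (S : 'I_K.+1 -> Prop) : (forall i, S (wid i)) -> S ord_max -> forall i, S i.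
Proof.
move=> Sw Sm i; have [iK|iK] := ltnP i K.
  by have -> : i = wid (Ordinal iK) by exact: val_inj.
have -> // : i = ord_max; apply: val_inj; apply/eqP.
by rewrite eqn_leq iK -ltnS ltn_ord.
Qed.

Lemma head_bidx (i : 'I_K) (a : 'I_n) : head_idx (bidx i a) = bidx (wid i) a.
Proof. by rewrite /head_idx bidx1K bidx2K. Qed.

Lemma mul_head a (A : 'M[F]_(m, a)) : P *m A = rowsub head_idx A.
Proof. by rewrite -rowsubE. Qed.

Lemma mul_last a (A : 'M[F]_(m, a)) : Q *m A = rowsub last_idx A.
Proof. by rewrite -rowsubE. Qed.

Lemma mul_corner a (A : 'M[F]_(p, a)) : E *m A = rowsub (bidx ord_max) A.
Proof. by rewrite -rowsubE. Qed.

Lemma head_last_splitting : row_splitting P Q.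
Proof.
have PP : P *m P^T = 1%:M.
  rewrite mul_head; apply/matrixP => r c; rewrite !mxE -(bidxK r) -(bidxK c) !head_bidx !eq_bidx.
  by rewrite wid_eq (eq_sym (bidx1 c)) (eq_sym (bidx2 c)).
have QQ : Q *m Q^T = 1%:M.
  by rewrite mul_last; apply/matrixP => r c; rewrite !mxE eq_bidx eqxx eq_sym.
have PQ0 : P *m Q^T = 0.
  rewrite mul_head; apply/matrixP => r c; rewrite !mxE -(bidxK r) head_bidx eq_bidx.
  by rewrite eq_sym wid_neq_max.
have QP0 : Q *m P^T = 0 by rewrite -[Q]trmxK -trmx_mul PQ0 trmx0.
split=> //; set X := _ + _.
have PX : P *m X = P by rewrite mulmxDr !mulmxA PP PQ0 mul1mx mul0mx addr0.
have QX : Q *m X = Q by rewrite mulmxDr !mulmxA QP0 QQ mul1mx mul0mx add0r.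
apply/matrixP => r c; rewrite -(bidxK r); elim/ord_last_ind: (bidx1 r) => [i|].
  by have /matrixP/(_ (bidx i (bidx2 r)) c) := PX; rewrite mul_head !mxE head_bidx => ->.
by have /matrixP/(_ (bidx2 r) c) := QX; rewrite mul_last !mxE => ->.
Qed.

Lemma lat_rowsub a b c (f : 'I_a -> 'I_b) (A : 'M[F]_(b, c)) t :
  A \in lat t -> rowsub f A \in lat t.
Proof. by move=> /latP At; apply/latP => r s; rewrite mxE. Qed.

Lemma head_last_integral : integral_splitting P Q E.
Proof.
split; try by apply: lat_rowsub; exact: lat_1.
by rewrite mul_corner; apply/matrixP => r c; rewrite !mxE eq_bidx eqxx eq_sym.
Qed.

Lemma corner_top (v : 'cV[F]_p) : E *m v = 0 -> forall r, (lvl r).+1 = K -> v r 0 = 0.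
Proof.
move=> Ev r [rk]; rewrite -(bidxK r); have -> : bidx1 r = ord_max by exact: val_inj.
by have /matrixP/(_ (bidx2 r) 0) := Ev; rewrite mul_corner !mxE.
Qed.

Lemma lvl_lt (r : 'I_p) : (lvl r < K)%N. Proof. exact: ltn_ord. Qed.

Lemma corner_jump j nu : (j < K)%N -> jump_mx (@lvl K n) j nu -> E *m nu = 0.
Proof.
move=> jK nj; rewrite mul_corner; apply/matrixP => a c; rewrite !mxE.
apply: contrapT => /eqP/nj; rewrite /lvl bidx1K /= => /andP[kj _].
by move: jK; rewrite ltnS leqNgt kj.
Qed.

Lemma corner_unipotent u : unipotent u -> E *m u = E.
Proof.
move=> [u0 u1]; rewrite mul_corner; apply/matrixP => a c; rewrite !mxE -(bidxK c) -(blkE u) eq_bidx.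
have [->|kc] := eqVneq ord_max (bidx1 c); first by rewrite u1 mxE.
rewrite u0 ?mxE//= ltn_neqAle -ltnS ltn_ord andbT.
by apply: contra kc => /eqP kc; apply/eqP/val_inj.
Qed.

Lemma corner_bdiag d : E *m bdiag K d = d *m E.
Proof.
rewrite mul_corner; apply/matrixP => a c; rewrite -(bidxK c) [LHS]mxE.
rewrite -(blkE (bdiag K d)) blk_bdiag [RHS]mxE.
rewrite (bigD1 (bidx2 c))//= [X in _ + X]big1 ?addr0 => [|b bc]; last first.
  by rewrite !mxE eq_bidx (negPf bc) andbF mulr0.
rewrite !mxE eq_bidx eqxx andbT.
by case: eqP => _; rewrite ?mulr1// mulr0 mxE.
Qed.

Lemma rowsub_entry a b (f : 'I_a -> 'I_m) (g : 'I_b -> 'I_m) (A : 'M[F]_m) i j :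
  (rowsub f 1%:M *m A *m (rowsub g 1%:M)^T) i j = A (f i) (g j).
Proof.
by rewrite -[X in fun_of_matrix X]trmxK trmx_mul trmxK -!rowsubE !mxE.
Qed.

Lemma blk_head A (i j : 'I_K) : blk (P *m A *m P^T) i j = blk A (wid i) (wid j).
Proof.
by apply/matrixP => a b; rewrite !blkE -!head_bidx; exact: rowsub_entry.
Qed.

Lemma blkU_head b z g (i j : 'I_K) : blk (blockU P Q b z g) (wid i) (wid j) = blk b i j.
Proof.
have PQ := head_last_splitting; have [PP _ _ _] := PQ.
by rewrite -blk_head -mulmxA (blockU_P PQ) mulmxA PP mul1mx.
Qed.

Lemma blkU_side b z g (i : 'I_K) : blk (blockU P Q b z g) (wid i) ord_max = rowsub (bidx i) z.
Proof.
have PQ := head_last_splitting; have [_ QQ PQ0 _] := PQ.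
have zE : P *m blockU P Q b z g *m Q^T = z.
  by rewrite (P_blockU PQ) mulmxDl -!mulmxA PQ0 QQ mulmx0 mulmx1 add0r.
apply/matrixP => a c; rewrite -{2}zE blkE [RHS]mxE -head_bidx.
by apply/esym; exact: rowsub_entry.
Qed.

Lemma blkU_last b z g : blk (blockU P Q b z g) ord_max ord_max = g.
Proof.
have PQ := head_last_splitting; have [_ QQ PQ0 _] := PQ.
have gE : Q *m blockU P Q b z g *m Q^T = g by rewrite (Q_blockU PQ) -mulmxA QQ mulmx1.
by apply/matrixP => a c; rewrite -{2}gE blkE; apply/esym; exact: rowsub_entry.
Qed.

Lemma blkU_low b z g (j : 'I_K) : blk (blockU P Q b z g) ord_max (wid j) = 0.
Proof.
have PQ := head_last_splitting; have [_ _ PQ0 _] := PQ.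
have QP0 : Q *m P^T = 0 by rewrite -[Q]trmxK -trmx_mul PQ0 trmx0.
have gE : Q *m blockU P Q b z g *m P^T = 0 by rewrite (Q_blockU PQ) -mulmxA QP0 mulmx0.
apply/matrixP => a c; rewrite !blkE -head_bidx [RHS]mxE.
transitivity ((Q *m blockU P Q b z g *m P^T) a (bidx j c)); last by rewrite gE mxE.
by apply/esym; exact: rowsub_entry.
Qed.

Lemma blockU_unit b z g : blockU P Q b z g \in unitmx -> b \in unitmx /\ g \in unitmx.
Proof.
have PQ := head_last_splitting; have [PP QQ _ _] := PQ.
set x := blockU _ _ _ _ _ => xU; split.
  suff /mulmx1_unit[] : P *m invmx x *m P^T *m b = 1%:M by [].
  by rewrite -!mulmxA -(blockU_P PQ b z g) mulKmx.
suff /mulmx1_unit[] : g *m (Q *m invmx x *m Q^T) = 1%:M by [].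
by rewrite !mulmxA -(Q_blockU PQ b z g) -(mulmxA Q) mulmxV// mulmx1.
Qed.

Lemma blockU_blk (A : 'M[F]_m) : (forall j : 'I_K, blk A ord_max (wid j) = 0) ->
  exists b z g, A = blockU P Q b z g.
Proof.
move=> A0; pose z := P *m A *m Q^T.
exists (P *m A *m P^T), z, (Q *m A *m Q^T).
have zE i : rowsub (bidx i) z = blk A (wid i) ord_max.
  by apply/matrixP => a c; rewrite mxE blkE -head_bidx; exact: rowsub_entry.
have gE : Q *m A *m Q^T = blk A ord_max ord_max.
  by apply/matrixP => a c; rewrite blkE; exact: rowsub_entry.
apply: blk_eq => i j; elim/ord_last_ind: i => [i|]; elim/ord_last_ind: j => [j|].
- by rewrite blkU_head blk_head.
- by rewrite blkU_side zE.
- by rewrite blkU_low A0.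
- by rewrite blkU_last gE.
Qed.

Lemma blockU_bdiag d : bdiag K.+1 d = blockU P Q (bdiag K d) 0 d.
Proof.
apply: blk_eq => i j; rewrite blk_bdiag.
elim/ord_last_ind: i => [i|]; elim/ord_last_ind: j => [j|].
- by rewrite blkU_head blk_bdiag wid_eq.
- rewrite wid_neq_max blkU_side; apply/matrixP => a b; rewrite !mxE//.
- by rewrite eq_sym wid_neq_max blkU_low.
- by rewrite eqxx blkU_last.
Qed.

Lemma blockU_unipotent u w : unipotent u -> unipotent (blockU P Q u w 1%:M).
Proof.
move=> [u0 u1]; split=> [i j|i].
  elim/ord_last_ind: i => [i|]; elim/ord_last_ind: j => [j|] /= ji.
  - by rewrite blkU_head u0.
  - by move: ji; rewrite ltnNge ltnW// ltn_ord.
  - by rewrite blkU_low.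
  - by rewrite ltnn in ji.
by elim/ord_last_ind: i => [i|]; rewrite ?blkU_head ?blkU_last.
Qed.

Lemma unipotent_blockU x : unipotent x -> exists u w, unipotent u /\ x = blockU P Q u w 1%:M.
Proof.
move=> [x0 x1]; have [j|b [z [g xE]]] := @blockU_blk x; first by rewrite x0//= ltn_ord.
exists b, z; rewrite xE in x0 x1 *; split; last by have := x1 ord_max; rewrite blkU_last => ->.
split=> [i j ji|i]; first by have := x0 (wid i) (wid j) ji; rewrite blkU_head.
by have := x1 (wid i); rewrite blkU_head.
Qed.

(** The last superdiagonal block is the bottom block of z, which E selects. This is how E, and with
    it the fiber Z Y = E, arises from the character of N. *)
Lemma supertrace_blockU b z g : supertrace (blockU P Q b z g) = supertrace b + \tr (E *m z).
Proof.
rewrite /supertrace big_ord_recr /= [X in _ + X]big1 ?addr0; last first.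
  by move=> j /eqP jK; move: (ltn_ord j); rewrite jK ltnn.
pose f (i : 'I_K) (j : 'I_K.+1) := \tr (blk (blockU P Q b z g) (wid i) j).
have e (i : 'I_K) : \sum_(j < K.+1 | j == i.+1 :> nat) f i j =
    \sum_(j < K | j == i.+1 :> nat) \tr (blk b i j) +
    (if i == ord_max then \tr (E *m z) else 0).
  rewrite big_mkcond big_ord_recr /= -big_mkcond /=; congr (_ + _).
    by apply: eq_bigr => j _; rewrite /f blkU_head.
  rewrite eqSS eq_sym -[(i : nat) == k]/(i == ord_max); case: eqP => // ->.
  by rewrite /f blkU_side mul_corner.
rewrite (eq_bigr _ (fun i _ => e i)) big_split /=; congr (_ + _).
by rewrite -big_mkcond big_pred1_eq.
Qed.

End LastBlock.

Section GroupBlocks.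
Variables (R : realType) (F : nonArchLocalFieldType R) (psi : F -> R[i]) (delta : F).
Hypothesis psiP : char_conductor psi delta.

Lemma N_charE K n (x : GL F (\sum_(i < K) n)%N) : N_char psi x = psi (supertrace (val x)).
Proof.
rewrite /supertrace (char_sum psiP); apply: eq_bigr => i _.
by rewrite (char_sum psiP).
Qed.

Lemma val_diagD K n (d : GL F n) : val (diagD K d) = bdiag K (val d).
Proof. by []. Qed.

Section GroupSplitting.
Variables (k n : nat).
Local Notation K := k.+1.
Local Notation p := (\sum_(i < K) n)%N.
Local Notation m := (\sum_(i < K.+1) n)%N.
Local Notation wid := (widen_ord (leqnSn K)).
Local Notation P := (head_rows F k n).
Local Notation Q := (last_rows F k n).
Local Notation E := (corner_rows F k n).

Lemma GL_blockU (x : GL F m) b z g : val x = blockU P Q b z g ->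
  exists (b' : GL F p) (g' : GL F n), b = val b' /\ g = val g'.
Proof.
move=> xE; have := valP x; rewrite xE => /blockU_unit[bU gU].
by exists (Sub b bU), (Sub g gU).
Qed.

Lemma N_group_blockU (x : GL F m) : N_group x ->
  exists (u : GL F p) w, N_group u /\ val x = blockU P Q (val u) w 1%:M.
Proof.
move=> Nx; have [u [w [uU xE]]] := unipotent_blockU Nx.
by have [u' [_ [uE _]]] := GL_blockU xE; subst u; exists u', w.
Qed.

Lemma val_diagD' (d : GL F n) :
  val (diagD' K.+1 d) = blockU P Q (bdiag K (val d)) 0 1%:M.
Proof.
apply: blk_eq => i j; rewrite /blk mxblockK.
elim/ord_last_ind: i => [i|]; elim/ord_last_ind: j => [j|].
- rewrite -/(blk _ _ _) blkU_head blk_bdiag wid_eq; case: eqP => // ij.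
  by rewrite conform_mx_id /= eqSS ltn_eqF.
- rewrite wid_neq_max -/(blk _ _ _) blkU_side; apply/matrixP => a b; rewrite !mxE//.
- by rewrite eq_sym wid_neq_max -/(blk _ _ _) blkU_low.
- by rewrite eqxx -/(blk _ _ _) blkU_last conform_mx_id /= eqxx.
Qed.

(** The vanishing of the block next to the last diagonal block is E z = 0, the same condition that
    cuts out the base stabilizer. *)
Lemma H_group_blockU (x : GL F m) : H_group x -> exists (u : GL F p) z (g : GL F n),
  [/\ N_group u, E *m z = 0 & val x = blockU P Q (val u) z (val g)].
Proof.
move=> [x0 x1 xK]; have [j|b [z [g xE]]] := @blockU_blk _ _ _ _ (val x).
  by have := x0 ord_max (wid j); apply; rewrite /= ltn_ord.
have [u [g' [uE gE]]] := GL_blockU xE; subst b g; exists u, z, g'; split=> //.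
  split=> [i j ji|i].
    by have := x0 (wid i) (wid j) ji; rewrite /block xE -[X in X = _]/(blk _ _ _) blkU_head.
  have := x1 (wid i) (ltn_ord i).
  by rewrite /block xE -[X in X = _]/(blk _ _ _) blkU_head.
have := xK (wid ord_max) ord_max erefl erefl.
by rewrite /block xE -[X in X = _]/(blk _ _ _) blkU_side mul_corner.
Qed.

Lemma blockU_H_group (x : GL F m) u z g : unipotent u -> E *m z = 0 ->
  val x = blockU P Q u z g -> H_group x.
Proof.
move=> [u0 u1] Ez xE; split=> [i j|i|i j]; rewrite /block xE.
- elim/ord_last_ind: i => [i|]; elim/ord_last_ind: j => [j|] /= ji.
  + by rewrite -[LHS]/(blk _ _ _) blkU_head u0.
  + by move: ji; rewrite ltnNge ltnW// ltn_ord.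
  + by rewrite -[LHS]/(blk _ _ _) blkU_low.
  + by rewrite ltnn in ji.
- elim/ord_last_ind: i => [i|] /= iK; last by rewrite ltnn in iK.
  by rewrite -[LHS]/(blk _ _ _) blkU_head u1.
elim/ord_last_ind: j => [j|] /= ji; first by move=> [jK]; have := ltn_ord j; rewrite jK ltnn.
elim/ord_last_ind: i ji => [i|] /= [ik] _; last by move/eqP: ik; rewrite ltn_eqF.
have -> : i = ord_max by exact: val_inj.
by rewrite -[LHS]/(blk _ _ _) blkU_side -mul_corner.
Qed.

Lemma size_exponent : (2 - K.+1%:R) * n%:R / 2 = n%:R - m%:R / 2 :> R.
Proof. by rewrite sum_nat_const card_ord natrM; field. Qed.

Lemma size_exponentN : (K.+1%:R - 2) * n%:R / 2 = - (n%:R - m%:R / 2) :> R.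
Proof. by rewrite sum_nat_const card_ord natrM; field. Qed.

Lemma H_charE (x : GL F m) u z g : val x = blockU P Q u z g ->
  H_char psi x = abs_det g (n%:R - m%:R / 2) * psi (supertrace u).
Proof.
move=> xE; rewrite /H_char /block xE size_exponent; congr (_ * _).
  rewrite (big_pred1 ord_max) => [|i]; first by rewrite -/(blk _ _ _) blkU_last.
  by rewrite /= eqSS.
rewrite /supertrace (char_sum psiP) big_ord_recr /= [X in _ * X]big1 ?mulr1 => [|j]; last first.
  by move=> /andP[/eqP->]; rewrite ltnNge leqnSn.
apply: eq_bigr => i _; rewrite (char_sum psiP) big_mkcond big_ord_recr /= ltnn andbF mulr1.
rewrite -big_mkcond; apply: eq_big => [j|j _]; first by rewrite /= ltnS ltn_ord andbT.
by rewrite -/(blk _ _ _) blkU_head.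
Qed.

End GroupSplitting.
End GroupBlocks.

(** * The abstract data of the extension argument, for GL_n^Delta N *)

Section LeviPairs.
Variables (R : realType) (F : nonArchLocalFieldType R) (psi : F -> R[i]) (delta : F).
Variables (k n : nat) (sigma : rep R[i] (GL F n)).
Hypothesis psiP : char_conductor psi delta.
Hypothesis psi_nontrivial : exists x, psi x != 1.
Local Notation K := k.+1.
Local Notation p := (\sum_(i < K) n)%N.
Local Notation E := (corner_rows F k n).
Local Notation lv := (@lvl K n).

Definition superchar (A : 'M[F]_p) : R[i] := psi (supertrace A).

Definition levi_pair (b : GL F p) (d : GL F n) : Prop :=
  exists2 u : GL F p, N_group u & b = (diagD K d * u)%g.

(** The unipotent part is recovered as diag(d)^-1 b, so the action is a function of the pair and
    involves no choice of u. *)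
Definition levi_act (b : GL F p) (d : GL F n) : {linear sigma -> sigma} :=
  superchar (invmx (bdiag K (val d)) *m val b) \*: act sigma d.

Lemma levi_actE u d w : levi_act (diagD K d * u)%g d w = superchar (val u) *: act sigma d w.
Proof.
rewrite -[LHS]/(superchar (invmx (bdiag K (val d)) *m (bdiag K (val d) *m val u)) *: _) mulKmx//.
exact: valP (diagD K d).
Qed.

Lemma levi_corner b d : levi_pair b d -> val d *m E = E *m val b.
Proof.
move=> [u uN ->]; rewrite GL_valM val_diagD mulmxA corner_bdiag -mulmxA.
by rewrite (@corner_unipotent _ _ k n (val u) uN).
Qed.

Lemma levi_upper b d : levi_pair b d -> upper_mx lv (val b) /\ upper_mx lv (invmx (val b)).
Proof.
move=> [u uN ->]; have uU := unipotent_upper uN; split.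
  by apply: upper_mul uU; exact: bdiag_upper.
rewrite -GL_valV invgM GL_valM !GL_valV val_diagD bdiag_inv ?(valP d)//.
apply: upper_mul; last exact: bdiag_upper.
exact: (unipotent_upper (unipotent_inv (valP u) uN)).
Qed.

Lemma levi_jump j nu (b : GL F p) : jump_mx lv j nu -> val b = 1%:M + nu ->
  levi_pair b 1%g /\ forall w, levi_act b 1%g w = superchar nu *: w.
Proof.
move=> nj bE; have d1 : diagD K 1%g = 1%g :> GL F p by apply: val_inj; exact: bdiag1.
have nu0 (i i' : 'I_K) : (i' <= i)%N -> blk nu i i' = 0.
  move=> ii'; apply/matrixP => a c; rewrite blkE mxE; apply: contrapT => /eqP/nj.
  by rewrite /lvl !bidx1K => /andP[ij] /(leq_trans ij); rewrite ltnNge ii'.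
have bN : N_group b.
  split=> [i i' ii'|i]; rewrite /block bE -[LHS]/(blk _ _ _) blkD nu0 ?addr0//.
  - exact: (@unipotent1 _ F K n).1.
  - exact: ltnW.
  - exact: (@unipotent1 _ F K n).2.
split=> [|w]; first by exists b => //; rewrite d1 mul1g.
have := levi_actE b 1%g w; rewrite d1 mul1g act1 => ->.
by rewrite /superchar bE supertraceD supertrace1 add0r.
Qed.

Lemma levi_conj j nu (b : GL F p) d : levi_pair b d -> jump_mx lv j nu ->
  jump_mx lv j (val b *m nu *m invmx (val b)) /\
  superchar (val b *m nu *m invmx (val b)) = superchar nu.
Proof.
move=> Tbd nj; have [bU bU'] := levi_upper Tbd; split=> [r c|].
  rewrite mxE => /sum_neq0[s]; rewrite mxE mulf_eq0 negb_or => /andP[/sum_neq0[t]].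
  rewrite mulf_eq0 negb_or => /andP[/bU rt /nj/andP[tj js]] /bU' sc.
  by rewrite (leq_ltn_trans rt tj) (leq_trans js sc).
have [u uN ->] := Tbd; rewrite -GL_valV invgM !GL_valM !GL_valV val_diagD bdiag_inv ?(valP d)//.
rewrite !mulmxA /superchar.
have -> : bdiag K (val d) *m val u *m nu *m invmx (val u) =
    bdiag K (val d) *m (val u *m nu *m invmx (val u)) by rewrite !mulmxA.
rewrite supertrace_conj ?(valP d)// supertrace_unip_conj// ?(valP u)// => r c /nj/andP[rj].
exact: leq_trans.
Qed.

(** One entry of w suffices: placed at level j + 1 in the same position within its block as a
    nonzero entry of v, it makes the supertrace equal to any prescribed t, in particular one with
    psi t <> 1. *)
Lemma superchar_generic j (v : 'cV[F]_p) : (j.+1 < K)%N -> (exists r, lv r = j /\ v r 0 != 0) ->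
  exists w : 'rV[F]_p, (forall c, w 0 c != 0 -> lv c = j.+1) /\ superchar (v *m w) != 1.
Proof.
move=> jK [r [rj vr]]; have [t t1] := psi_nontrivial; pose j' := Ordinal jK.
exists ((t / v r 0) *: delta_mx 0 (bidx j' (bidx2 r))); split=> [c|].
  rewrite !mxE eqxx /=; have [-> _|_] := eqVneq c (bidx j' (bidx2 r)).
    by rewrite /lvl bidx1K.
  by rewrite mulr0 eqxx.
rewrite /superchar (@supertrace_delta _ _ _ _ _ _ (bidx1 r) j') ?bidxK; last by rewrite /= -rj.
by rewrite mulrC divfK.
Qed.

End LeviPairs.

(** * The isomorphism *)

Lemma span_ker (C : fieldType) (V W : lmodType C) (A : set V) (T : {linear V -> W}) :
  (forall a, A a -> T a = 0) -> forall x, x \in Defs.span A -> T x = 0.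
Proof.
move=> TA x /spanP xS; pose S : {pred V} := fun y => T y == 0.
have SE y : (y \in S) = (T y == 0) by [].
have SS : GRing.subsemimod_closed S.
  split; first split.
  - by rewrite SE (linear0 T).
  - by move=> u v; rewrite !SE (linearD T) => /eqP-> /eqP->; rewrite addr0.
  - by move=> c v; rewrite !SE (linearZ_LR T) => /eqP->; rewrite scaler0.
pose SM := GRing.isSubmodClosed.Build C _ S SS.
pose SP : submodClosed V := HB.pack S SM.
suff /xS : forall a, A a -> a \in SP by move/eqP.
by move=> a /TA Ta; rewrite [_ \in _]SE Ta.
Qed.

Section ThetaSpace.
Variables (C : fieldType) (G H : groupType) (U : rep C (G * H)%type) (V : rep C G).
Local Notation T := (tensor_rep U (inflate H V)).

Definition theta_proj (phi : U) (v : V) : coinv_rep T :=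
  quot_proj (Defs.span (coinv_rel (V := T))) (tens phi v : T).

Lemma theta_act h phi v :
  act (coinv_rep T) h (theta_proj phi v) = theta_proj (act U (1%g, h) phi) v.
Proof.
rewrite [LHS]coinv_actE; congr quot_proj; rewrite [LHS]tensor_actE; congr tens.
exact: act1.
Qed.

Lemma theta_inv g phi v : theta_proj (act U (g, 1%g) phi) (act V g v) = theta_proj phi v.
Proof.
apply/eq_quot_proj/mem_span; exists g, (tens phi v); congr (_ - _).
by rewrite [RHS]tensor_actE.
Qed.

Lemma theta_proj_linearl v : linear (theta_proj^~ v).
Proof. by move=> c x y; rewrite /theta_proj tensDl tensZl linearP. Qed.

Lemma theta_proj_linearr phi : linear (theta_proj phi).
Proof. by move=> c x y; rewrite /theta_proj tensDr tensZr linearP. Qed.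

Lemma theta_ext (W : lmodType C) (L L' : coinv_rep T -> W) : linear L -> linear L' ->
  (forall phi v, L (theta_proj phi v) = L' (theta_proj phi v)) -> L = L'.
Proof.
move=> lL lL' LL'; apply/funext => x; have [t ->] := quot_projK x.
have z (f : coinv_rep T -> W) : linear f -> f 0 = 0.
  by move=> lf; have := lf (-1) 0 0; rewrite scaler0 addr0 scaleN1r addNr.
elim/tensor_ind: t => [c phi v y IHy|]; last by rewrite raddf0 !z.
by rewrite linearP lL lL' IHy -/(theta_proj phi v) LL'.
Qed.

(** Universal property: linear maps out of the coinvariants of a tensor product are the invariant
    bilinear maps. *)
Lemma theta_lift (W : lmodType C) (b : U -> V -> W) : bilin b ->
  (forall g phi v, b (act U (g, 1%g) phi) (act V g v) = b phi v) ->
  exists L : coinv_rep T -> W, linear L /\ forall phi v, L (theta_proj phi v) = b phi v.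
Proof.
move=> bb binv; pose B : {linear T -> W} := HB.pack (tensor_lift b)
  (GRing.isLinear.Build C T W *:%R (tensor_lift b) (tensor_lift_linear bb)).
have BE phi v : B (tens phi v) = b phi v by exact: (tensor_liftE bb).
have B0 x : x \in Defs.span (coinv_rel (V := T)) -> B x = 0.
  apply: span_ker => _ [g [t ->]]; apply/eqP; rewrite (linearB B) subr_eq0; apply/eqP.
  elim/tensor_ind: t => [c phi v y IHy|]; last by rewrite !linear0.
  rewrite (linearP (act T (g, 1%g))) !(linearP B) IHy; congr (_ *: _ + _).
  rewrite BE -(binv g) -BE; congr (B _); exact: tensor_actE.
exists (quot_lift B); split; first exact: quot_lift_linear.
by move=> phi v; rewrite /theta_proj quot_liftE// BE.
Qed.

End ThetaSpace.

Section WeilElements.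
Variables (R : realType) (F : nonArchLocalFieldType R) (m : nat).
Local Notation Phi := ('M[F]_m -> R[i]^o).

Definition schwartz_mod : submodClosed Phi := @schwartz R F m.
Definition weil_fun (phi : weil F m) : Phi := val (phi : submod schwartz_mod).
Definition weil_of (f : Phi) : weil F m := insubd (0 : submod schwartz_mod) f.

Lemma weil_fun_schw phi : schw (weil_fun phi).
Proof. exact: schwartz_schw (valP (phi : submod schwartz_mod)). Qed.

Lemma weil_ofK f : schw f -> weil_fun (weil_of f) = f.
Proof. by move=> fS; apply: insubdK; exact: schw_schwartz. Qed.

Lemma weil_fun_inj : injective weil_fun.
Proof. by move=> phi phi' e; exact: (val_inj (sT := submod schwartz_mod)). Qed.

Lemma weil_fun_linear c phi phi' : weil_fun (c *: phi + phi') = c *: weil_fun phi + weil_fun phi'.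
Proof. by []. Qed.

Lemma weil_fun_act h g phi X : weil_fun (act (weil F m) (h, g) phi) X =
  abs_det (val g) (- (m%:R / 2)) * abs_det (val h) (m%:R / 2) *:
    weil_fun phi (invmx (val g) *m X *m val h).
Proof. by []. Qed.

End WeilElements.

Section FourierModel.
Variables (R : realType) (F : nonArchLocalFieldType R) (psi : F -> R[i]) (delta : F).
Variables (k n : nat).
Hypothesis psiP : char_conductor psi delta.
Local Notation C := R[i].
Local Notation p := (\sum_(i < k.+1) n)%N.
Local Notation m := (\sum_(i < k.+2) n)%N.
Local Notation P := (head_rows F k n).
Local Notation Q := (last_rows F k n).
Local Notation E := (corner_rows F k n).
Local Notation S2 := (@schw2 R F m p n m C^o).
Local Notation omega := (@weil R F m).
Local Notation alpha := (n%:R - m%:R / 2 : R).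

Let PQ : row_splitting P Q. Proof. exact: head_last_splitting. Qed.
Let PL : P \in lat 1. Proof. by have [] := @head_last_integral R F k n. Qed.
Let QL : Q \in lat 1. Proof. by have [] := @head_last_integral R F k n. Qed.

Definition ft (phi : omega) : 'M[F]_(m, p) -> 'M[F]_(n, m) -> C^o :=
  pfourier psi P Q (weil_fun phi).

Definition ift (f : 'M[F]_(m, p) -> 'M[F]_(n, m) -> C^o) : omega :=
  weil_of (ipfourier psi delta P Q f).

Lemma ft_schw phi : S2 (ft phi).
Proof. exact: (pfourier_schw psiP PQ PL QL (weil_fun_schw phi)). Qed.

Lemma weil_fun_ift f : S2 f -> weil_fun (ift f) = ipfourier psi delta P Q f.
Proof. by move=> fS; apply: weil_ofK; exact: (ipfourier_schw psiP PQ PL QL). Qed.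

Lemma ftK phi : ift (ft phi) = phi.
Proof.
apply: weil_fun_inj; rewrite (weil_fun_ift (ft_schw phi)).
exact: (pfourierK psiP PQ PL QL (weil_fun_schw phi)).
Qed.

Lemma iftK f : S2 f -> ft (ift f) = f.
Proof. by move=> fS; rewrite /ft weil_fun_ift//; exact: (ipfourierK psiP PQ fS). Qed.

Lemma ft_linear c phi phi' : ft (c *: phi + phi') = fun Y Z => c *: ft phi Y Z + ft phi' Y Z.
Proof.
rewrite /ft weil_fun_linear.
exact: (pfourier_linear psiP PQ PL QL c (weil_fun_schw phi) (weil_fun_schw phi')).
Qed.

Lemma ift_linear c f g : S2 f -> S2 g ->
  ift (fun Y Z => c *: f Y Z + g Y Z) = c *: ift f + ift g.
Proof. by move=> fS gS; rewrite -[RHS]ftK ft_linear !iftK. Qed.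

(** The Jacobian |det b|^m turns the Weil exponent -m/2 of b into m/2, and |det h|^(m/2) |det
    h|^(-p) is |det h|^alpha because m = p + n. *)
Lemma ft_weil (h g : GL F m) b w d phi : val g = blockU P Q b w d ->
  ft (act omega (h, g) phi) = fun Y Z =>
    (abs_det b (m%:R / 2) * abs_det d (- (m%:R / 2)) * abs_det (val h) alpha *
     psi (\tr (w *m invmx d *m Z *m Y))) *:
    ft phi (invmx (val h) *m Y *m b) (invmx d *m Z *m val h).
Proof.
move=> gE; have hU := valP h; have := valP g; rewrite gE => /blockU_unit[bU dU].
have pS := weil_fun_schw phi; pose f X := weil_fun phi (invmx (blockU P Q b w d) *m X *m val h).
pose c := abs_det (val g) (- (m%:R / 2)) * abs_det (val h) (m%:R / 2).
have gU : invmx (blockU P Q b w d) \in unitmx by rewrite -gE unitmx_inv (valP g).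
have fS : schw f.
  exact: (schw_mulmx (f := fun X => weil_fun phi (X *m val h)) gU (schw_mulr hU pS)).
have -> : ft (act omega (h, g) phi) = fun Y Z => c *: pfourier psi P Q f Y Z.
  apply/funext => Y; apply/funext => Z.
  rewrite -(fourierZ psiP c _ (schw_rows PQ PL QL Z fS)); congr fourier.
  by apply/funext => X; rewrite weil_fun_act /f -gE.
apply/funext => Y; apply/funext => Z.
rewrite (pfourier_weil psiP PQ PL QL w bU dU hU pS) scalerA; congr (_ *: _).
rewrite /c gE {1}/abs_det (det_blockU PQ) // absFM powRM ?absF_ge0// rmorphM -!/(abs_det _ _).
rewrite !abs_det_vol -(abs_detNr _ hU).
have key (x1 x2 y1 z x3 y2 : C) :
    x1 * x2 * y1 * (z * (x3 * y2)) = (x3 * x1) * x2 * (y1 * y2) * z by ring.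
rewrite key -!abs_detD//; congr (_ * _ * _ * _); congr (abs_det _ _); first by field.
by rewrite block_size natrD; field.
Qed.

Lemma ft_left (h : GL F m) phi : ft (act omega (h, 1%g) phi) = act_pt alpha h (ft phi).
Proof.
rewrite (ft_weil h (g := 1%g) phi (esym (blockU1 PQ))).
apply/funext => Y; apply/funext => Z.
rewrite /act_pt !mul0mx mxtrace0 (char0 psiP) !abs_det1 !mul1r mulr1.
by rewrite invmx1 mul1mx mulmx1.
Qed.

Lemma ft_right (g : GL F m) (b : GL F p) w (d : GL F n) phi :
  val g = blockU P Q (val b) w (val d) ->
  ft (act omega (1%g, g) phi) = fun Y Z =>
    psi (\tr (w *m invmx (val d) *m (Z *m Y))) *: act_levi b d (ft phi) Y Z.
Proof.
move=> gE; rewrite (ft_weil _ _ gE); apply/funext => Y; apply/funext => Z.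
rewrite /act_levi GL_val1 abs_det1 mulr1 invmx1 mul1mx mulmx1 scalerA mulrC.
by rewrite !mulmxA.
Qed.

End FourierModel.

Section CharacterSupport.
Variables (R : realType) (F : nonArchLocalFieldType R) (psi : F -> R[i]) (delta : F).
Hypothesis psiP : char_conductor psi delta.
Hypothesis psi_nontrivial : exists x, psi x != 1.
Local Notation C := R[i].
Local Notation unif := (unif F).

Lemma char_lat1 p n (w : 'M[F]_(p, n)) : exists N, forall X : 'M[F]_(n, p),
  X \in lat (unif ^+ N) -> psi (\tr (w *m X)) = 1.
Proof.
have [s ws] := lat_bounded w.
have t0 : unif ^- s != 0 by rewrite invr_eq0 unifX_neq0.
have [N Ns] : exists N, absF unif ^+ N < absF (delta / unif ^- s).
  apply: unifX_small; rewrite absF_gt0; apply: mulf_neq0; first exact: conductor_neq0 psiP.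
  by rewrite invr_eq0.
exists N => X XN; apply: (char1 psiP t0) ws; apply: lat_le XN.
by rewrite absFX ltW.
Qed.

Lemma char_separates p n (X : 'M[F]_(n, p)) : X != 0 -> exists w, psi (\tr (w *m X)) != 1.
Proof.
move=> X0; have [t t1] := psi_nontrivial.
have [a [c Xac]] : exists a c, X a c != 0.
  apply: contrapT => h; case/eqP: X0; apply/matrixP => a c; rewrite mxE.
  by apply: contrapT => /eqP ac; apply: h; exists a, c.
exists ((t / X a c) *: delta_mx c a); rewrite -scalemxAl mxtraceZ.
have -> : \tr (delta_mx c a *m X) = X a c.
  rewrite /mxtrace (bigD1 c)//= [X in _ + X]big1 ?addr0 => [|b bc].
    by rewrite mxE (bigD1 a)//= [X in _ + X]big1 ?addr0 => [|b ba];
      rewrite !mxE ?eqxx ?mul1r// (negPf ba) andbF mul0r.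
  by rewrite mxE big1// => b' _; rewrite !mxE (negPf bc) mul0r.
by rewrite divfK.
Qed.

(* Near a point (Y, Z) off the fiber a suitable w makes psi(tr(w (ZY - E))) a
   constant different from 1, which kills the functional there. *)
Lemma char_fiber_supported m p n (E : 'M[F]_(n, p)) (W : lmodType C)
    (B : ('M[F]_(m, p) -> 'M[F]_(n, m) -> C^o) -> W) :
  linear_on (@schw2 R F m p n m C^o) B ->
  (forall (w : 'M[F]_(p, n)) f, schw2 f ->
     B (fun Y Z => psi (\tr (w *m (Z *m Y))) *: f Y Z) = psi (\tr (w *m E)) *: B f) ->
  fiber_supported E (@schw2 R F m p n m C^o) B.
Proof.
move=> lB Bw f fS f0; have [s [r [_ fr]]] := fS; apply: (local_vanishing lB fS) => Y Z.
have [ZY|/eqP ZY] := eqVneq (Z *m Y) E.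
  exists r => N y z rN yY zZ; rewrite -(subrK Y y) -(subrK Z z) addrC [_ + Z]addrC.
  by rewrite fr// f0// eqxx.
have /char_separates[w w1] : Z *m Y - E != 0 by rewrite subr_eq0; apply/eqP.
have [N0 wN] := char_lat1 w; have [r0 r0P] := mulmx_near Y Z N0.
exists r0 => N y z r0N yY zZ _; pose g := ind2 y z (unif ^+ N).
have gS : schw2 g by exact: ind2_schw.
have e : (fun Y' Z' => psi (\tr (w *m (Z' *m Y'))) *: g Y' Z') =
    fun Y' Z' => psi (\tr (w *m (Z *m Y))) *: g Y' Z'.
  apply/funext => Y'; apply/funext => Z'; rewrite /g ind2E.
  case: (boolP (_ && _)) => [/andP[Yy Zz]|_]; last by rewrite !scaler0.
  congr (_ *: _); rewrite -(subrK (Z *m Y) (Z' *m Y')) mulmxDr mxtraceD (charD psiP) wN ?mul1r//.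
  apply: r0P.
    by rewrite -(subrKA y) rpredD//; exact: lat_unifX Yy.
  by rewrite -(subrKA z) rpredD//; exact: lat_unifX Zz.
have := Bw w g gS; rewrite e (linear_onZ _ (schw2_subT F m p n) lB gS).
rewrite -{1}(subrK E (Z *m Y)) mulmxDr mxtraceD (charD psiP) -scalerA.
move: (psi _) (char_neq0 psiP (\tr (w *m E))) w1 => c; move: (psi _) => c' c'0 c1 /eqP.
rewrite !scalerA -subr_eq0 -scalerBl scaler_eq0 => /orP[|/eqP//].
by rewrite -{2}(mul1r c) -mulrBl mulf_eq0 subr_eq0 (negPf c1) (negPf c'0).
Qed.

End CharacterSupport.

Definition smooth_dual_mod (R : realType) (F : nonArchLocalFieldType R) m
  (pi : rep R[i] (GL F m)) : submodClosed (pi -> R[i]^o) := @smooth_dual R F m pi.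

Lemma contragredient_fixed (R : realType) (F : nonArchLocalFieldType R) m
    (pi : rep R[i] (GL F m)) (v : contragredient pi) : exists r, fixed_by r v.
Proof.
have /asboolP[_ /nbhs_lat[r rv]] := valP (v : submod (smooth_dual_mod pi)).
exists r => h hr; apply: val_inj; apply: (rv _ hr).
by rewrite addrC subrK.
Qed.

(** * The map between the two Hom spaces and its inverse *)

Section HomSpaces.
Variables (R : realType) (F : nonArchLocalFieldType R) (psi : F -> R[i]) (delta : F).
Variables (k n : nat) (pi : rep R[i] (GL F (\sum_(i < k.+2) n)%N)) (sigma : rep R[i] (GL F n)).
Hypothesis psiP : char_conductor psi delta.
Hypothesis psi_nontrivial : exists x, psi x != 1.
Local Notation C := R[i].
Local Notation K := k.+1.
Local Notation p := (\sum_(i < K) n)%N.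
Local Notation m := (\sum_(i < K.+1) n)%N.
Local Notation P := (head_rows F k n).
Local Notation Q := (last_rows F k n).
Local Notation E := (corner_rows F k n).
Local Notation S2 := (@schw2 R F m p n m C^o).
Local Notation omega := (weil F m).
Local Notation V := (contragredient pi).
Local Notation alpha := (n%:R - m%:R / 2 : R).
Local Notation proj := (@theta_proj C (GL F m) (GL F m) omega V).
Local Notation ft := (@ft R F psi k n).
Local Notation ift := (@ift R F psi delta k n).
Local Notation full := (@full_model R F m p n E V sigma alpha (@levi_pair R F k n)
  (@levi_act R F psi k n sigma) S2).
Local Notation value := (base_value P E (@contragredient_fixed R F m pi)).

Let PQ : row_splitting P Q. Proof. exact: head_last_splitting. Qed.
Let PQE : integral_splitting P Q E. Proof. exact: head_last_integral. Qed.
Let mE : m = (p + n)%N. Proof. exact: block_size. Qed.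

Definition equivariantN (L : big_theta pi -> sigma) := linear L /\
  forall d x, N_group x -> forall t,
    L (act (big_theta pi) (diagD K.+1 d * x)%g t) = N_char psi x *: act sigma d (L t).

Definition equivariantH (ell : V -> sigma) := linear ell /\
  forall d x, H_group x -> forall v, ell (act V (diagD' K.+1 d * x)%g v) =
    (abs_det (val d) ((K.+1%:R - 2) * n%:R / 2) * H_char psi x) *: act sigma d (ell v).

Definition theta_functional (L : big_theta pi -> sigma) f v : sigma := L (proj (ift f) v).

Lemma act_theta g phi v : act (big_theta pi) g (proj phi v) = proj (act omega (1%g, g) phi) v.
Proof. exact: theta_act. Qed.

(** Coinvariance under the first factor gives invariance under [act_pt]. The unipotent elements with
    block w multiply by a character of Z Y and thus confine the support to the fiber; the diagonal
    blocks give the Levi equivariance. *)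
Lemma theta_functional_model L : equivariantN L -> full (theta_functional L).
Proof.
move=> [lL LN]; have B1 v : linear_on S2 ((theta_functional L)^~ v).
  by move=> c f g fS gS; rewrite /theta_functional (ift_linear psiP)// theta_proj_linearl lL.
have act_ift x phi g : S2 g -> ft (act omega x phi) = g -> act omega x phi = ift g.
  by move=> gS <-; rewrite (ftK psiP).
have Bg (x : GL F m) (b : GL F p) (w : 'M[F]_(p, n)) (d : GL F n) f v : S2 f ->
    val x = blockU P Q (val b) w (val d) ->
    L (act (big_theta pi) x (proj (ift f) v)) = theta_functional L (fun Y Z =>
      psi (\tr (w *m invmx (val d) *m (Z *m Y))) *: act_levi b d f Y Z) v.
  move=> fS xE; rewrite act_theta /theta_functional; congr (L (proj _ v)).
  have := ft_right psiP (ift f) xE; rewrite (iftK psiP fS) => <-.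
  by rewrite (ftK psiP).
split; first split=> //.
- by move=> f fS c u v; rewrite /theta_functional theta_proj_linearr lL.
- move=> v; apply: (char_fiber_supported psiP psi_nontrivial (B1 v)) => w f fS.
  have xU : blockU P Q 1%:M w 1%:M \in unitmx.
    by rewrite unitmxE (det_blockU1 PQ) det1 unitr1.
  pose x : GL F m := Sub (blockU P Q 1%:M w 1%:M) xU.
  have xE : val x = blockU P Q (val (1%g : GL F p)) w (val (1%g : GL F n)) by [].
  have Nx : N_group x.
    apply: (@blockU_unipotent R F k n 1%:M w); exact: unipotent1.
  have := LN 1%g x Nx (proj (ift f) v).
  have -> : diagD K.+1 (1%g : GL F n) = 1%g :> GL F m by apply: val_inj; exact: bdiag1.
  rewrite mul1g act1 (Bg _ _ _ _ _ _ fS xE) (N_charE psiP) xE supertrace_blockU.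
  rewrite GL_val1 supertrace1 add0r mxtrace_mulC => <-.
  congr (theta_functional L _ v); apply/funext => Y; apply/funext => Z.
  by rewrite /act_levi !GL_val1 !abs_det1 invmx1 !mulmx1 mul1mx mul1r scale1r.
- move=> h f v fS; rewrite /theta_functional.
  have -> : ift (act_pt alpha h f) = act omega (h, 1%g) (ift f).
    by rewrite -[RHS](ftK psiP) (ft_left psiP) (iftK psiP fS).
  by congr L; exact: (theta_inv (U := omega) h (ift f) v).
move=> b d [u uN bE] f v fS.
have [x xE] : exists x : GL F m, val x = blockU P Q (val u) 0 1%:M.
  have xU : blockU P Q (val u) 0 1%:M \in unitmx.
    by rewrite unitmxE (det_blockU_diag PQ) -unitmxE (valP u).
  by exists (Sub (blockU P Q (val u) 0 1%:M) xU).
have Nx : N_group x.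
  by rewrite /N_group /= /block xE; exact: (@blockU_unipotent R F k n (val u) 0 uN).
have gE : val (diagD K.+1 d * x)%g = blockU P Q (val b) 0 (val d).
  by rewrite bE !GL_valM xE !val_diagD blockU_bdiag (blockUM PQ) mulmx0 mul0mx addr0 mulmx1.
have := LN d x Nx (proj (ift f) v); rewrite (Bg _ _ _ _ _ _ fS gE) bE levi_actE.
rewrite (N_charE psiP) xE supertrace_blockU mulmx0 mxtrace0 addr0 => <-.
congr (theta_functional L _ v); apply/funext => Y; apply/funext => Z.
by rewrite !mul0mx mxtrace0 (char0 psiP) scale1r.
Qed.

Lemma theta_functional_linear c L L' f v :
  theta_functional (c *: L + L') f v = c *: theta_functional L f v + theta_functional L' f v.
Proof. by []. Qed.

Lemma value_linear c L L' v : value (theta_functional (c *: L + L')) v =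
  c *: value (theta_functional L) v + value (theta_functional L') v.
Proof. by rewrite /base_value theta_functional_linear scalerDr !scalerA mulrC. Qed.

Lemma value_equivariant L : equivariantN L -> equivariantH (value (theta_functional L)).
Proof.
move=> LN; have mB := theta_functional_model LN.
have [l1 l2 l3] := base_value_equivariant PQ PQE (@contragredient_fixed R F m pi) mE erefl
  (@levi_corner R F k n) mB.
split=> // d x Hx v; have [u [z [g [uN Ez xE]]]] := H_group_blockU Hx.
have [y yE] : exists y : GL F m, val y = blockU P Q (val (diagD K d * u)%g) 0 1%:M.
  have yU : blockU P Q (val (diagD K d * u)%g) 0 1%:M \in unitmx.
    by rewrite unitmxE (det_blockU_diag PQ) -unitmxE (valP (diagD K d * u)%g).
  by exists (Sub (blockU P Q (val (diagD K d * u)%g) 0 1%:M) yU).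
have [t tE] : exists t : GL F m, val t = blockU P Q 1%:M (invmx (val u) *m z) (val g).
  have tU : blockU P Q 1%:M (invmx (val u) *m z) (val g) \in unitmx.
    by rewrite unitmxE (det_blockU1 PQ) -unitmxE (valP g).
  by exists (Sub (blockU P Q 1%:M (invmx (val u) *m z) (val g)) tU).
(* Factor the element into its block-diagonal part y, governed by the Levi clause, and t in the base
   stabilizer; the two clauses of [base_equivariant] then apply in turn. *)
have -> : (diagD' K.+1 d * x)%g = (y * t)%g.
  apply: val_inj; rewrite !GL_valM val_diagD' xE yE tE !(blockUM PQ) !mulmx1 !mul1mx.
  by rewrite GL_valM !mul0mx !addr0 val_diagD -!mulmxA mulKVmx// (valP u).
rewrite actM (l3 _ d y _ _ yE); last by exists u.
rewrite (l2 t _ _ _ tE); last first.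
  by rewrite mulmxA (corner_unipotent (unipotent_inv (valP u) uN)).
rewrite levi_actE (H_charE psiP xE) size_exponentN.
have tg : \det (val t) = \det (val g) by rewrite tE (det_blockU1 PQ).
rewrite (abs_det_eq alpha tg) (linearZ_LR (act sigma d)) !scalerA; congr (_ *: _).
have key (a b c : C) : a * b * c = a * (c * b) by ring.
exact: key.
Qed.

Lemma H_base_equivariant ell : equivariantH ell ->
  base_equivariant P Q E alpha (@levi_pair R F k n) (@levi_act R F psi k n sigma) ell.
Proof.
move=> [l1 lH]; split=> // [x z g v xE Ez|b d x v [u uN bE] xE].
  have Hx : H_group x by apply: (blockU_H_group _ Ez xE); exact: unipotent1.
  have := lH 1%g x Hx v; rewrite act1 abs_det1 mul1r (H_charE psiP xE) supertrace1 (char0 psiP).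
  have -> : diagD' K.+1 (1%g : GL F n) = 1%g.
    by apply: val_inj; rewrite val_diagD' bdiag1 (blockU1 PQ).
  rewrite mul1g mulr1 => ->; congr (_ *: _).
  by apply: abs_det_eq; rewrite xE (det_blockU1 PQ).
have [y yE] : exists y : GL F m, val y = blockU P Q (val u) 0 1%:M.
  have yU : blockU P Q (val u) 0 1%:M \in unitmx.
    by rewrite unitmxE (det_blockU_diag PQ) -unitmxE (valP u).
  by exists (Sub (blockU P Q (val u) 0 1%:M) yU).
have Hy : H_group y by apply: (blockU_H_group uN _ yE); rewrite mulmx0.
have -> : x = (diagD' K.+1 d * y)%g.
  apply: val_inj; rewrite GL_valM val_diagD' xE yE (blockUM PQ) bE GL_valM val_diagD.
  by rewrite mulmx0 mul0mx addr0 mulmx1.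
rewrite (lH d y Hy v) bE levi_actE (H_charE psiP yE) size_exponentN abs_det1 mul1r.
by rewrite scalerA.
Qed.

Let upperV (b : GL F p) (d : GL F n) : levi_pair b d -> upper_mx (@lvl K n) (invmx (val b)).
Proof. by case/levi_upper. Qed.

Let jumpP j nu (b : GL F p) : (j < K)%N -> jump_mx (@lvl K n) j nu -> val b = 1%:M + nu ->
  levi_pair b 1%g /\ forall w, @levi_act R F psi k n sigma b 1%g w = superchar psi nu *: w.
Proof. by move=> _; exact: levi_jump. Qed.

Let conjP j nu (b : GL F p) (d : GL F n) : (j < K)%N -> levi_pair b d ->
  jump_mx (@lvl K n) j nu ->
  jump_mx (@lvl K n) j (val b *m nu *m invmx (val b)) /\
  superchar psi (val b *m nu *m invmx (val b)) = superchar psi nu.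
Proof. by move=> _; exact: levi_conj. Qed.

Lemma value_inj L : equivariantN L -> (forall v, value (theta_functional L) v = 0) ->
  L = fun=> 0.
Proof.
move=> LN L0; have mB := theta_functional_model LN; have [lL _] := LN.
apply: theta_ext => //; first by move=> c x y; rewrite scaler0 addr0.
move=> phi v; have := full_model_eq0 PQ PQE (@corner_top R F k n) (@lvl_lt k n) upperV
  (ltn0Sn k) (superchar_generic psi_nontrivial) jumpP mB L0 v (ft_schw psiP phi).
by rewrite /theta_functional (ftK psiP).
Qed.

(** The functional supplied by [exists_model], composed with the Fourier transform, is an invariant
    bilinear map and so factors through Theta(pi). *)
Lemma value_surj ell : equivariantH ell ->
  exists2 L, equivariantN L & forall v, value (theta_functional L) v = ell v.
Proof.
move=> lH; have [B [[[B1 B1' B2 B3] BT] BV]] := exists_model PQ PQE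
  (@contragredient_fixed R F m pi) mE erefl (@levi_corner R F k n) (@corner_top R F k n)
  (@lvl_lt k n) (H_base_equivariant lH) upperV (ltn0Sn k) (superchar_generic psi_nontrivial)
  (@corner_jump R F k n) jumpP conjP.
pose b (phi : omega) (v : V) := B (ft phi) v.
have bb : bilin b.
  split=> [v c phi phi'|phi c u v]; last exact: (B1' _ (ft_schw psiP phi)).
  by rewrite /b (ft_linear psiP) B1//; exact: (ft_schw psiP).
have binv (g : GL F m) phi v : b (act omega (g, 1%g) phi) (act V g v) = b phi v.
  by rewrite /b (ft_left psiP) B3//; exact: (ft_schw psiP).
have [L [lL LE]] := theta_lift bb binv.
have LN : equivariantN L.
  split=> // d x Nx t; have [u [w [uN xE]]] := N_group_blockU Nx.
  have gE : val (diagD K.+1 d * x)%g = blockU P Q (val (diagD K d * u)%g)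
      (bdiag K (val d) *m w) (val d).
    by rewrite !GL_valM xE !val_diagD blockU_bdiag (blockUM PQ) mul0mx addr0 mulmx1.
  have dU := valP d.
  pose c := psi (\tr (E *m w)).
  have key phi v : L (act (big_theta pi) (diagD K.+1 d * x)%g (proj phi v)) =
      N_char psi x *: act sigma d (L (proj phi v)).
    rewrite act_theta !LE /b; have pS := ft_schw psiP phi.
    have aS : S2 (act_levi (diagD K d * u)%g d (ft phi)) by exact: act_levi_schw.
    rewrite (N_charE psiP) xE supertrace_blockU (charD psiP) mulrC -scalerA -levi_actE.
    rewrite -BT//; last by exists u.
    have gS := ft_schw psiP (act omega (1%g, diagD K.+1 d * x)%g phi).
    (* The block w is not part of the Levi data. On the fiber its character of Z Y takes the
       constant value c, so the two functions agree there and the support condition identifies their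
       images. *)
    have := B2 v _ (schw2D (schw2Z (- c) aS) gS) _; rewrite B1// => e.
    apply/eqP; rewrite -subr_eq0 addrC -scaleNr; apply/eqP; apply: e => Y Z ZY.
    rewrite (ft_right psiP phi gE) ZY scaleNr addrC -scalerBl.
    suff -> : \tr (bdiag K (val d) *m w *m invmx (val d) *m E) = \tr (E *m w).
      by rewrite subrr scale0r.
    rewrite mxtrace_mulC !mulmxA corner_bdiag mxtrace_mulC !mulmxA mulVmx// mul1mx//.
  have e : (fun t => L (act (big_theta pi) (diagD K.+1 d * x)%g t)) =
      (fun t => N_char psi x *: act sigma d (L t)).
    apply: theta_ext key => a t1 t2; first by rewrite linearP lL.
    by rewrite lL linearP scalerDr !scalerA mulrC.
  exact: (congr1 (fun f => f t) e).
exists L => // v; rewrite -BV /base_value; congr (_ *: _).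
rewrite /theta_functional LE /b (iftK psiP)//.
exact: (base_ind_schw PQE).
Qed.

End HomSpaces.

(** The correspondence L -> ell is defined on all functions, additive or not; only its restriction
    to the intertwiners has to be linear and bijective. *)
Lemma submod_lin_iso (C : fieldType) (U U' : lmodType C) (S : submodClosed U)
    (S' : submodClosed U') (T : U -> U') :
  (forall u, u \in S -> T u \in S') ->
  (forall c u v, u \in S -> v \in S -> T (c *: u + v) = c *: T u + T v) ->
  (forall u, u \in S -> T u = 0 -> u = 0) ->
  (forall u', u' \in S' -> exists2 u, u \in S & T u = u') ->
  lin_iso (submod S) (submod S').
Proof.
move=> TS Tlin Tinj Tsurj; pose f (u : submod S) : submod S' := Sub (T (val u)) (TS _ (valP u)).
have lf : linear f by move=> c u v; apply: val_inj; rewrite /= Tlin//; exact: valP.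
pose g : {linear submod S -> submod S'} := HB.pack f
  (GRing.isLinear.Build C (submod S) (submod S') *:%R f lf).
exists g; have ginj : injective g.
  move=> u v /(congr1 val) /= e; apply/eqP; rewrite -subr_eq0; apply/eqP/val_inj.
  apply: Tinj; first exact: valP.
  have -> : val (u - v) = -1 *: val v + val u by rewrite /= scaleN1r addrC.
  by rewrite Tlin; [rewrite e scaleN1r addNr|exact: valP|exact: valP].
have gsurj w : exists u, g u == w.
  have [u uS uw] := Tsurj _ (valP w); exists (Sub u uS).
  by apply/eqP/val_inj.
by exists (fun w => xchoose (gsurj w)) => [u|w]; [apply: ginj|];
  apply/eqP; exact: (xchooseP (gsurj _)).
Qed.

Theorem theorem1p1 (R : realType) (F : nonArchLocalFieldType R)
    (charF0 : [pchar F] =i pred0)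
    (psi : F -> R[i]) (psi_char : nontrivial_additive_char psi)
    (n k : nat) (n_ge1 : (1 <= n)%N) (k_ge2 : (2 <= k)%N)
    (pi : rep R[i] (GL F (\sum_(i < k) n)%N)) (pi_irr : smooth_irr pi)
    (sigma : rep R[i] (GL F n)) (sigma_irr : smooth_irr sigma) :
  lin_iso (Hom_DeltaN psi (big_theta pi) sigma)
          (Hom_DeltaH psi (contragredient pi) sigma).
Proof.
(* From here k + 2 replaces k, so that both the first k + 1 blocks and the last one exist by the
   shape of the index. *)
case: k k_ge2 pi pi_irr => [|[|k]] // _ pi _.
have [delta psiP] := exists_conductor psi_char; have [_ _ _ psi1] := psi_char.
pose T L := base_value (head_rows F k n) (corner_rows F k n) (@contragredient_fixed R F _ pi)
  (@theta_functional R F psi delta k n pi sigma L).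
have memN L : L \in intertwiner [set q : GL F n * GL F _ | N_group q.2]
    (fun q => act (big_theta pi) (diagD k.+2 q.1 * q.2)%g)
    (fun q => N_char psi q.2 \*: act sigma q.1) -> equivariantN psi L.
  by move=> /asboolP[lL LN]; split=> // d x Nx t; exact: (LN (d, x)).
apply: (submod_lin_iso (T := T)).
- move=> L /memN LN; have [lT TH] := value_equivariant psiP psi1 LN.
  by apply/asboolP; split=> // -[d x] Hx v; exact: TH.
- move=> c L L' /memN LN /memN LN'; apply/funext => v.
  exact: (@value_linear R F psi delta k n pi sigma c L L' v).
- move=> L /memN LN T0; apply: (value_inj psiP psi1 LN) => v.
  exact: (congr1 (fun f => f v) T0).
move=> ell /asboolP[lell ellH].
have [|L [lL LN] Lell] := @value_surj R F psi delta k n pi sigma psiP psi1 ell.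
  by split=> // d x Hx v; exact: (ellH (d, x)).
exists L; last exact/funext.
by apply/asboolP; split=> // -[d x] Nx t; exact: LN.
Qed.
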